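(* Assume that $\Re(c)>\Re(a)>0$ and $b\in\mathbb{C}$. Fix $\delta\in(0,\frac{\pi}{2})$ and take $\lambda:=\frac{y}{x}$ such that $$|\arg(\lambda)|\leqslant\frac{\pi}{2}-\delta,\qquad 0<\lambda_1\leqslant|\lambda|\leqslant\lambda_2<\infty$$ (with $\lambda_1,\lambda_2$ fixed). Then as $x\to+\infty$, we have the asymptotic expansions $$\Phi_1[a,b;c;-x,y]\sim\frac{\Gamma(c)}{\Gamma(a)}x^{-b}e^{y}\sum_{k=0}^{\infty}a_k^{(1)}(\lambda)\,y^{a-c-k},$$ $$\Phi_1[a,b;c;-x,-y]\sim\frac{\Gamma(c)}{\Gamma(c-a)}\sum_{k=0}^{\infty}a_k^{(2)}(\lambda)\,x^{-a-k},$$ where the coefficients are given by $$a_k^{(1)}(\lambda)=(b-a+1)_k\sum_{n=0}^{k}\frac{(b)_n(c-a)_{k-n}}{(b-a+1)_n\,n!\,(k-n)!}(-\lambda)^n,$$ $$a_k^{(2)}(\lambda)=\frac{(a)_k(a-c+1)_k}{k!}\,U(a+k,\,a-b+k+1,\,\lambda),$$ in which $U(a,b,z)$ denotes the Kummer $U$-function.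
   Context: $(\alpha)_n=\Gamma(\alpha+n)/\Gamma(\alpha)$ is the Pochhammer symbol; the quotient $(b-a+1)_k/(b-a+1)_n$ means $(b-a+1+n)_{k-n}$ when $b-a+1\in\mathbb{Z}_{\leqslant0}$. Here $x>0$ is real, powers take principal values, and $\sim$ denotes a Poincar\'e-type asymptotic expansion. The Kummer function satisfies $U(a,b,z)=\frac{1}{\Gamma(a)}\int_0^{\infty}t^{a-1}(1+t)^{b-a-1}e^{-zt}\,dt$ for $\Re(a)>0$, $|\arg z|<\frac{\pi}{2}$. The Humbert function $\Phi_1$ is defined for $|x|<1$, $y\in\mathbb{C}$ by $$\Phi_1[a,b;c;x,y]=\sum_{m,n=0}^{\infty}\frac{(a)_{m+n}(b)_m}{(c)_{m+n}}\frac{x^m}{m!}\frac{y^n}{n!},$$ and is continued analytically to all $x\in\mathbb{C}\setminus[1,\infty)$, $y\in\mathbb{C}$ by $$\Phi_1[a,b;c;x,y]=\sum_{n=0}^{\infty}\frac{(a)_n}{(c)_n}\,{}_2F_1\left[\begin{matrix}a+n,b\\ c+n\end{matrix};x\right]\frac{y^n}{n!}$$ (principal branch of ${}_2F_1$). *)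

(* Defs.v *)
(* Stdlib reals with Coquelicot: C is Coquelicot's type of complex numbers. *)
From Stdlib Require Import Reals Factorial Lia ClassicalEpsilon.
From Coquelicot Require Import Coquelicot.

Local Open Scope C_scope.

(** * Elementary functions, principal branches *)

Definition Cexp (z : C) : C :=
  (exp (Re z) * cos (Im z), exp (Re z) * sin (Im z))%R.

(* Takes its values in (-PI, PI]; the value at 0 is irrelevant. *)
Definition Carg (z : C) : R :=
  if Rle_dec 0 (Im z) then acos (Re z / Cmod z)
  else (- acos (Re z / Cmod z))%R.

Definition Clog (z : C) : C := (ln (Cmod z), Carg z).

(* Only meaningful for z <> 0. *)
Definition Cpower (z s : C) : C := Cexp (s * Clog z).

(** * Sums and integrals *)

(* Total operator: the sum of the series when it converges. *)
Definition CSeries (u : nat -> C) : C :=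
  @iota C_CompleteNormedModule (is_series u).

Lemma CSeries_unique (u : nat -> C) (l : C) : is_series u l -> CSeries u = l.
Proof.
intros Hl. unfold CSeries.
apply (@iota_unique C_AbsRing C_CompleteNormedModule); [ | exact Hl].
intros l' Hl'. exact (filterlim_locally_unique _ _ _ Hl' Hl).
Qed.

(* Improper integral over (0, +oo): both endpoints are limits. *)
Definition CInt_0_infty (f : R -> C) : C :=
  @RInt_gen C_R_CompleteNormedModule f (at_right 0) (Rbar_locally p_infty).

(** * Gamma function and Pochhammer symbols *)

(* Euler's integral; meaningful for Re z > 0. *)
Definition Cgamma (z : C) : C :=
  CInt_0_infty (fun t => Cpower (RtoC t) (z - 1) * Cexp (- RtoC t)).

(* alpha (alpha + 1) ... (alpha + n - 1): this is
   Gamma (alpha + n) / Gamma alpha, extended by continuity to the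
   nonpositive integers alpha, where that quotient is undefined. *)
Fixpoint poch (alpha : C) (n : nat) : C :=
  match n with
  | O => 1
  | S m => poch alpha m * (alpha + RtoC (INR m))
  end.

(* The quotient (alpha)_k / (alpha)_n for n <= k, with its conventional value
   when (alpha)_n vanishes; see poch_quotE for the other alpha. *)
Definition poch_quot (alpha : C) (k n : nat) : C :=
  poch (alpha + RtoC (INR n)) (k - n).

Lemma poch_add (alpha : C) (n m : nat) :
  poch alpha (n + m) = poch alpha n * poch (alpha + RtoC (INR n)) m.
Proof.
induction m as [|m IH]; simpl.
- rewrite Nat.add_0_r. ring.
- rewrite Nat.add_succ_r. simpl. rewrite IH, plus_INR, RtoC_plus. ring.
Qed.

Lemma poch_quotE (alpha : C) (k n : nat) :
  (n <= k)%nat -> poch alpha n <> 0 ->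
  poch_quot alpha k n = poch alpha k / poch alpha n.
Proof.
intros Hnk Hn. unfold poch_quot.
replace k with (n + (k - n))%nat at 2 by lia.
rewrite poch_add. field. exact Hn.
Qed.

(** * Gauss's hypergeometric function, principal branch *)

(* Analyticity as the existence of a local power series expansion. *)
Definition analytic_at (f : C -> C) (z0 : C) : Prop :=
  exists (u : nat -> C) (r : R), (0 < r)%R /\
    forall z : C, (Cmod (z - z0) < r)%R -> is_pseries u (z - z0) (f z).

(* z lies in C \ [1, +oo) *)
Definition off_cut (z : C) : Prop := ~ (Im z = 0%R /\ (1 <= Re z)%R).

(* F restricts, on C \ [1, +oo), to the analytic continuation of the
   hypergeometric series; these conditions determine F there. *)
Definition is_hyp2F1 (a b c : C) (F : C -> C) : Prop :=
  (forall z : C, (Cmod z < 1)%R ->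
     is_pseries
       (fun n => poch a n * poch b n / (poch c n * RtoC (INR (fact n))))
       z (F z)) /\
  (forall z : C, off_cut z -> analytic_at F z).

(* Meaningful on C \ [1, +oo), for c not a nonpositive integer. *)
Definition hyp2F1 (a b c : C) : C -> C :=
  epsilon (inhabits (fun _ : C => RtoC 0)) (is_hyp2F1 a b c).

(** * Humbert's function Phi_1 and Kummer's function U *)

(* The continuation to x in C \ [1, +oo) and all y of the double series
   sum_(m,n) (a)_(m+n) (b)_m / (c)_(m+n) x^m/m! y^n/n!. *)
Definition Phi1 (a b c x y : C) : C :=
  CSeries (fun n =>
    poch a n / poch c n
    * hyp2F1 (a + RtoC (INR n)) b (c + RtoC (INR n)) x
    * (y ^ n / RtoC (INR (fact n)))).

(* Meaningful for Re a > 0 and |arg z| < PI / 2. *)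
Definition KummerU (a b z : C) : C :=
  / Cgamma a *
  CInt_0_infty (fun t =>
    Cpower (RtoC t) (a - 1) * Cpower (1 + RtoC t) (b - a - 1)
    * Cexp (- z * RtoC t)).

(** * Poincare-type expansions as x -> +oo, uniform in a second variable *)

(* F ~ g * sum_k coef_k * phi_k: for each N, the error after the term of
   index N is o(g phi_N), uniformly over the y with D x y. *)
Definition poincare_expansion (D : R -> C -> Prop) (F g : R -> C -> C)
    (coef phi : nat -> R -> C -> C) : Prop :=
  forall (N : nat) (eps : R), (0 < eps)%R ->
    Rbar_locally p_infty (fun x : R => forall y : C, D x y ->
      (Cmod (F x y - g x y * sum_n (fun k => (coef k x y * phi k x y)%C) N)
       <= eps * Cmod (g x y * phi N x y))%R).

(** * Coefficients of the two expansions *)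

Definition coef1 (a b c lambda : C) (k : nat) : C :=
  sum_n (fun n =>
    poch_quot (b - a + 1) k n
    * (poch b n * poch (c - a) (k - n)
       / (RtoC (INR (fact n)) * RtoC (INR (fact (k - n)))))
    * (- lambda) ^ n) k.

Definition coef2 (a b c lambda : C) (k : nat) : C :=
  poch a k * poch (a - c + 1) k / RtoC (INR (fact k))
  * KummerU (a + RtoC (INR k)) (a - b + RtoC (INR k) + 1) lambda.

Definition lambda_region (delta lambda1 lambda2 : R) (x : R) (y : C) : Prop :=
  let lambda := y / RtoC x in
  (Rabs (Carg lambda) <= PI / 2 - delta)%R /\
  (lambda1 <= Cmod lambda <= lambda2)%R.

(* Main.v *)
Require Import Defs.
From Stdlib Require Import Reals Lra Lia Psatz Factorial ClassicalEpsilon.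
From Coquelicot Require Import Coquelicot.

(** Both expansions are Laplace-type asymptotics of one integral. The
    quotient (a)_n / (c)_n is a ratio of Beta integrals, so integrating the
    exponential series term by term gives, for x >= 0,

      Phi_1[a,b;c;-x,y] = 1 / B(a,c-a) *
        int_0^1 t^(a-1) (1-t)^(c-a-1) (1+xt)^(-b) e^(yt) dt     [Phi1_euler].

    The values of 2F1 that occur in Phi_1 are given implicitly, by the series
    in the unit disk and by analyticity off [1,+oo). Euler's integral has
    these properties [euler_is_hyp2F1], and two functions that have them agree
    on the negative axis [hyp2F1_unique].

    With -y in place of y, the integral concentrates at t of order 1/x. The
    factor (1-t)^(c-a-1) is replaced by its Taylor polynomial, and each term is
    integrated over the whole half line, which gives the Kummer functions
    [expansion_origin]. With y itself, put t = 1-s and take e^y x^(-b) out: the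
    factor (1-s)^(a-1) (1-s+1/x)^(-b) is expanded in s and 1/x together
    [taylor2_remainder], and the terms are Gamma integrals with the complex
    rate y, that is Gamma(z) y^(-z) [is_int_gamma_fun_complex].

    One estimate, [watson], controls the error in both cases. The kernel is at
    most (1+xt)^beta e^(-mu x t), with mu > 0 because of the sector condition,
    hence at most a constant times (xt)^(-M) for whichever M >= 0 suits the
    region of t under consideration; this produces the powers of x without any
    rescaling of the variable.

    The same estimate shows that n^q B(q,p+1+n) tends to Gamma(q). For p = 0
    this is Gauss's product formula for Gamma; combined with that formula, the
    general case yields B(q,p) Gamma(p+q) = Gamma(p) Gamma(q) [beta_gamma]. An
    elementary bound of Gauss's product from below shows that Gamma has no
    zero in the right half plane [Cgamma_neq_0], so that all the quotients in
    the statement are genuine. *)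

Local Open Scope R_scope.

(** * Calculus for complex functions of a real variable *)

Definition derivC (F : R -> C) (t : R) (l : C) : Prop :=
  is_derive (fun s => fst (F s)) t (fst l) /\
  is_derive (fun s => snd (F s)) t (snd l).

Definition contC (F : R -> C) (t : R) : Prop :=
  continuous (fun s => fst (F s)) t /\ continuous (fun s => snd (F s)) t.

Lemma derivC_contC F t l : derivC F t l -> contC F t.
Proof.
intros [H1 H2]; split.
- exact (ex_derive_continuous (fun s => fst (F s)) t (ex_intro _ _ H1)).
- exact (ex_derive_continuous (fun s => snd (F s)) t (ex_intro _ _ H2)).
Qed.

Lemma derivC_const c t : derivC (fun _ => c) t 0%C.
Proof. split; simpl; apply @is_derive_const. Qed.

Lemma derivC_RtoC f t l : is_derive f t l -> derivC (fun s => RtoC (f s)) t l.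
Proof. intros H; split; simpl; [exact H | apply @is_derive_const]. Qed.

Lemma derivC_plus F G t l m :
  derivC F t l -> derivC G t m -> derivC (fun s => F s + G s)%C t (l + m)%C.
Proof. intros [A B] [D E]; split; apply @is_derive_plus; assumption. Qed.

Lemma derivC_opp F t l : derivC F t l -> derivC (fun s => - F s)%C t (- l)%C.
Proof. intros [A B]; split; apply @is_derive_opp; assumption. Qed.

Lemma derivC_minus F G t l m :
  derivC F t l -> derivC G t m -> derivC (fun s => F s - G s)%C t (l - m)%C.
Proof. intros H K; apply derivC_plus, derivC_opp; assumption. Qed.

Lemma is_derive_Rmult (f g : R -> R) t l m :
  is_derive f t l -> is_derive g t m ->
  is_derive (fun s => f s * g s) t (l * g t + f t * m).
Proof.
intros H K. apply (is_derive_mult f g t l m H K). intros n p; apply Rmult_comm.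
Qed.

Lemma derivC_eq F t l m : derivC F t l -> l = m -> derivC F t m.
Proof. intros H <-; exact H. Qed.

Lemma derivC_mult F G t l m :
  derivC F t l -> derivC G t m ->
  derivC (fun s => F s * G s)%C t (l * G t + F t * m)%C.
Proof.
intros [A B] [D E]; split.
- simpl.
  replace (fst l * fst (G t) - snd l * snd (G t) + (fst (F t) * fst m - snd (F t) * snd m))
   with (minus (fst l * fst (G t) + fst (F t) * fst m) (snd l * snd (G t) + snd (F t) * snd m)).
  + apply @is_derive_minus; apply is_derive_Rmult; assumption.
  + unfold minus, plus, opp; simpl; ring.
- simpl.
  replace (fst l * snd (G t) + snd l * fst (G t) + (fst (F t) * snd m + snd (F t) * fst m))
   with (plus (fst l * snd (G t) + fst (F t) * snd m) (snd l * fst (G t) + snd (F t) * fst m)).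
  + apply @is_derive_plus; apply is_derive_Rmult; assumption.
  + unfold plus; simpl. ring.
Qed.

Lemma derivC_scal c F t l : derivC F t l -> derivC (fun s => c * F s)%C t (c * l)%C.
Proof.
intros H. eapply derivC_eq; [apply derivC_mult; [apply derivC_const | exact H]|]. cbv beta; ring.
Qed.

Lemma derivC_Cexp F t l :
  derivC F t l -> derivC (fun s => Cexp (F s)) t (Cexp (F t) * l)%C.
Proof.
intros [A B]. unfold Cexp, Re, Im; split; simpl.
- replace (exp (fst (F t)) * cos (snd (F t)) * fst l - exp (fst (F t)) * sin (snd (F t)) * snd l)
  with ((fst l * exp (fst (F t))) * cos (snd (F t)) + exp (fst (F t)) * (snd l * - sin (snd (F t)))) by ring.
  apply (is_derive_Rmult (fun s => exp (fst (F s))) (fun s => cos (snd (F s)))).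
  + apply (is_derive_comp exp (fun s => fst (F s))); [apply is_derive_exp | exact A].
  + apply (is_derive_comp cos (fun s => snd (F s))); [apply is_derive_cos | exact B].
- replace (exp (fst (F t)) * cos (snd (F t)) * snd l + exp (fst (F t)) * sin (snd (F t)) * fst l)
  with ((fst l * exp (fst (F t))) * sin (snd (F t)) + exp (fst (F t)) * (snd l * cos (snd (F t)))) by ring.
  apply (is_derive_Rmult (fun s => exp (fst (F s))) (fun s => sin (snd (F s)))).
  + apply (is_derive_comp exp (fun s => fst (F s))); [apply is_derive_exp | exact A].
  + apply (is_derive_comp sin (fun s => snd (F s))); [apply is_derive_sin | exact B].
Qed.

Lemma contC_mult F G t : contC F t -> contC G t -> contC (fun s => F s * G s)%C t.
Proof.
intros [A B] [D E]; split; simpl.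
- apply @continuous_minus; apply @continuous_mult; assumption.
- apply @continuous_plus; apply @continuous_mult; assumption.
Qed.

Lemma contC_const c t : contC (fun _ => c) t.
Proof. split; apply continuous_const. Qed.

Lemma contC_pow F n t : contC F t -> contC (fun s => F s ^ n)%C t.
Proof.
intros H; induction n; simpl; [apply contC_const | apply contC_mult; assumption].
Qed.

Lemma Cmod_sqr z : Cmod z ^ 2 = fst z ^ 2 + snd z ^ 2.
Proof. unfold Cmod. rewrite pow2_sqrt; [reflexivity | nra]. Qed.

Lemma Cmod_dot_le z w : fst z * fst w + snd z * snd w <= Cmod z * Cmod w.
Proof.
assert (H := Rle_abs (fst z * fst w + snd z * snd w)).
assert (K := re_le_Cmod (z * Cconj w)%C).
rewrite Cmod_mult, Cmod_conj in K. unfold Re in K; simpl in K.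
replace (fst z * fst w - snd z * - snd w) with (fst z * fst w + snd z * snd w) in K by ring.
lra.
Qed.

Lemma incr_of_derive (h dh : R -> R) a b :
  a <= b -> (forall t, a <= t <= b -> is_derive h t (dh t)) ->
  (forall t, a <= t <= b -> 0 <= dh t) -> h a <= h b.
Proof.
intros Hab H K.
destruct (MVT_gen h a b dh) as [c [Hc E]].
- intros x Hx. apply H. rewrite Rmin_left, Rmax_right in Hx; lra.
- intros x Hx. rewrite Rmin_left, Rmax_right in Hx by lra.
  apply continuity_pt_filterlim. apply (ex_derive_continuous h x).
  eexists; apply H; lra.
- rewrite Rmin_left, Rmax_right in Hc by lra. specialize (K c Hc). nra.
Qed.

(** Let u be the total increment of F. By the Cauchy-Schwarz inequality |u| G
    - <u, F> is nondecreasing, and the increment of <u, F> is |u|^2. *)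
Lemma mean_value_ineq F f G g a b :
  a <= b ->
  (forall t, a <= t <= b -> derivC F t (f t)) ->
  (forall t, a <= t <= b -> is_derive G t (g t)) ->
  (forall t, a <= t <= b -> Cmod (f t) <= g t) ->
  Cmod (F b - F a)%C <= G b - G a.
Proof.
intros Hab HF HG Hle.
set (u := (F b - F a)%C).
assert (M : Cmod u * G a - (fst u * fst (F a) + snd u * snd (F a))
         <= Cmod u * G b - (fst u * fst (F b) + snd u * snd (F b))).
{ apply (incr_of_derive (fun t => Cmod u * G t - (fst u * fst (F t) + snd u * snd (F t)))
     (fun t => Cmod u * g t - (fst u * fst (f t) + snd u * snd (f t))) a b Hab).
  - intros t Ht. destruct (HF t Ht) as [A B]. specialize (HG t Ht).
    apply @is_derive_minus.
    + apply (is_derive_scal G t (Cmod u) (g t)); exact HG.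
    + apply @is_derive_plus.
      * apply (is_derive_scal (fun t => fst (F t))); exact A.
      * apply (is_derive_scal (fun t => snd (F t))); exact B.
  - intros t Ht. assert (D := Cmod_dot_le u (f t)). specialize (Hle t Ht).
    assert (P := Cmod_ge_0 u). nra. }
assert (E : Cmod u ^ 2 = fst u * fst (F b) + snd u * snd (F b) - (fst u * fst (F a) + snd u * snd (F a))).
{ rewrite Cmod_sqr. unfold u; simpl; ring. }
assert (Q : G a <= G b).
{ apply (incr_of_derive G g); auto. intros t Ht.
  apply Rle_trans with (2 := Hle t Ht), Cmod_ge_0. }
assert (P := Cmod_ge_0 u).
destruct (Req_dec (Cmod u) 0) as [Z|Z]; [lra|].
apply Rmult_le_reg_l with (Cmod u); nra.
Qed.

(** * Exponential, logarithm and powers on the cut plane *)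

Lemma Cexp_0 : Cexp 0%C = 1%C.
Proof. unfold Cexp; simpl. rewrite exp_0, cos_0, sin_0. unfold RtoC; f_equal; ring. Qed.

Lemma Cexp_plus z w : Cexp (z + w)%C = (Cexp z * Cexp w)%C.
Proof.
unfold Cexp, Re, Im, Cmult; simpl. rewrite exp_plus, cos_plus, sin_plus.
f_equal; ring.
Qed.

Lemma Cmod_Cexp z : Cmod (Cexp z) = exp (fst z).
Proof.
unfold Cmod, Cexp, Re, Im; simpl fst; simpl snd.
replace ((exp (fst z) * cos (snd z)) ^ 2 + (exp (fst z) * sin (snd z)) ^ 2)
  with ((exp (fst z))^2 * ((sin (snd z))² + (cos (snd z))²)) by (unfold Rsqr; ring).
rewrite sin2_cos2, Rmult_1_r. apply sqrt_pow2. left; apply exp_pos.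
Qed.

Lemma Cexp_neq_0 z : Cexp z <> 0%C.
Proof.
intros H. assert (K := Cmod_Cexp z). rewrite H, Cmod_0 in K.
assert (P := exp_pos (fst z)); lra.
Qed.

Lemma Cexp_RtoC x : Cexp (RtoC x) = RtoC (exp x).
Proof. unfold Cexp, RtoC; simpl. rewrite cos_0, sin_0. f_equal; ring. Qed.

(** The plane cut along (-oo, 0]. *)
Definition slit (z : C) : Prop := 0 < Cmod z + fst z.

(** The principal logarithm. The half-angle formula for the argument, unlike
    the arc cosine with its sign distinction, is differentiable on the whole
    cut plane at once. *)
Definition slitlog (z : C) : C := (ln (Cmod z), 2 * atan (snd z / (Cmod z + fst z))).

Lemma slit_Re z : 0 < fst z -> slit z.
Proof. unfold slit; intros. assert (P := Cmod_ge_0 z); lra. Qed.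

Lemma slit_Im z : snd z <> 0 -> slit z.
Proof.
unfold slit; intros H. assert (P := Cmod_ge_0 z).
assert (E := Cmod_sqr z). assert (0 < snd z ^ 2) by nra. nra.
Qed.

Lemma slit_Cmod z : slit z -> 0 < Cmod z.
Proof.
unfold slit; intros H. assert (P := Cmod_ge_0 z). assert (E := Cmod_sqr z).
destruct P as [P|P]; [exact P|]. rewrite <- P in *. nra.
Qed.

Lemma cos_2atan u : cos (2 * atan u) = (1 - u^2) / (1 + u^2).
Proof.
rewrite cos_2a, cos_atan, sin_atan.
assert (S : 0 < 1 + u²) by (unfold Rsqr; nra).
assert (Q : sqrt (1 + u²) * sqrt (1 + u²) = 1 + u²) by (apply sqrt_sqrt; lra).
assert (N : sqrt (1 + u²) <> 0) by (apply Rgt_not_eq, sqrt_lt_R0; lra).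
replace (1 / sqrt (1 + u²) * (1 / sqrt (1 + u²)) - u / sqrt (1 + u²) * (u / sqrt (1 + u²)))
  with ((1 - u * u) / (sqrt (1 + u²) * sqrt (1 + u²))) by (field; exact N).
rewrite Q. unfold Rsqr in *. simpl. rewrite !Rmult_1_r. reflexivity.
Qed.

Lemma sin_2atan u : sin (2 * atan u) = 2 * u / (1 + u^2).
Proof.
rewrite sin_2a, cos_atan, sin_atan.
assert (S : 0 < 1 + u²) by (unfold Rsqr; nra).
assert (Q : sqrt (1 + u²) * sqrt (1 + u²) = 1 + u²) by (apply sqrt_sqrt; lra).
assert (N : sqrt (1 + u²) <> 0) by (apply Rgt_not_eq, sqrt_lt_R0; lra).
replace (2 * (u / sqrt (1 + u²)) * (1 / sqrt (1 + u²)))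
  with ((2 * u) / (sqrt (1 + u²) * sqrt (1 + u²))) by (field; exact N).
rewrite Q. unfold Rsqr in *. simpl. rewrite !Rmult_1_r. reflexivity.
Qed.

Lemma Cexp_slitlog z : slit z -> Cexp (slitlog z) = z.
Proof.
intros H. assert (P := slit_Cmod z H). assert (E := Cmod_sqr z).
unfold slit in H. unfold Cexp, slitlog, Re, Im; simpl fst; simpl snd.
rewrite exp_ln by exact P. rewrite cos_2atan, sin_2atan.
destruct z as [p q]; simpl fst in *; simpl snd in *.
set (r := Cmod (p, q)) in *.
assert (D : 1 + (q / (r + p))^2 = 2 * r / (r + p)).
{ apply Rmult_eq_reg_r with ((r+p)^2); [|nra].
  replace ((1 + (q / (r + p)) ^ 2) * (r + p) ^ 2) with ((r+p)^2 + q^2) by (field; lra).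
  replace (2 * r / (r + p) * (r + p) ^ 2) with (2 * r * (r + p)) by (field; lra). nra. }
assert (D' : 1 - (q / (r + p))^2 = 2 * p / (r + p)).
{ apply Rmult_eq_reg_r with ((r+p)^2); [|nra].
  replace ((1 - (q / (r + p)) ^ 2) * (r + p) ^ 2) with ((r+p)^2 - q^2) by (field; lra).
  replace (2 * p / (r + p) * (r + p) ^ 2) with (2 * p * (r + p)) by (field; lra). nra. }
rewrite D, D'. f_equal; field; lra.
Qed.

Lemma slitlog_RtoC t : 0 < t -> slitlog (RtoC t) = RtoC (ln t).
Proof.
intros H. unfold slitlog. rewrite Cmod_R, Rabs_pos_eq by lra. unfold RtoC; simpl.
unfold Rdiv; rewrite Rmult_0_l, atan_0, Rmult_0_r. reflexivity.
Qed.

(** With F = p + i q and r = |F|, the argument has derivative (p q' - q p') /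
    r^2; only r^2 = p^2 + q^2 enters the simplification. *)
Lemma derivC_slitlog F t l :
  slit (F t) -> derivC F t l -> derivC (fun s => slitlog (F s)) t (l / F t)%C.
Proof.
intros S [A B]. assert (P := slit_Cmod _ S). assert (E := Cmod_sqr (F t)).
unfold slit in S.
assert (DR : is_derive (fun s => Cmod (F s)) t
   ((fst (F t) * fst l + snd (F t) * snd l) / Cmod (F t))).
{ unfold Cmod.
  replace ((fst (F t) * fst l + snd (F t) * snd l) / sqrt (fst (F t) ^ 2 + snd (F t) ^ 2))
   with ((fst l * (2 * fst (F t)) + snd l * (2 * snd (F t))) / (2 * sqrt (fst (F t) ^ 2 + snd (F t) ^ 2))).
  2:{ fold (Cmod (F t)). field. lra. }
  apply (is_derive_sqrt (fun s => fst (F s) ^ 2 + snd (F s) ^ 2)).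
  2:{ rewrite <- E. nra. }
  - apply @is_derive_plus.
    + apply (is_derive_comp (fun x => x ^ 2) (fun s => fst (F s))); [|exact A].
      auto_derive; [trivial | ring].
    + apply (is_derive_comp (fun x => x ^ 2) (fun s => snd (F s))); [|exact B].
      auto_derive; [trivial | ring]. }
set (r := Cmod (F t)) in *. set (p := fst (F t)) in *. set (q := snd (F t)) in *.
assert (HR : p * (p * 1) + q * (q * 1) = r * r) by nra.
unfold slitlog; split; simpl.
- match goal with |- is_derive _ _ ?X =>
    replace X with ((p * fst l + q * snd l) / r * / r) end.
  + apply (is_derive_comp ln (fun s => Cmod (F s))); [apply is_derive_ln; exact P | exact DR].
  + fold p q. rewrite HR. field. lra.
- match goal with |- is_derive _ _ ?X =>
    replace X with (2 * (((snd l * (r + p) - q * ((p * fst l + q * snd l) / r + fst l)) / (r + p)^2) * / (1 + (q / (r + p))²))) end.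
  + apply (is_derive_scal (fun s => atan (snd (F s) / (Cmod (F s) + fst (F s))))).
    apply (is_derive_comp atan (fun s => snd (F s) / (Cmod (F s) + fst (F s)))).
    * apply is_derive_atan.
    * apply (is_derive_div (fun s => snd (F s)) (fun s => Cmod (F s) + fst (F s))).
      -- exact B.
      -- apply @is_derive_plus; assumption.
      -- unfold r, p in S. lra.
  + fold p q. rewrite HR.
    assert (D : 1 + (q / (r + p))² = 2 * r / (r + p)).
    { unfold Rsqr. apply Rmult_eq_reg_r with ((r+p)^2); [|nra].
      replace ((1 + q / (r + p) * (q / (r + p))) * (r + p) ^ 2) with ((r+p)^2 + q^2) by (field; lra).
      replace (2 * r / (r + p) * (r + p) ^ 2) with (2 * r * (r + p)) by (field; lra). nra. }
    rewrite D.
    assert (Q : q * q = r * r - p * p) by nra.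
    replace (2 * ((snd l * (r + p) - q * ((p * fst l + q * snd l) / r + fst l)) / (r + p) ^ 2 * / (2 * r / (r + p))))
     with ((snd l * (r + p) * r - q * p * fst l - (q * q) * snd l - q * fst l * r) / (r * r * (r + p))) by (field; lra).
    rewrite Q. field. lra.
Qed.

(** t^z for a positive real t, and below u^z for u in the cut plane. *)
Definition rpw (t : R) (z : C) : C := Cexp (z * RtoC (ln t))%C.
Definition spw (u : C) (z : C) : C := Cexp (z * slitlog u)%C.

Lemma spw_RtoC t z : 0 < t -> spw t z = rpw t z.
Proof. intros H; unfold spw, rpw. now rewrite slitlog_RtoC. Qed.

Lemma Cmod_rpw t z : Cmod (rpw t z) = Rpower t (fst z).
Proof. unfold rpw, Rpower. rewrite Cmod_Cexp. simpl. f_equal; ring. Qed.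

Lemma rpw_plus t z w : rpw t (z + w)%C = (rpw t z * rpw t w)%C.
Proof. unfold rpw. rewrite <- Cexp_plus. f_equal; ring. Qed.

Lemma spw_plus t z w : spw t (z + w)%C = (spw t z * spw t w)%C.
Proof. unfold spw. rewrite <- Cexp_plus. f_equal; ring. Qed.

Lemma rpw_1 t : 0 < t -> rpw t 1%C = t.
Proof. intros H. unfold rpw. rewrite Cmult_1_l, Cexp_RtoC, exp_ln; auto. Qed.

Lemma spw_1 u : slit u -> spw u 1%C = u.
Proof. intros H. unfold spw. rewrite Cmult_1_l. now apply Cexp_slitlog. Qed.

Lemma rpw_0 t : rpw t 0%C = 1%C.
Proof. unfold rpw. rewrite Cmult_0_l. apply Cexp_0. Qed.

Lemma spw_0 t : spw t 0%C = 1%C.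
Proof. unfold spw. rewrite Cmult_0_l. apply Cexp_0. Qed.

Lemma rpw_mult s t z : 0 < s -> 0 < t -> rpw (s * t) z = (rpw s z * rpw t z)%C.
Proof.
intros; unfold rpw. rewrite ln_mult, RtoC_plus, <- Cexp_plus by assumption. f_equal; ring.
Qed.

Lemma rpw_base_1 z : rpw 1 z = 1%C.
Proof. unfold rpw. rewrite ln_1, Cmult_0_r. apply Cexp_0. Qed.

Lemma rpw_nat t n : 0 < t -> rpw t (INR n) = RtoC (t ^ n).
Proof.
intros H. unfold rpw. rewrite <- RtoC_mult, Cexp_RtoC. f_equal.
rewrite <- Rpower_pow by exact H. reflexivity.
Qed.

Lemma derivC_spw F t l z :
  slit (F t) -> derivC F t l ->
  derivC (fun s => spw (F s) z) t (z * l * spw (F t) (z - 1))%C.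
Proof.
intros S H. unfold spw at 1. eapply derivC_eq.
- apply derivC_Cexp, derivC_scal, derivC_slitlog; eassumption.
- cbv beta. replace (Cexp (z * slitlog (F t))) with (spw (F t) (z - 1) * F t)%C.
  + field. intros Z. apply slit_Cmod in S. rewrite Z, Cmod_0 in S. lra.
  + rewrite <- (spw_1 (F t) S) at 2. rewrite <- spw_plus. unfold spw. f_equal. f_equal. ring.
Qed.

Lemma derivC_rpw t z : 0 < t -> derivC (fun s => rpw s z) t (z * rpw t (z - 1))%C.
Proof.
intros H. unfold rpw at 1. eapply derivC_eq.
- apply derivC_Cexp, derivC_scal, derivC_RtoC, is_derive_ln, H.
- cbv beta. replace (Cexp (z * RtoC (ln t))) with (rpw t (z - 1) * t)%C.
  + rewrite RtoC_inv by lra. field. intros Z; apply RtoC_inj in Z; lra.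
  + rewrite <- (rpw_1 t H). rewrite <- rpw_plus. unfold rpw. f_equal. f_equal. ring.
Qed.

Lemma derivC_comp F g t l m :
  derivC F (g t) l -> is_derive g t m -> derivC (fun s => F (g s)) t (m * l)%C.
Proof.
intros [A B] G. split; simpl.
- replace (m * fst l - 0 * snd l) with (m * fst l) by ring.
  apply (is_derive_comp (fun x => fst (F x)) g); assumption.
- replace (m * snd l + 0 * fst l) with (m * snd l) by ring.
  apply (is_derive_comp (fun x => snd (F x)) g); assumption.
Qed.

(** * Improper integrals through primitives *)

Ltac unfold_ball H :=
  unfold ball in H; simpl in H; unfold AbsRing_ball, abs, minus, plus, opp in H; simpl in H.
Ltac unfold_ball_goal :=
  unfold ball; simpl; unfold AbsRing_ball, abs, minus, plus, opp; simpl.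

Definition limat {T : Type} (Fl : (T -> Prop) -> Prop) (F : T -> C) (L : C) : Prop :=
  forall eps, 0 < eps -> Fl (fun t => Cmod (F t - L)%C < eps).

(** Only finite right ends and +oo are meant. *)
Definition right_end (b : Rbar) : (R -> Prop) -> Prop :=
  match b with Finite b => at_left b | _ => Rbar_locally p_infty end.

Definition inI (a : R) (b : Rbar) (t : R) : Prop := a < t /\ Rbar_lt t b.

#[local] Instance right_end_proper b : ProperFilter (right_end b).
Proof.
destruct b; simpl; [apply at_left_proper_filter| |]; apply (Rbar_locally_filter p_infty).
Qed.

#[local] Instance at_right_proper a : ProperFilter (at_right a).
Proof. apply at_right_proper_filter. Qed.

Lemma right_end_inI (a : R) b (s : R) : Rbar_lt a b -> Rbar_lt s b ->
  right_end b (fun t => inI a b t /\ s < t).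
Proof.
intros Hab Hs. unfold inI. destruct b as [b| |]; simpl in *.
- assert (P : 0 < b - Rmax a s) by (apply Rlt_0_minus, Rmax_lub_lt; assumption).
  exists (mkposreal _ P). intros t Ht Htb.
  unfold_ball Ht.
  apply Rabs_def2 in Ht. assert (U := Rmax_l a s). assert (V := Rmax_r a s). repeat split; lra.
- exists (Rmax a s). intros t Ht. assert (U := Rmax_l a s). assert (V := Rmax_r a s). repeat split; lra.
- contradiction.
Qed.

Lemma at_right_inI (a : R) b (s : R) : Rbar_lt a b -> a < s ->
  at_right a (fun t => inI a b t /\ t < s).
Proof.
intros Hab Hs. unfold inI.
assert (K : forall d, 0 < d -> at_right a (fun t => a < t /\ t < a + d)).
{ intros d P. exists (mkposreal _ P). intros t Ht Htb.
  unfold_ball Ht.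
  apply Rabs_def2 in Ht. lra. }
destruct b as [b| |]; simpl in *.
- assert (P : 0 < Rmin b s - a) by (apply Rlt_0_minus, Rmin_glb_lt; assumption).
  eapply filter_imp; [|exact (K _ P)]. intros t Ht. simpl.
  assert (U := Rmin_l b s). assert (V := Rmin_r b s). repeat split; lra.
- assert (P : 0 < s - a) by lra.
  eapply filter_imp; [|exact (K _ P)]. intros t Ht. simpl. repeat split; lra.
- contradiction.
Qed.

Lemma inI_between a b s t u : inI a b s -> inI a b t -> s <= u <= t -> inI a b u.
Proof.
intros [A _] [_ B] H. split; [lra|]. destruct b; simpl in *; try lra; auto.
Qed.

Lemma inI_nonempty (a : R) b : Rbar_lt a b -> exists c, inI a b c.
Proof.
intros H. destruct (filter_ex _ (right_end_inI a b a H H)) as [c Hc]. exists c; tauto.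
Qed.

Lemma inI_locally a b t : inI a b t -> locally t (fun s => inI a b s).
Proof.
intros [A B]. apply filter_and.
- apply (open_gt a t A).
- destruct b as [b| |]; simpl in *.
  + apply (open_lt b t B).
  + apply filter_forall; auto.
  + contradiction.
Qed.

Section Lim.
Context {T : Type} {Fl : (T -> Prop) -> Prop} {PF : ProperFilter Fl}.

Lemma limat_unique F L M : limat Fl F L -> limat Fl F M -> L = M.
Proof.
intros H K. destruct (Ceq_dec L M) as [E|E]; [exact E|exfalso].
assert (P : 0 < Cmod (L - M)%C / 2).
{ assert (0 < Cmod (L - M)%C); [|lra]. apply Cmod_gt_0. intros Z. apply E.
  replace L with (L - M + M)%C by ring. rewrite Z; ring. }
destruct (filter_ex _ (filter_and _ _ (H _ P) (K _ P))) as [t [A B]].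
assert (Tr := Cmod_triangle (L - F t)%C (F t - M)%C).
replace (L - F t + (F t - M))%C with (L - M)%C in Tr by ring.
rewrite <- (Cmod_opp (L - F t)%C) in Tr. replace (- (L - F t))%C with (F t - L)%C in Tr by ring.
lra.
Qed.

Lemma limat_ext F G L : Fl (fun t => F t = G t) -> limat Fl F L -> limat Fl G L.
Proof.
intros E H eps P. generalize (filter_and _ _ E (H eps P)). apply filter_imp.
intros t [<- K]; exact K.
Qed.

Lemma limat_const L : limat Fl (fun _ => L) L.
Proof.
intros eps P. apply filter_forall. intros _. replace (L - L)%C with (RtoC 0) by ring. now rewrite Cmod_0.
Qed.

Lemma limat_plus F G L M :
  limat Fl F L -> limat Fl G M -> limat Fl (fun t => F t + G t)%C (L + M)%C.
Proof.
intros H K eps P. assert (P2 : 0 < eps / 2) by lra.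
generalize (filter_and _ _ (H _ P2) (K _ P2)). apply filter_imp.
intros t [A B]. replace (F t + G t - (L + M))%C with (F t - L + (G t - M))%C by ring.
eapply Rle_lt_trans; [apply Cmod_triangle|lra].
Qed.

Lemma limat_scal c F L : limat Fl F L -> limat Fl (fun t => c * F t)%C (c * L)%C.
Proof.
intros H eps P. assert (Q := Cmod_ge_0 c).
assert (P2 : 0 < eps / (Cmod c + 1)) by (apply Rdiv_lt_0_compat; lra).
generalize (H _ P2). apply filter_imp. intros t A.
replace (c * F t - c * L)%C with (c * (F t - L))%C by ring. rewrite Cmod_mult.
apply Rle_lt_trans with (Cmod c * (eps / (Cmod c + 1))).
- apply Rmult_le_compat_l; lra.
- apply Rmult_lt_reg_r with (Cmod c + 1); [lra|]. field_simplify; nra.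
Qed.

Lemma limat_filterlim F L : limat Fl F L ->
  filterlim (fun t => fst (F t)) Fl (locally (fst L)) /\
  filterlim (fun t => snd (F t)) Fl (locally (snd L)).
Proof.
intros H; split; apply filterlim_locally; intros eps; generalize (H _ (cond_pos eps));
 apply filter_imp; intros t Ht;
 unfold_ball_goal;
 eapply Rle_lt_trans; try exact Ht;
 eapply Rle_trans; try apply (Rmax_Cmod (F t - L)%C); simpl;
 [apply (Rmax_l) | apply Rmax_r].
Qed.

Lemma filterlim_limat F L :
  filterlim (fun t => fst (F t)) Fl (locally (fst L)) ->
  filterlim (fun t => snd (F t)) Fl (locally (snd L)) -> limat Fl F L.
Proof.
intros H K eps P. assert (P2 : 0 < eps / 2) by lra.
assert (H' := proj1 (filterlim_locally _ _) H (mkposreal _ P2)).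
assert (K' := proj1 (filterlim_locally _ _) K (mkposreal _ P2)).
generalize (filter_and _ _ H' K'). apply filter_imp.
unfold_ball_goal.
intros t [A B].
eapply Rle_lt_trans; [apply Cmod_2Rmax|].
assert (S : sqrt 2 < 2).
{ rewrite <- (sqrt_pow2 2) at 2 by lra. apply sqrt_lt_1; lra. }
assert (S0 := sqrt_pos 2).
assert (M : Rmax (Rabs (fst (F t - L)%C)) (Rabs (snd (F t - L)%C)) < eps / 2).
{ apply Rmax_lub_lt; assumption. }
assert (M0 : 0 <= Rmax (Rabs (fst (F t - L)%C)) (Rabs (snd (F t - L)%C))).
{ eapply Rle_trans; [|apply Rmax_l]. apply Rabs_pos. }
nra.
Qed.

Lemma limat_cauchy F :
  (forall eps, 0 < eps -> exists P : T -> Prop, Fl P /\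
     forall u v, P u -> P v -> Cmod (F u - F v)%C < eps) ->
  exists L, limat Fl F L.
Proof.
intros H.
assert (A : exists y : R, filterlim (fun t => fst (F t)) Fl (locally y)).
{ apply (proj1 (filterlim_locally_cauchy (U := R_CompleteSpace) (F := Fl) (fun t => fst (F t)))).
  intros eps. destruct (H _ (cond_pos eps)) as [P [HP K]]. exists P; split; [exact HP|].
  intros u v Hu Hv. unfold_ball_goal.
  eapply Rle_lt_trans; [|apply (K v u Hv Hu)]. apply (re_le_Cmod (F v - F u)%C). }
assert (B : exists y : R, filterlim (fun t => snd (F t)) Fl (locally y)).
{ apply (proj1 (filterlim_locally_cauchy (U := R_CompleteSpace) (F := Fl) (fun t => snd (F t)))).
  intros eps. destruct (H _ (cond_pos eps)) as [P [HP K]]. exists P; split; [exact HP|].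
  intros u v Hu Hv. unfold_ball_goal.
  eapply Rle_lt_trans; [|apply (K v u Hv Hu)].
  eapply Rle_trans; [|apply (Rmax_Cmod (F v - F u)%C)]. apply Rmax_r. }
destruct A as [x A]; destruct B as [y B]. exists (x, y). now apply filterlim_limat.
Qed.
End Lim.

(** The integral over (a, b) is the increment of a primitive between its
    one-sided limits. For continuous integrands it is the improper Riemann
    integral [is_int_CInt]; in this form substitution, splitting and
    integration by parts are statements about primitives. *)
Definition is_int (a : R) (b : Rbar) (f : R -> C) (l : C) : Prop :=
  exists (F : R -> C) (La Lb : C),
    (forall t, inI a b t -> derivC F t (f t)) /\
    limat (at_right a) F La /\ limat (right_end b) F Lb /\ l = (Lb - La)%C.

Lemma is_int_ext a b f g l :
  (forall t, inI a b t -> f t = g t) -> is_int a b f l -> is_int a b g l.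
Proof.
intros E (F & La & Lb & H & A & B & K). exists F, La, Lb. split; [intros t Ht|split; [|split]]; auto.
rewrite <- E by assumption; now apply H.
Qed.

Lemma is_int_eq a b f l m : is_int a b f l -> l = m -> is_int a b f m.
Proof. now intros H <-. Qed.

Lemma is_int_plus a b f g l m :
  is_int a b f l -> is_int a b g m -> is_int a b (fun t => f t + g t)%C (l + m)%C.
Proof.
intros (F & La & Lb & H & A & B & K) (G & Ma & Mb & H' & A' & B' & K').
exists (fun t => F t + G t)%C, (La + Ma)%C, (Lb + Mb)%C. split; [intros t Ht|split; [|split]].
- apply derivC_plus; auto.
- now apply limat_plus.
- now apply limat_plus.
- subst; ring.
Qed.

Lemma is_int_scal a b c f l :
  is_int a b f l -> is_int a b (fun t => c * f t)%C (c * l)%C.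
Proof.
intros (F & La & Lb & H & A & B & K).
exists (fun t => c * F t)%C, (c * La)%C, (c * Lb)%C. split; [intros t Ht|split; [|split]].
- apply derivC_scal; auto.
- now apply limat_scal.
- now apply limat_scal.
- subst; ring.
Qed.

Lemma is_int_minus a b f g l m :
  is_int a b f l -> is_int a b g m -> is_int a b (fun t => f t - g t)%C (l - m)%C.
Proof.
intros H K. apply (is_int_ext _ _ (fun t => f t + (- (1)) * g t)%C); [intros; ring|].
replace (l - m)%C with (l + (- (1)) * m)%C by ring.
apply is_int_plus; [exact H|]. now apply is_int_scal.
Qed.

Lemma is_int_sum a b (f : nat -> R -> C) (l : nat -> C) N :
  (forall n, (n <= N)%nat -> is_int a b (f n) (l n)) ->
  is_int a b (fun t => sum_n (fun n => f n t) N) (sum_n l N).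
Proof.
induction N; intros H.
- rewrite sum_O. apply (is_int_ext _ _ (f 0%nat)); [intros; now rewrite sum_O|]. now apply H.
- rewrite sum_Sn. apply (is_int_ext a b (fun t => sum_n (fun n => f n t) N + f (S N) t)%C); [intros; now rewrite sum_Sn|].
  apply is_int_plus; [|apply H; lia]. apply IHN. intros; apply H; lia.
Qed.

(** The mean value inequality between the two primitives, passed to the limit
    at both ends. *)
Lemma is_int_le (a : R) b f l g m :
  Rbar_lt a b -> is_int a b f l -> is_int a b (fun t => RtoC (g t)) m ->
  (forall t, inI a b t -> Cmod (f t) <= g t) -> Cmod l <= Re m.
Proof.
intros Hab (F & La & Lb & H & A & B & ->) (G & Ma & Mb & H' & A' & B' & ->) Hle.
apply le_epsilon. intros eps He. assert (P : 0 < eps / 4) by lra.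
destruct (inI_nonempty a b Hab) as [c Hc].
destruct (filter_ex _ (filter_and _ _ (filter_and _ _ (A _ P) (A' _ P)) (at_right_inI a b c Hab (proj1 Hc))))
  as [s [[As As'] [Is Hs]]].
destruct (filter_ex _ (filter_and _ _ (filter_and _ _ (B _ P) (B' _ P)) (right_end_inI a b c Hab (proj2 Hc))))
  as [t [[Bt Bt'] [It Ht]]].
assert (M : Cmod (F t - F s)%C <= Re (G t) - Re (G s)).
{ apply (mean_value_ineq F f (fun x => Re (G x)) g s t); [lra| | |].
  - intros x Hx. apply H. now apply (inI_between a b s t).
  - intros x Hx. apply (H' x). now apply (inI_between a b s t).
  - intros x Hx. apply Hle. now apply (inI_between a b s t). }
assert (T : Cmod (Lb - La)%C <= Cmod (F t - F s)%C + Cmod (F t - Lb)%C + Cmod (F s - La)%C).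
{ replace (Lb - La)%C with ((F t - F s) + - (F t - Lb) + (F s - La))%C by ring.
  eapply Rle_trans; [apply Cmod_triangle|]. apply Rplus_le_compat_r.
  eapply Rle_trans; [apply Cmod_triangle|]. rewrite Cmod_opp. lra. }
assert (U := re_le_Cmod (G t - Mb)%C). assert (V := re_le_Cmod (G s - Ma)%C).
unfold Re in *; simpl in *.
assert (U' := Rle_abs (fst (G t) + - fst Mb)). assert (V' := Rle_abs (- (fst (G s) + - fst Ma))).
rewrite Rabs_Ropp in V'. lra.
Qed.

Lemma is_int_unique (a : R) b f l m : Rbar_lt a b -> is_int a b f l -> is_int a b f m -> l = m.
Proof.
intros Hab H K. assert (D := is_int_minus _ _ _ _ _ _ H K).
assert (Z : is_int a b (fun _ => RtoC 0) 0%C).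
{ exists (fun _ => 0%C), 0%C, 0%C. split; [intros; apply derivC_const|split; [apply limat_const|split; [apply limat_const|ring]]]. }
assert (E : Cmod (l - m)%C <= Re (RtoC 0)).
{ apply (is_int_le a b _ _ (fun _ => 0) _ Hab D Z). intros t _.
  replace (f t - f t)%C with (RtoC 0) by ring. rewrite Cmod_0; lra. }
simpl in E. assert (Cmod (l - m)%C = 0) by (assert (W := Cmod_ge_0 (l - m)%C); lra).
apply Cmod_eq_0 in H0. replace l with (l - m + m)%C by ring. rewrite H0; ring.
Qed.

Lemma is_derive_RInt_inI a b (f : R -> R) c t :
  (forall s, inI a b s -> continuous f s) -> inI a b c -> inI a b t ->
  is_derive (fun t => RInt f c t) t (f t).
Proof.
intros Hf Hc Ht. apply (is_derive_RInt f _ c).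
- generalize (inI_locally _ _ _ Ht). apply filter_imp. intros s Hs.
  apply (RInt_correct (V := R_CompleteNormedModule)). apply (ex_RInt_continuous (V := R_CompleteNormedModule)).
  intros z Hz. apply Hf. unfold Rmin, Rmax in Hz. destruct (Rle_dec c s).
  + now apply (inI_between a b c s).
  + now apply (inI_between a b s c).
- now apply Hf.
Qed.

(** The increments of a primitive of f are bounded by those of a primitive of
    g, hence it satisfies the Cauchy criterion at both ends. *)
Lemma is_int_dominated (a : R) b f g m :
  Rbar_lt a b -> (forall t, inI a b t -> contC f t) ->
  (forall t, inI a b t -> Cmod (f t) <= g t) ->
  is_int a b (fun t => RtoC (g t)) m ->
  exists l, is_int a b f l /\ Cmod l <= Re m.
Proof.
intros Hab Hf Hle HG.
assert (E : exists l, is_int a b f l).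
{ destruct (inI_nonempty a b Hab) as [c Hc].
  set (F := fun t => (RInt (fun s => fst (f s)) c t, RInt (fun s => snd (f s)) c t) : C).
  assert (HF : forall t, inI a b t -> derivC F t (f t)).
  { intros t Ht; split; simpl; apply (is_derive_RInt_inI a b); auto; intros s Hs; now apply Hf. }
  destruct HG as (G & Ma & Mb & H' & A' & B' & ->).
  assert (LE : forall s t, s <= t -> inI a b s -> inI a b t -> Cmod (F t - F s)%C <= Cmod (G t - G s)%C).
  { intros s t Hst Hs Ht. eapply Rle_trans; [|eapply Rle_trans; [|apply (re_le_Cmod (G t - G s)%C)]].
    2:{ apply Rle_abs. }
    apply (mean_value_ineq F f (fun x => Re (G x)) g s t Hst).
    - intros x Hx. apply HF. now apply (inI_between a b s t).
    - intros x Hx. apply (H' x). now apply (inI_between a b s t).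
    - intros x Hx. apply Hle. now apply (inI_between a b s t). }
  assert (SYM : forall x y : C, Cmod (x - y)%C = Cmod (y - x)%C).
  { intros x y. rewrite <- Cmod_opp. f_equal; ring. }
  assert (LE2 : forall s t, inI a b s -> inI a b t -> Cmod (F t - F s)%C <= Cmod (G t - G s)%C).
  { intros s t Hs Ht. destruct (Rle_dec s t); [now apply LE|].
    rewrite (SYM (F t)), (SYM (G t)). apply LE; auto; lra. }
  assert (CAU : forall Fl M, ProperFilter Fl -> Fl (inI a b) -> limat Fl G M -> exists L, limat Fl F L).
  { intros Fl M PF HI HM. apply limat_cauchy. intros eps P. assert (P2 : 0 < eps / 2) by lra.
    exists (fun t => inI a b t /\ Cmod (G t - M)%C < eps / 2). split.
    - apply filter_and; [exact HI | apply HM; exact P2].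
    - intros u v [Iu Hu] [Iv Hv]. eapply Rle_lt_trans; [apply LE2; auto|].
      replace (G u - G v)%C with ((G u - M) + (M - G v))%C by ring.
      eapply Rle_lt_trans; [apply Cmod_triangle|]. rewrite (SYM M). lra. }
  destruct (CAU (at_right a) Ma) as [La HLa]; auto using at_right_proper.
  { eapply filter_imp; [|apply (at_right_inI a b c Hab (proj1 Hc))]. intros x Hx; apply Hx. }
  destruct (CAU (right_end b) Mb) as [Lb HLb]; auto using right_end_proper.
  { eapply filter_imp; [|apply (right_end_inI a b c Hab (proj2 Hc))]. intros x Hx; apply Hx. }
  exists (Lb - La)%C, F, La, Lb. auto. }
destruct E as [l Hl]. exists l; split; [exact Hl|]. now apply (is_int_le a b f l g m).
Qed.

Lemma is_int_CInt f l :
  (forall t, 0 < t -> contC f t) -> is_int 0 p_infty f l -> CInt_0_infty f = l.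
Proof.
intros Hf (F & La & Lb & H & A & B & ->).
unfold CInt_0_infty.
apply (@is_RInt_gen_unique C_R_CompleteNormedModule (at_right 0) (Rbar_locally p_infty)).
- apply Proper_StrongProper, at_right_proper_filter.
- apply Proper_StrongProper, Rbar_locally_filter.
- unfold is_RInt_gen.
  apply limat_filterlim in A. apply limat_filterlim in B.
  intros P [eps HP]. unfold filtermapi.
  assert (P2 : 0 < eps / 2) by (destruct eps as [e He]; simpl; lra).
  destruct A as [A1 A2]. destruct B as [B1 B2].
  assert (A1' := proj1 (filterlim_locally _ _) A1 (mkposreal _ P2)).
  assert (A2' := proj1 (filterlim_locally _ _) A2 (mkposreal _ P2)).
  assert (B1' := proj1 (filterlim_locally _ _) B1 (mkposreal _ P2)).
  assert (B2' := proj1 (filterlim_locally _ _) B2 (mkposreal _ P2)).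
  apply (Filter_prod _ _ _
    (fun s => (ball (fst La) (eps/2) (fst (F s)) /\ ball (snd La) (eps/2) (snd (F s))) /\ (inI 0 p_infty s /\ s < 1))
    (fun t => (ball (fst Lb) (eps/2) (fst (F t)) /\ ball (snd Lb) (eps/2) (snd (F t))) /\ (inI 0 p_infty t /\ 1 < t))).
  + apply filter_and; [apply filter_and; assumption|]. apply at_right_inI; simpl; auto; lra.
  + apply (filter_and (F := Rbar_locally p_infty)); [apply (filter_and (F := Rbar_locally p_infty)); assumption|].
    apply (right_end_inI 0 p_infty 1); simpl; auto.
  + intros s t [[S1 S2] [Is Hs]] [[T1 T2] [It Ht]]. simpl fst; simpl snd.
    exists (F t - F s)%C. split.
    * apply (@is_RInt_fct_extend_pair R_NormedModule R_NormedModule f s t).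
      -- apply (is_RInt_derive (V := R_CompleteNormedModule) (fun x => fst (F x)) (fun x => fst (f x))).
         ++ intros x Hx. rewrite Rmin_left, Rmax_right in Hx by lra. apply H. now apply (inI_between _ _ s t).
         ++ intros x Hx. rewrite Rmin_left, Rmax_right in Hx by lra. apply Hf. destruct Is; lra.
      -- apply (is_RInt_derive (V := R_CompleteNormedModule) (fun x => snd (F x)) (fun x => snd (f x))).
         ++ intros x Hx. rewrite Rmin_left, Rmax_right in Hx by lra. apply H. now apply (inI_between _ _ s t).
         ++ intros x Hx. rewrite Rmin_left, Rmax_right in Hx by lra. apply Hf. destruct Is; lra.
    * apply HP.
      unfold ball in S1, S2, T1, T2; simpl in S1, S2, T1, T2;
       unfold AbsRing_ball, abs, minus, plus, opp in S1, S2, T1, T2; simpl in S1, S2, T1, T2.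
      apply Rabs_def2 in S1, S2, T1, T2.
      split; simpl; unfold_ball_goal;
      apply Rabs_def1; lra.
Qed.

Lemma is_int_scale f l x : 0 < x ->
  is_int 0 p_infty f l -> is_int 0 p_infty (fun t => x * f (x * t)%R)%C l.
Proof.
intros Hx (F & La & Lb & H & A & B & ->).
exists (fun t => F (x * t)), La, Lb. split; [|split; [|split; [|reflexivity]]].
- intros t [Ht _]. apply (derivC_comp F (fun t => x * t)).
  + apply H. split; simpl; auto. nra.
  + auto_derive; [trivial|ring].
- intros eps P. destruct (A eps P) as [d Hd].
  assert (Q : 0 < d / x) by (apply Rdiv_lt_0_compat; [apply cond_pos|lra]).
  exists (mkposreal _ Q). intros t Ht Htb. apply Hd; [|nra].
  unfold_ball_goal. unfold_ball Ht.
  rewrite Ropp_0, Rplus_0_r in *. rewrite Rabs_mult, (Rabs_pos_eq x) by lra.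
  apply Rmult_lt_reg_r with (/ x); [now apply Rinv_0_lt_compat|].
  replace (x * Rabs t * / x) with (Rabs t) by (field; lra). exact Ht.
- intros eps P. destruct (B eps P) as [M HM]. exists (Rmax M (M / x)). intros t Ht. apply HM.
  assert (U := Rmax_r M (M / x)). assert (W : M / x < t) by lra.
  apply Rmult_lt_compat_l with (1 := Hx) in W. replace (x * (M / x)) with M in W by (field; lra). exact W.
Qed.

Lemma is_int_reflect f l :
  is_int 0 1 f l -> is_int 0 1 (fun t => f (1 - t)%R) l.
Proof.
intros (F & La & Lb & H & A & B & ->).
exists (fun t => - F (1 - t)%R)%C, (- Lb)%C, (- La)%C. split; [|split; [|split; [|ring]]].
- intros t [Ht Ht1]; simpl in Ht1. eapply derivC_eq.
  + apply derivC_opp. apply (derivC_comp F (fun t => 1 - t) t (f (1 - t)) (-1)).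
    * apply H. split; simpl; lra.
    * auto_derive; [trivial|ring].
  + replace (RtoC (-1)) with (- (1))%C; [ring|]. rewrite <- RtoC_opp. f_equal.
- intros eps P. destruct (B eps P) as [d Hd]. exists d. intros t Ht Htb.
  replace (- F (1 - t)%R - - Lb)%C with (- (F (1 - t)%R - Lb))%C by ring. rewrite Cmod_opp.
  apply Hd; [|lra].
  unfold_ball_goal. unfold_ball Ht.
  replace (1 - t + - (1)) with (- (t + - 0)) by ring. now rewrite Rabs_Ropp.
- intros eps P. destruct (A eps P) as [d Hd]. exists d. intros t Ht Htb.
  replace (- F (1 - t)%R - - La)%C with (- (F (1 - t)%R - La))%C by ring. rewrite Cmod_opp.
  apply Hd; [|lra].
  unfold_ball_goal. unfold_ball Ht.
  replace (1 - t + - 0) with (- (t + - (1))) by ring. now rewrite Rabs_Ropp.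
Qed.

Lemma contC_limat F t Fl : Filter Fl -> filter_le Fl (locally t) -> contC F t -> limat Fl F (F t).
Proof.
intros FF Hle [A B] eps P. apply Hle.
apply (@filterlim_limat R (locally t) _ F (F t) A B eps P).
Qed.

(** A primitive on (0, +oo) is continuous at 1. *)
Lemma is_int_split f l :
  is_int 0 p_infty f l ->
  exists l1 l2, is_int 0 1 f l1 /\ is_int 1 p_infty f l2 /\ l = (l1 + l2)%C.
Proof.
intros (F & La & Lb & H & A & B & ->).
assert (CF : contC F 1). { eapply derivC_contC. apply H. split; simpl; auto; lra. }
exists (F 1 - La)%C, (Lb - F 1)%C. split; [|split; [|ring]].
- exists F, La, (F 1). split; [intros t [Ht _]|split; [|split]]; auto.
  + apply H. split; simpl; auto.
  + apply contC_limat; [typeclasses eauto | apply filter_le_within | exact CF].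
- exists F, (F 1), Lb. split; [intros t [Ht _]|split; [|split]]; auto.
  + apply H. split; simpl; auto; lra.
  + apply contC_limat; [typeclasses eauto | apply filter_le_within | exact CF].
Qed.

(** * Series and term-by-term integration *)

Lemma is_series_limat (u : nat -> C) (l : C) :
  limat eventually (sum_n u) l -> @is_series C_AbsRing C_NormedModule u l.
Proof.
intros H P [eps HP]. unfold filtermap.
destruct (limat_filterlim _ _ H) as [A B].
assert (A' := proj1 (filterlim_locally _ _) A eps).
assert (B' := proj1 (filterlim_locally _ _) B eps).
generalize (filter_and _ _ A' B'). apply filter_imp. intros n [U V]. apply HP. split; assumption.
Qed.

Lemma limat_is_series (u : nat -> C) (l : C) :
  @is_series C_AbsRing C_NormedModule u l -> limat eventually (sum_n u) l.
Proof.
intros H. apply filterlim_limat; apply filterlim_locally; intros eps;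
 assert (K := proj1 (filterlim_locally _ _) H eps); revert K; apply filter_imp; intros n [U V]; assumption.
Qed.

Lemma Cmod_sum_n (u : nat -> C) N : Cmod (sum_n u N) <= sum_n (fun n => Cmod (u n)) N.
Proof.
induction N; [rewrite !sum_O; lra|]. rewrite !sum_Sn.
eapply Rle_trans; [apply Cmod_triangle|]. now apply Rplus_le_compat_r.
Qed.

Lemma sum_n_R_le (u v : nat -> R) N : (forall n, (n <= N)%nat -> u n <= v n) -> sum_n u N <= sum_n v N.
Proof.
induction N; intros H; [rewrite !sum_O; apply H; lia|]. rewrite !sum_Sn.
apply Rplus_le_compat; [apply IHN; intros; apply H; lia|apply H; lia].
Qed.

Lemma sum_n_R_scal (u : nat -> R) c N : sum_n (fun n => u n * c) N = sum_n u N * c.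
Proof.
induction N; [now rewrite !sum_O|]. rewrite !sum_Sn, IHN.
change (@plus _ (sum_n u N * c) (u (S N) * c)) with (sum_n u N * c + u (S N) * c).
change (@plus _ (sum_n u N) (u (S N))) with (sum_n u N + u (S N)).
match goal with |- @eq _ ?p ?q => change (@eq R p q); ring end.
Qed.

Lemma sum_n_R_nonneg (u : nat -> R) N : (forall n, 0 <= u n) -> 0 <= sum_n u N.
Proof.
intros H. induction N; [rewrite sum_O; apply H|]. rewrite sum_Sn.
change (@plus _ (sum_n u N) (u (S N))) with (sum_n u N + u (S N)). specialize (H (S N)). lra.
Qed.

Lemma sum_n_C_scal (u : nat -> C) c N : sum_n (fun n => c * u n)%C N = (c * sum_n u N)%C.
Proof. exact (sum_n_mult_l (K := C_Ring) c u N). Qed.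

Lemma sum_n_C_scal_r (u : nat -> C) c N : sum_n (fun n => u n * c)%C N = (sum_n u N * c)%C.
Proof. exact (sum_n_mult_r (K := C_Ring) c u N). Qed.

Lemma Cmod_sum_n_diff (u : nat -> C) (M : nat -> R) N n :
  (forall k, Cmod (u k) <= M k) -> (N <= n)%nat ->
  Cmod (sum_n u n - sum_n u N)%C <= sum_n M n - sum_n M N.
Proof.
intros H Hn. induction Hn.
- replace (sum_n u N - sum_n u N)%C with (RtoC 0) by ring. rewrite Cmod_0. lra.
- rewrite !sum_Sn. change (plus (sum_n u m) (u (S m))) with (sum_n u m + u (S m))%C.
  change (plus (sum_n M m) (M (S m))) with (sum_n M m + M (S m)).
  replace (sum_n u m + u (S m) - sum_n u N)%C with ((sum_n u m - sum_n u N) + u (S m))%C by ring.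
  eapply Rle_trans; [apply Cmod_triangle|]. specialize (H (S m)). lra.
Qed.

Lemma sum_n_le_Series (M : nat -> R) N : (forall k, 0 <= M k) -> ex_series M -> sum_n M N <= Series M.
Proof.
intros H E. assert (S := Series_correct M E).
apply (is_lim_seq_incr_compare (sum_n M) (Series M)).
- exact S.
- intros n. rewrite sum_Sn. unfold plus; simpl. specialize (H (Datatypes.S n)). lra.
Qed.

Lemma limat_Cmod_le {T} {Fl : (T -> Prop) -> Prop} {PF : ProperFilter Fl} F L c K :
  limat Fl F L -> Fl (fun t => Cmod (F t - c)%C <= K) -> Cmod (L - c)%C <= K.
Proof.
intros H E. apply le_epsilon. intros eps P.
destruct (filter_ex _ (filter_and _ _ (H eps P) E)) as [t [A B]].
replace (L - c)%C with (- (F t - L) + (F t - c))%C by ring.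
eapply Rle_trans; [apply Cmod_triangle|]. rewrite Cmod_opp. lra.
Qed.

Lemma series_tail_le (u : nat -> C) (M : nat -> R) l N :
  (forall k, Cmod (u k) <= M k) -> ex_series M -> limat eventually (sum_n u) l ->
  Cmod (l - sum_n u N)%C <= Series M - sum_n M N.
Proof.
intros H E L. apply (limat_Cmod_le _ _ _ _ L). exists N. intros n Hn.
eapply Rle_trans; [apply (Cmod_sum_n_diff u M); auto|].
assert (sum_n M n <= Series M); [|lra]. apply sum_n_le_Series; auto.
intros k; eapply Rle_trans; [apply Cmod_ge_0|apply H].
Qed.

Lemma limat_of_bound (F : nat -> C) L K (a : nat -> R) : 0 <= K -> (forall n, 0 <= a n) ->
  (forall n, Cmod (L - F n)%C <= K * a n) -> is_lim_seq a 0 -> limat eventually F L.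
Proof.
intros HK Ha H E eps P. apply is_lim_seq_spec in E.
destruct (E (mkposreal (eps / (K + 1)) ltac:(apply Rdiv_lt_0_compat; lra))) as [N0 H0].
exists N0. intros n Hn. specialize (H0 n Hn). specialize (Ha n). simpl in H0. rewrite Rminus_0_r, Rabs_pos_eq in H0 by exact Ha.
rewrite <- Cmod_opp. replace (- (F n - L))%C with (L - F n)%C by ring.
eapply Rle_lt_trans; [apply H|].
assert (a n * (K + 1) < eps).
{ replace eps with (eps / (K + 1) * (K + 1)) by (field; lra). apply Rmult_lt_compat_r; lra. }
lra.
Qed.

(** The M-test under an integrable weight: the tail of the series is uniformly
    small, so its integral against f is small. *)
Lemma is_int_series (a : R) b f g m (phi : nat -> R -> C) (Phi : R -> C) (M : nat -> R) (l : nat -> C) :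
  Rbar_lt a b ->
  (forall t, inI a b t -> contC f t) ->
  (forall t, inI a b t -> Cmod (f t) <= g t) ->
  is_int a b (fun t => RtoC (g t)) m ->
  (forall t, inI a b t -> contC Phi t) ->
  (forall n t, inI a b t -> Cmod (phi n t) <= M n) -> ex_series M ->
  (forall t, inI a b t -> limat eventually (sum_n (fun n => phi n t)) (Phi t)) ->
  (forall n, is_int a b (fun t => f t * phi n t)%C (l n)) ->
  exists L, is_int a b (fun t => f t * Phi t)%C L /\ limat eventually (sum_n l) L.
Proof.
intros Hab Cf Hfg Hg CPhi HM EM HPhi Hl.
destruct (inI_nonempty a b Hab) as [c Hc].
assert (M0 : forall k, 0 <= M k) by (intros k; eapply Rle_trans; [apply Cmod_ge_0| apply (HM k c Hc)]).
set (r := fun N => Series M - sum_n M N).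
assert (r0 : forall N, 0 <= r N) by (intros N; unfold r; assert (A := sum_n_le_Series M N M0 EM); lra).
assert (T : forall t N, inI a b t -> Cmod (Phi t - sum_n (fun n => phi n t) N)%C <= r N).
{ intros t N Ht. apply series_tail_le; auto. }
assert (SB : forall t, inI a b t -> Cmod (Phi t) <= Series M).
{ intros t Ht. replace (Phi t) with ((Phi t - sum_n (fun n => phi n t) 0) + phi 0%nat t)%C.
  2:{ rewrite sum_O. ring. }
  eapply Rle_trans; [apply Cmod_triangle|]. specialize (T t 0%nat Ht). unfold r in T.
  rewrite (sum_O M) in T. specialize (HM 0%nat t Ht). lra. }
assert (g0 : forall t, inI a b t -> 0 <= g t) by (intros t Ht; eapply Rle_trans; [apply Cmod_ge_0| apply (Hfg t Ht)]).
destruct (is_int_dominated a b (fun t => f t * Phi t)%C (fun t => Series M * g t) (RtoC (Series M) * m)%C) as [L [HL _]]; auto.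
{ intros t Ht. apply contC_mult; auto. }
{ intros t Ht. rewrite Cmod_mult, Rmult_comm. apply Rmult_le_compat; auto using Cmod_ge_0. }
{ eapply is_int_ext; [|apply is_int_scal; exact Hg]. intros; simpl; now rewrite RtoC_mult. }
exists L; split; [exact HL|].
assert (D : forall N, Cmod (L - sum_n l N)%C <= r N * Re m).
{ intros N.
  assert (H1 := is_int_minus _ _ _ _ _ _ HL (is_int_sum a b _ l N (fun n _ => Hl n))).
  assert (H2 : is_int a b (fun t => RtoC (r N * g t)) (RtoC (r N) * m)%C).
  { eapply is_int_ext; [|apply is_int_scal; exact Hg]. intros; simpl; now rewrite RtoC_mult. }
  replace (r N * Re m) with (Re (RtoC (r N) * m)%C) by (unfold Re; simpl; ring).
  apply (is_int_le a b _ _ _ _ Hab H1 H2). intros t Ht. cbv beta.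
  replace (f t * Phi t - sum_n (fun n => f t * phi n t) N)%C
    with (f t * (Phi t - sum_n (fun n => phi n t) N))%C.
  - rewrite Cmod_mult, Rmult_comm. apply Rmult_le_compat; auto using Cmod_ge_0.
  - assert (Q : sum_n (fun n : nat => (f t * phi n t)%C) N = (f t * sum_n (fun n => phi n t) N)%C).
    { apply sum_n_C_scal. }
    rewrite Q. ring. }
assert (m0 : 0 <= Re m).
{ eapply Rle_trans; [apply (Cmod_ge_0 m)|]. apply (is_int_le a b _ _ g _ Hab Hg Hg).
  intros t Ht. rewrite Cmod_R, Rabs_pos_eq; auto; lra. }
intros eps P.
assert (P' : 0 < eps / (Re m + 1)) by (apply Rdiv_lt_0_compat; lra).
assert (LS : is_lim_seq (sum_n M) (Series M)) by (apply (Series_correct M EM)).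
apply is_lim_seq_spec in LS. destruct (LS (mkposreal _ P')) as [N0 HN0].
exists N0. intros n Hn. specialize (HN0 n Hn). simpl in HN0. apply Rabs_def2 in HN0.
specialize (D n). rewrite <- Cmod_opp. replace (- (sum_n l n - L))%C with (L - sum_n l n)%C by ring.
eapply Rle_lt_trans; [exact D|]. assert (r n < eps / (Re m + 1)) by (unfold r; lra).
specialize (r0 n).
assert (r n * (Re m + 1) < eps / (Re m + 1) * (Re m + 1)) by nra.
replace (eps / (Re m + 1) * (Re m + 1)) with eps in H0 by (field; lra). nra.
Qed.

(** * Real powers and elementary majorants *)

Lemma Rpower_pos t s : 0 < Rpower t s.
Proof. apply exp_pos. Qed.

Lemma is_derive_Rpower s t : 0 < t -> is_derive (fun t => Rpower t s) t (s * Rpower t (s - 1)).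
Proof.
intros H. unfold Rpower. auto_derive; [exact H|].
replace ((s - 1) * ln t) with (s * ln t + - ln t) by ring.
rewrite exp_plus, exp_Ropp, exp_ln by exact H. field. lra.
Qed.

Lemma Rpower_le_1_base u s : 0 < u <= 1 -> 0 <= s -> Rpower u s <= 1.
Proof.
intros [H [K|K]] Hs.
- unfold Rpower. rewrite <- exp_0. assert (ln u < ln 1) by (apply ln_increasing; auto).
  rewrite ln_1 in H0. destruct (Req_dec (s * ln u) 0) as [E|E]; [rewrite E; lra|].
  left; apply exp_increasing. nra.
- subst; unfold Rpower; rewrite ln_1, Rmult_0_r, exp_0; lra.
Qed.

Lemma exp_le x y : x <= y -> exp x <= exp y.
Proof. intros [H|H]; [left; now apply exp_increasing | subst; lra]. Qed.

Lemma ln_le_0 x y : 0 < x -> x <= y -> ln x <= ln y.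
Proof. intros P [H|H]; [left; now apply ln_increasing | subst; lra]. Qed.

Lemma Rpower_le_base u v s : 0 < u <= v -> 0 <= s -> Rpower u s <= Rpower v s.
Proof.
intros [H K] Hs. unfold Rpower. apply exp_le, Rmult_le_compat_l; [exact Hs|]. now apply ln_le_0.
Qed.

Lemma Rpower_le_exp u s s' : 1 <= u -> s <= s' -> Rpower u s <= Rpower u s'.
Proof.
intros H K. unfold Rpower. apply exp_le, Rmult_le_compat_r; [|exact K].
rewrite <- ln_1. apply ln_le_0; lra.
Qed.

Lemma Rpower_between u r s : 1 <= r -> / r <= u <= r -> Rpower u s <= Rpower r (Rabs s).
Proof.
intros Hr [A B]. assert (I : 0 < / r) by (apply Rinv_0_lt_compat; lra). unfold Rpower. apply exp_le.
assert (H1 : ln u <= ln r) by (apply ln_le_0; lra).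
assert (H2 : - ln r <= ln u). { rewrite <- ln_Rinv by lra. apply ln_le_0; lra. }
assert (L2 : 0 <= ln r) by (rewrite <- ln_1; apply ln_le_0; lra).
unfold Rabs; destruct (Rcase_abs s); nra.
Qed.

Lemma Rpower_middle u s : 1/2 <= u <= 2 -> Rpower u s <= Rpower 2 (Rabs s).
Proof. intros H. apply Rpower_between; lra. Qed.

(** Apply ln u <= u - 1 to u = e (1 + s), with e so small that the term linear
    in s is absorbed by kappa s. *)
Lemma exp_decay kappa M : 0 < kappa ->
  exists K, 0 < K /\ forall s, 0 <= s -> Rpower (1 + s) M * exp (- kappa * s) <= K.
Proof.
intros Hk. set (A := Rabs M). assert (A0 : 0 <= A) by apply Rabs_pos.
set (e := kappa / (A + 1)). assert (e0 : 0 < e) by (apply Rdiv_lt_0_compat; lra).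
exists (exp (kappa - A - A * ln e)). split; [apply exp_pos|]. intros s Hs.
apply Rle_trans with (Rpower (1 + s) A * exp (- kappa * s)).
{ apply Rmult_le_compat_r; [left; apply exp_pos|]. apply Rpower_le_exp; [lra|]. apply Rle_abs. }
unfold Rpower. rewrite <- exp_plus. apply exp_le.
assert (L : ln (e * (1 + s)) <= e * (1 + s) - 1).
{ assert (U := exp_ineq1_le (ln (e * (1 + s)))). rewrite exp_ln in U by nra. lra. }
rewrite ln_mult in L by lra.
assert (Q : A * e <= kappa).
{ unfold e. apply Rmult_le_reg_r with (A + 1); [lra|].
  replace (A * (kappa / (A + 1)) * (A + 1)) with (A * kappa) by (field; lra). nra. }
assert (A * ln (1 + s) <= A * (e * (1 + s) - 1 - ln e)) by (apply Rmult_le_compat_l; lra).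
assert (A * e * (1 + s) <= kappa * (1 + s)) by (apply Rmult_le_compat_r; lra).
lra.
Qed.

(** With s = x t, this converts an excess of powers of t into powers of 1/x; M
    is at our disposal. *)
Lemma exp_decay_pow kappa B M : 0 < kappa -> 0 <= M ->
  exists K, 0 < K /\ forall s, 0 < s ->
   Rpower (1 + s) B * exp (- kappa * s) <= K * Rpower s (- M).
Proof.
intros Hk HM. destruct (exp_decay kappa (B + M) Hk) as [K [K0 HK]]. exists K; split; [exact K0|].
intros s Hs. apply Rmult_le_reg_r with (Rpower s M); [apply Rpower_pos|].
rewrite (Rmult_assoc K), <- Rpower_plus, Rplus_opp_l, Rpower_O, Rmult_1_r by exact Hs.
eapply Rle_trans; [|apply (HK s); lra]. rewrite Rpower_plus.
replace (Rpower (1 + s) B * exp (- kappa * s) * Rpower s M)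
 with (Rpower (1 + s) B * Rpower s M * exp (- kappa * s)) by ring.
apply Rmult_le_compat_r; [left; apply exp_pos|].
apply Rmult_le_compat_l; [left; apply Rpower_pos|]. apply Rpower_le_base; lra.
Qed.

Lemma limat_R_bound {T} {Fl : (T -> Prop) -> Prop} {PF : ProperFilter Fl} (F : T -> C) (h : T -> R) :
  Fl (fun t => Cmod (F t) <= h t) -> (forall eps, 0 < eps -> Fl (fun t => h t < eps)) -> limat Fl F 0%C.
Proof.
intros H K eps P. generalize (filter_and _ _ H (K eps P)). apply filter_imp. intros t [A B].
replace (F t - 0)%C with (F t) by ring. lra.
Qed.

Lemma Rpower_small_0 s : 0 < s -> forall eps, 0 < eps -> at_right 0 (fun t => Rpower t s < eps).
Proof.
intros Hs eps P.
assert (Q : 0 < Rpower eps (/ s)) by apply Rpower_pos.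
exists (mkposreal _ Q). intros t Ht Htb.
unfold_ball_goal. unfold_ball Ht.
rewrite Ropp_0, Rplus_0_r, Rabs_pos_eq in Ht by lra.
replace eps with (Rpower (Rpower eps (/ s)) s).
2:{ rewrite Rpower_mult. replace (/ s * s) with 1 by (field; lra). now apply Rpower_1. }
unfold Rpower at 1 2. apply exp_increasing, Rmult_lt_compat_l; [exact Hs|]. now apply ln_increasing.
Qed.

Lemma Rpower_small_infty s : 0 < s -> forall eps, 0 < eps -> Rbar_locally p_infty (fun t => Rpower t (- s) < eps).
Proof.
intros Hs eps P. exists (Rpower eps (- / s)). intros t Ht.
assert (Q := Rpower_pos eps (- / s)).
replace eps with (Rpower (Rpower eps (- / s)) (- s)).
2:{ rewrite Rpower_mult. replace (- / s * - s) with 1 by (field; lra). now apply Rpower_1. }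
unfold Rpower at 1 2. apply exp_increasing.
assert (ln (Rpower eps (- / s)) < ln t) by (apply ln_increasing; assumption). nra.
Qed.

Lemma is_int_Rpower s : 0 < s -> is_int 0 1 (fun t => RtoC (Rpower t (s - 1))) (RtoC (/ s)).
Proof.
intros Hs. exists (fun t => RtoC (/ s * Rpower t s)), (RtoC 0), (RtoC (/ s)).
assert (D : forall t, 0 < t -> is_derive (fun t => / s * Rpower t s) t (Rpower t (s - 1))).
{ intros t Ht. replace (Rpower t (s - 1)) with (/ s * (s * Rpower t (s - 1))) by (field; lra).
  apply (is_derive_scal (fun t => Rpower t s)). now apply is_derive_Rpower. }
split; [|split; [|split]].
- intros t [Ht _]. now apply derivC_RtoC, D.
- apply limat_R_bound with (fun t => / s * Rpower t s).
  + apply filter_forall. intros t. rewrite Cmod_R, Rabs_pos_eq; [lra|].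
    apply Rmult_le_pos; [left; now apply Rinv_0_lt_compat|left; apply Rpower_pos].
  + intros eps P. assert (P' : 0 < s * eps) by nra. generalize (Rpower_small_0 s Hs _ P').
    apply filter_imp. intros t Ht. apply Rmult_lt_reg_l with s; [exact Hs|].
    replace (s * (/ s * Rpower t s)) with (Rpower t s) by (field; lra). exact Ht.
- replace (RtoC (/ s)) with (RtoC (/ s * Rpower 1 s)).
  2:{ f_equal. unfold Rpower. rewrite ln_1, Rmult_0_r, exp_0. ring. }
  apply (contC_limat (fun t => RtoC (/ s * Rpower t s)) 1).
  + typeclasses eauto.
  + apply filter_le_within.
  + eapply derivC_contC, derivC_RtoC, D. lra.
- ring.
Qed.

Lemma is_int_tail : is_int 1 p_infty (fun t => RtoC (Rpower t (- 2))) 1%C.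
Proof.
exists (fun t => RtoC (- Rpower t (-(1)))), (RtoC (-(1))), (RtoC 0).
assert (D : forall t, 0 < t -> is_derive (fun t => - Rpower t (-(1))) t (Rpower t (- 2))).
{ intros t Ht. replace (Rpower t (- 2)) with (opp (-(1) * Rpower t (-(1) - 1))).
  - apply @is_derive_opp. now apply is_derive_Rpower.
  - unfold opp; simpl. replace (- (1) - 1) with (-2) by ring. ring. }
split; [|split; [|split]].
- intros t [Ht _]. apply derivC_RtoC, D. lra.
- replace (RtoC (- (1))) with (RtoC (- Rpower 1 (-(1)))).
  2:{ f_equal. unfold Rpower. rewrite ln_1, Rmult_0_r, exp_0. ring. }
  apply (contC_limat (fun t => RtoC (- Rpower t (-(1)))) 1).
  + typeclasses eauto.
  + apply filter_le_within.
  + eapply derivC_contC, derivC_RtoC, D. lra.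
- apply (@limat_R_bound R (Rbar_locally p_infty)) with (fun t => Rpower t (-(1))).
  + apply (Rbar_locally_filter p_infty).
  + apply (filter_forall (F := Rbar_locally p_infty)). intros t. rewrite Cmod_R, Rabs_Ropp, Rabs_pos_eq; [lra|].
    left; apply Rpower_pos.
  + intros eps P. apply Rpower_small_infty; lra.
- rewrite <- RtoC_minus. f_equal; ring.
Qed.

(** The primitive is (t / (1+t))^s / s. The integrand behaves like t^(s-1) at
    0 and like t^(-2) at infinity, hence dominates t^(s-1) times any decaying
    exponential, up to a constant. *)
Lemma is_int_half_line s : 0 < s ->
  is_int 0 p_infty (fun t => RtoC (Rpower t (s - 1) * Rpower (1 + t) (- (s + 1)))) (RtoC (/ s)).
Proof.
intros Hs. set (G := fun t => / s * Rpower (t / (1 + t)) s).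
exists (fun t => RtoC (G t)), (RtoC 0), (RtoC (/ s)).
split; [|split; [|split]].
- intros t [Ht _]. apply derivC_RtoC. unfold G.
  replace (Rpower t (s - 1) * Rpower (1 + t) (- (s + 1)))
   with (/ s * (((1 * (1 + t) - t * (0 + 1)) / (1 + t)^2) * (s * Rpower (t / (1 + t)) (s - 1)))).
  + apply (is_derive_scal (fun t => Rpower (t / (1 + t)) s)).
    apply (is_derive_comp (fun u => Rpower u s) (fun t => t / (1 + t))).
    * apply is_derive_Rpower. apply Rdiv_lt_0_compat; lra.
    * apply (is_derive_div (fun t => t) (fun t => 1 + t)).
      -- apply @is_derive_id.
      -- apply @is_derive_plus; [apply @is_derive_const | apply @is_derive_id].
      -- lra.
  + replace (- (s + 1)) with (- (s - 1) + - INR 2) by (simpl; ring).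
    rewrite Rpower_plus, (Rpower_Ropp _ (INR 2)), Rpower_pow by lra.
    unfold Rdiv at 2. unfold Rpower at 1. rewrite ln_mult, ln_Rinv by (try apply Rinv_0_lt_compat; lra).
    replace ((s - 1) * (ln t + - ln (1 + t))) with ((s-1) * ln t + (- (s-1)) * ln (1 + t)) by ring.
    rewrite exp_plus. fold (Rpower t (s - 1)). fold (Rpower (1 + t) (- (s - 1))). field. lra.
- apply limat_R_bound with (fun t => / s * Rpower t s).
  + assert (EQ : forall t : R, 0 < t -> t / (1 + t) * (1 + t) = t) by (intros; field; lra).
    exists (mkposreal 1 Rlt_0_1). intros t _ Ht. unfold G.
    rewrite Cmod_R, Rabs_pos_eq.
    * apply Rmult_le_compat_l; [left; now apply Rinv_0_lt_compat|]. apply Rpower_le_base; [|lra].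
      split; [apply Rdiv_lt_0_compat; lra|]. apply Rmult_le_reg_r with (1 + t); [lra|].
      rewrite EQ by lra. nra.
    * apply Rmult_le_pos; [left; now apply Rinv_0_lt_compat|left; apply Rpower_pos].
  + intros eps P. assert (P' : 0 < s * eps) by nra. generalize (Rpower_small_0 s Hs _ P').
    apply filter_imp. intros t Ht. apply Rmult_lt_reg_l with s; [exact Hs|].
    replace (s * (/ s * Rpower t s)) with (Rpower t s) by (field; lra). exact Ht.
- assert (EQ : forall t : R, 0 < t -> t / (1 + t) + - (1) = - / (1 + t)) by (intros; field; lra).
  assert (D : contC (fun u => RtoC (/ s * Rpower u s)) 1).
  { eapply derivC_contC, derivC_RtoC. apply (is_derive_scal (fun t => Rpower t s)).
    apply is_derive_Rpower. lra. }
  intros eps P.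
  assert (E : locally 1 (fun u => Cmod (RtoC (/ s * Rpower u s) - RtoC (/ s * Rpower 1 s))%C < eps)).
  { apply (contC_limat _ 1 (locally 1)) in D; [apply D, P| typeclasses eauto | intros Q HQ; exact HQ]. }
  destruct E as [d Hd]. exists (Rmax 0 (/ d)). intros t Ht.
  assert (U := Rmax_l 0 (/ d)). assert (V := Rmax_r 0 (/ d)).
  replace (RtoC (/ s)) with (RtoC (/ s * Rpower 1 s)).
  2:{ f_equal. unfold Rpower. rewrite ln_1, Rmult_0_r, exp_0. ring. }
  apply Hd. unfold_ball_goal.
  rewrite EQ by lra.
  rewrite Rabs_Ropp, Rabs_pos_eq by (left; apply Rinv_0_lt_compat; lra).
  rewrite <- (Rinv_inv d). destruct d as [d Pd]; simpl in *.
  assert (0 < / d) by now apply Rinv_0_lt_compat.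
  apply Rinv_lt_contravar; [nra | lra].
- rewrite <- RtoC_minus. f_equal; ring.
Qed.

(** * Taylor's formula and the binomial series *)

(** The type of a finite sum is a projection of an algebraic structure, which
    ring does not read as C; sums are turned into atoms first. *)
Ltac cring :=
  repeat match goal with |- context [@sum_n ?G ?f ?n] =>
    let X := fresh in pose (X := (@sum_n G f n : C)); change (@sum_n G f n) with X; clearbody X end;
  match goal with |- @eq _ ?x ?y => change (@eq C x y); ring end.

Lemma Cmod_spw u z : Cmod (spw u z) = exp (fst z * ln (Cmod u) - snd z * (2 * atan (snd u / (Cmod u + fst u)))).
Proof. unfold spw. rewrite Cmod_Cexp. reflexivity. Qed.

Lemma Cmod_spw_le u z R : 1 <= R -> / R <= Cmod u <= R -> Cmod (spw u z) <= exp (Cmod z * (ln R + 4)).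
Proof.
intros HR [H1 H2]. rewrite Cmod_spw. apply exp_le.
assert (A := re_le_Cmod z). unfold Re in A. assert (B := Rle_trans _ _ _ (Rmax_r _ _) (Rmax_Cmod z)).
assert (IR : 0 < / R) by (apply Rinv_0_lt_compat; lra).
assert (L1 : ln (Cmod u) <= ln R) by (apply ln_le_0; lra).
assert (L2 : - ln R <= ln (Cmod u)) by (rewrite <- ln_Rinv by lra; apply ln_le_0; lra).
assert (L0 : 0 <= ln R) by (rewrite <- ln_1; apply ln_le_0; lra).
set (th := 2 * atan (snd u / (Cmod u + fst u))).
assert (T := atan_bound (snd u / (Cmod u + fst u))). assert (P4 := PI_4).
assert (TH : Rabs th <= 4) by (unfold th; apply Rabs_le; lra).
assert (LL : Rabs (ln (Cmod u)) <= ln R) by (apply Rabs_le; lra).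
assert (X : fst z * ln (Cmod u) <= Cmod z * ln R).
{ eapply Rle_trans; [apply Rle_abs|]. rewrite Rabs_mult. apply Rmult_le_compat; auto using Rabs_pos. }
assert (Y : - (snd z * th) <= Cmod z * 4).
{ eapply Rle_trans; [apply Rle_abs|]. rewrite Rabs_Ropp, Rabs_mult. apply Rmult_le_compat; auto using Rabs_pos. }
lra.
Qed.

Lemma slit_one_minus w : Cmod w < 1 -> slit (1 - w)%C.
Proof.
intros H. apply slit_Re. simpl. assert (A := re_le_Cmod w). unfold Re in A.
assert (B := Rle_abs (fst w)). lra.
Qed.

Lemma INR_fact_C n : RtoC (INR (fact n)) <> 0%C.
Proof. intros H. apply RtoC_inj in H. now apply INR_fact_neq_0 in H. Qed.

Lemma RtoC_S n : RtoC (INR (S n)) = (INR n + 1)%C.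
Proof. rewrite S_INR, RtoC_plus. reflexivity. Qed.

Lemma derivC_pow F t l n :
  derivC F t l -> derivC (fun s => F s ^ S n)%C t (RtoC (INR (S n)) * F t ^ n * l)%C.
Proof.
intros H. induction n.
- simpl. eapply derivC_eq; [apply derivC_mult; [exact H|apply derivC_const]|]. cbv beta. ring.
- eapply derivC_eq; [apply (derivC_mult F (fun s => F s ^ S n)%C); [exact H|exact IHn]|].
  rewrite (RtoC_S (S n)). simpl (F t ^ S n)%C. ring.
Qed.

(** The coefficient of w^n in (1 - w)^(-b). *)
Definition binc (b : C) (n : nat) : C := (poch b n / RtoC (INR (fact n)))%C.

Lemma poch_S_left b n : poch b (S n) = (b * poch (b + 1) n)%C.
Proof.
replace (S n) with (1 + n)%nat by lia. rewrite poch_add. simpl. rewrite Cplus_0_r. ring.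
Qed.

Lemma binc_S b n : (RtoC (INR (S n)) * binc b (S n))%C = ((b + INR n) * binc b n)%C.
Proof.
unfold binc. simpl poch. replace (fact (S n)) with (S n * fact n)%nat by reflexivity.
rewrite mult_INR, RtoC_mult. field. split; [apply INR_fact_C|].
intros H. apply RtoC_inj in H. now apply not_0_INR in H.
Qed.

Lemma derivC_affine u w t : derivC (fun s : R => u - s * w)%C t (- w)%C.
Proof.
eapply derivC_eq.
- apply derivC_minus; [apply derivC_const|]. apply (derivC_mult (fun s : R => RtoC s)); [|apply derivC_const].
  apply derivC_RtoC. apply @is_derive_id.
- cbv beta. change (RtoC one) with (RtoC 1). ring.
Qed.

Lemma derivC_ext F G t l : (forall s, F s = G s) -> derivC F t l -> derivC G t l.
Proof.
intros E [A B]; split.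
- apply (is_derive_ext (fun s => fst (F s))); [intros s; now rewrite E|exact A].
- apply (is_derive_ext (fun s => snd (F s))); [intros s; now rewrite E|exact B].
Qed.

(** The Taylor polynomial of D 0 centred at t, evaluated at 1, has a
    telescoping derivative, D (N+1) t (1-t)^N / N!. It equals D 0 1 for t = 1
    and the sum in the statement for t = 0. *)
Lemma taylor_remainder (D : nat -> R -> C) N A :
  (forall n t, 0 <= t <= 1 -> derivC (D n) t (D (S n) t)) ->
  (forall t, 0 <= t <= 1 -> Cmod (D (S N) t) * (1 - t) ^ N / INR (fact N) <= A) ->
  Cmod (D 0%nat 1 - sum_n (fun n => D n 0 / RtoC (INR (fact n))) N)%C <= A.
Proof.
intros HD HA.
assert (DS : forall t, 0 <= t <= 1 ->
  derivC (fun s => sum_n (fun n => D n s * (1 - s) ^ n / RtoC (INR (fact n)))%C N) t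
    (D (S N) t * (1 - t) ^ N / RtoC (INR (fact N)))%C).
{ intros t Ht. clear HA. induction N.
  - apply (derivC_ext (D 0%nat)); [intros s; rewrite sum_O; simpl; field|].
    eapply derivC_eq; [now apply HD|]. simpl. field.
  - assert (DT : derivC (fun s => D (S N) s * ((1 - s) ^ S N * / RtoC (INR (fact (S N)))))%C t
      (D (S (S N)) t * ((1 - t) ^ S N * / RtoC (INR (fact (S N))))
       + D (S N) t * (RtoC (INR (S N)) * (1 - t) ^ N * - (1) * / RtoC (INR (fact (S N)))
            + (1 - t) ^ S N * 0))%C).
    { apply (derivC_mult (D (S N))); [now apply HD|].
      apply (derivC_mult (fun s : R => (1 - s) ^ S N)%C (fun _ => / RtoC (INR (fact (S N))))%C); [|apply derivC_const].
      apply (derivC_pow (fun s : R => 1 - s)%C).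
      eapply derivC_eq; [apply derivC_minus; [apply derivC_const|apply derivC_RtoC, @is_derive_id]|].
      change (RtoC one) with (RtoC 1). ring. }
    assert (E := derivC_plus _ _ _ _ _ IHN DT). cbv beta in E.
    eapply derivC_eq.
    + eapply derivC_ext; [|exact E]. intros s. cbv beta. rewrite sum_Sn. unfold Cdiv.
      change plus with Cplus. cring.
    + replace (fact (S N)) with (S N * fact N)%nat by reflexivity. rewrite mult_INR, RtoC_mult.
      field. split; [apply INR_fact_C|]. intros H. apply RtoC_inj in H. now apply not_0_INR in H. }
assert (M := mean_value_ineq _ _ (fun t => A * t) (fun _ => A) 0 1 Rle_0_1 DS). cbv beta in M.
rewrite Rmult_0_r, Rminus_0_r, Rmult_1_r in M.
replace (D 0%nat 1 - sum_n (fun n => D n 0 / RtoC (INR (fact n))) N)%C with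
 (sum_n (fun n => D n 1 * (1 - RtoC 1) ^ n / RtoC (INR (fact n))) N
 - sum_n (fun n => D n 0 * (1 - RtoC 0) ^ n / RtoC (INR (fact n))) N)%C.
- apply M.
  + intros t Ht. auto_derive; [trivial|ring].
  + intros t Ht. rewrite Cmod_div, Cmod_mult, Cmod_pow by apply INR_fact_C.
    rewrite <- RtoC_minus, !Cmod_R, !Rabs_pos_eq by (try apply pos_INR; lra). now apply HA.
- clear. apply (f_equal2 Cminus).
  + induction N; [rewrite sum_O; simpl; field|].
    rewrite sum_Sn, IHN. change plus with Cplus. simpl Cpow. replace (1 - RtoC 1)%C with (RtoC 0) by ring.
    unfold Cdiv. cring.
  + apply sum_n_ext. intros n. replace (1 - RtoC 0)%C with (RtoC 1) by ring.
    assert (P1 : (RtoC 1 ^ n)%C = RtoC 1) by (clear; induction n; simpl; [reflexivity|rewrite IHn; ring]).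
    rewrite P1. unfold Cdiv. cring.
Qed.

Lemma spw_sub_nat u z n : slit u -> spw u (z - INR n)%C = (spw u z / u ^ n)%C.
Proof.
intros Hs. assert (U : u <> 0%C). { intros Z. apply slit_Cmod in Hs. rewrite Z, Cmod_0 in Hs. lra. }
induction n.
- simpl. replace (z - RtoC 0)%C with z by ring. field.
- rewrite RtoC_S. replace (z - (INR n + 1))%C with (z - INR n + (- (1)))%C by ring.
  rewrite spw_plus, IHn. assert (E : spw u (- (1))%C = (/ u)%C).
  { assert (K : (spw u (- (1)) * u)%C = 1%C).
    { rewrite <- (spw_1 u Hs) at 2. rewrite <- spw_plus, <- (spw_0 u). f_equal; ring. }
    transitivity (spw u (- (1)) * u * / u)%C; [field; exact U | rewrite K; ring]. }
  rewrite E. simpl. field. split; [|exact U].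
  intros Z. apply (f_equal Cmod) in Z. rewrite Cmod_pow, Cmod_0 in Z.
  apply slit_Cmod in Hs. assert (P := pow_lt (Cmod u) n Hs). lra.
Qed.

Lemma Rle_div_1 x y : 0 <= x -> x <= y -> 0 < y -> x / y <= 1.
Proof. intros. apply Rmult_le_reg_r with y; [lra|]. replace (x / y * y) with x by (field; lra). lra. Qed.

(** Taylor's formula along the segment from u to u - v. Since |u| (1 - t) <=
    |u - t v|, the factor (1 - t)^N compensates the N extra negative powers of
    u - t v. *)
Lemma binomial_remainder b u v N K :
  (forall t, 0 <= t <= 1 -> slit (u - t * v)%C) -> Cmod v <= Cmod u ->
  (forall t, 0 <= t <= 1 -> Cmod (spw (u - t * v) (- b - 1))%C <= K) ->
  Cmod (spw (u - v) (- b) - sum_n (fun n => binc b n * v ^ n * spw u (- b - INR n)) N)%C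
   <= Cmod b * Cmod (binc (b + 1) N) * (Cmod v / Cmod u) ^ N * Cmod v * K.
Proof.
intros SL Huv HK. assert (V0 := Cmod_ge_0 v).
assert (U0 : 0 < Cmod u).
{ assert (H := slit_Cmod _ (SL 0 ltac:(lra))). now replace (u - 0 * v)%C with u in H by ring. }
set (D := fun (n : nat) (t : R) => (poch b n * v ^ n * spw (u - t * v) (- b - INR n))%C).
replace (spw (u - v) (- b))%C with (D 0%nat 1).
2:{ unfold D. simpl. replace (- b - RtoC 0)%C with (- b)%C by ring.
    replace (u - RtoC 1 * v)%C with (u - v)%C by ring. ring. }
rewrite (sum_n_ext (fun n => binc b n * v ^ n * spw u (- b - INR n))%C (fun n => D n 0 / RtoC (INR (fact n)))%C).
2:{ intros n. unfold D, binc. replace (u - RtoC 0 * v)%C with u by ring. unfold Cdiv. cring. }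
apply taylor_remainder.
- intros n t Ht. unfold D. eapply derivC_eq.
  + apply derivC_scal. apply (derivC_spw (fun s : R => u - s * v)%C); [now apply SL|apply derivC_affine].
  + rewrite RtoC_S. replace (- b - (INR n + 1))%C with (- b - INR n - 1)%C by ring. simpl. ring.
- intros t Ht. unfold D. rewrite RtoC_S, poch_S_left.
  replace (- b - (INR N + 1))%C with (- b - 1 - INR N)%C by ring.
  rewrite spw_sub_nat by auto. assert (W := slit_Cmod _ (SL t Ht)).
  assert (UN : ((u - t * v) ^ N)%C <> 0%C).
  { apply Cpow_nz. intros Z. rewrite Z, Cmod_0 in W. lra. }
  rewrite !Cmod_mult, Cmod_div, !Cmod_pow by exact UN.
  unfold binc. rewrite Cmod_div, (Cmod_R (INR (fact N))), (Rabs_pos_eq (INR (fact N))) by (try apply INR_fact_C; apply pos_INR).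
  assert (F : 0 < INR (fact N)) by (apply lt_0_INR, lt_O_fact).
  assert (G : Cmod u * (1 - t) <= Cmod (u - t * v)%C).
  { assert (T := Cmod_triangle (u - t * v)%C (t * v)%C). replace (u - t * v + t * v)%C with u in T by ring.
    rewrite Cmod_mult, Cmod_R, Rabs_pos_eq in T by lra. nra. }
  set (m := Cmod (u - t * v)%C) in *. set (k := Cmod (spw (u - t * v) (- b - 1))%C).
  assert (Q : ((1 - t) / m) ^ N <= (/ Cmod u) ^ N).
  { apply pow_incr. split; [apply Rmult_le_pos; [lra|left; now apply Rinv_0_lt_compat]|].
    apply Rmult_le_reg_r with (Cmod u * m); [nra|].
    replace ((1 - t) / m * (Cmod u * m)) with (Cmod u * (1 - t)) by (field; lra).
    replace (/ Cmod u * (Cmod u * m)) with m by (field; lra). exact G. }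
  assert (Q0 : 0 <= ((1 - t) / m) ^ N).
  { apply pow_le, Rmult_le_pos; [lra|left; now apply Rinv_0_lt_compat]. }
  assert (HKt : k <= K) by now apply HK. assert (k0 : 0 <= k) by apply Cmod_ge_0.
  set (X := Cmod b * (Cmod (poch (b + 1) N) / INR (fact N)) * Cmod v ^ S N).
  assert (X0 : 0 <= X).
  { apply Rmult_le_pos; [|apply pow_le, V0]. apply Rmult_le_pos; [apply Cmod_ge_0|].
    apply Rmult_le_pos; [apply Cmod_ge_0|left; now apply Rinv_0_lt_compat]. }
  apply Rle_trans with (X * (((1 - t) / m) ^ N * k)).
  + right. unfold X, Rdiv. rewrite !Rpow_mult_distr, pow_inv. ring.
  + apply Rle_trans with (X * ((/ Cmod u) ^ N * K)).
    * apply Rmult_le_compat_l; [exact X0|]. now apply Rmult_le_compat.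
    * right. unfold X, Rdiv. rewrite Rpow_mult_distr. simpl. ring.
Qed.

(** A positive majorant of |(b)_n / n!|: the ratio test requires nonzero
    terms, while (b)_n may vanish. *)
Fixpoint rbin (beta : R) (n : nat) : R :=
  match n with O => 1 | S m => rbin beta m * ((beta + INR m) / INR (S m)) end.

Lemma rbin_pos beta n : 0 < beta -> 0 < rbin beta n.
Proof.
intros H. induction n; cbn [rbin]; [lra|]. apply Rmult_lt_0_compat; [exact IHn|].
assert (P := pos_INR n). apply Rdiv_lt_0_compat; [lra|]. apply lt_0_INR; lia.
Qed.

Lemma Cmod_binc_le b n : Cmod (binc b n) <= rbin (Cmod b + 1) n.
Proof.
assert (A := Cmod_ge_0 b). induction n.
- unfold binc; simpl. replace (1 / 1)%C with (RtoC 1) by field. rewrite Cmod_1. lra.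
- cbn [rbin]. assert (P : 0 < INR (S n)) by (apply lt_0_INR; lia).
  assert (E : binc b (S n) = (binc b n * ((b + INR n) / RtoC (INR (S n))))%C).
  { assert (Z : RtoC (INR (S n)) <> 0%C) by (intros H; apply RtoC_inj in H; lra).
    transitivity (RtoC (INR (S n)) * binc b (S n) / RtoC (INR (S n)))%C; [field; exact Z|].
    rewrite binc_S. field. exact Z. }
  rewrite E, Cmod_mult. apply Rmult_le_compat; auto using Cmod_ge_0.
  rewrite Cmod_div, Cmod_R, Rabs_pos_eq by (try (intros H; apply RtoC_inj in H); lra).
  apply Rmult_le_compat_r; [left; now apply Rinv_0_lt_compat|].
  eapply Rle_trans; [apply Cmod_triangle|]. rewrite Cmod_R, Rabs_pos_eq by apply pos_INR. lra.
Qed.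

Lemma ex_series_rbin beta q : 0 < beta -> 0 < q < 1 -> ex_series (fun n => rbin beta n * q ^ n).
Proof.
intros Hb Hq.
assert (Pn : forall n, 0 < rbin beta n * q ^ n).
{ intros n. apply Rmult_lt_0_compat; [now apply rbin_pos | apply pow_lt; lra]. }
apply (ex_series_ext (V := R_NormedModule) (fun n => Rabs (rbin beta n * q ^ n))).
{ intros n. apply Rabs_pos_eq. left; apply Pn. }
apply (ex_series_DAlembert _ q).
- lra.
- intros n. apply Rgt_not_eq, Pn.
- apply (is_lim_seq_ext (fun n => q * (1 + (beta - 1) * / INR (S n)))).
  { intros n. assert (P : 0 < INR (S n)) by (apply lt_0_INR; lia).
    assert (N0 := pos_INR n).
    assert (Q := Pn n). assert (R1 := rbin_pos beta n Hb). assert (R2 : 0 < q ^ n) by (apply pow_lt; lra).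
    replace (rbin beta (S n) * q ^ S n / (rbin beta n * q ^ n)) with (q * ((beta + INR n) / INR (S n))).
    2:{ cbn [rbin pow]. field. repeat split; lra. }
    rewrite Rabs_pos_eq.
    - rewrite S_INR in *. field. lra.
    - apply Rmult_le_pos; [lra|]. apply Rlt_le, Rdiv_lt_0_compat; lra. }
  replace (Finite q) with (Finite (q * (1 + (beta - 1) * 0))) by (f_equal; ring).
  apply is_lim_seq_mult'; [apply is_lim_seq_const|].
  apply is_lim_seq_plus'; [apply is_lim_seq_const|].
  apply is_lim_seq_mult'; [apply is_lim_seq_const|].
  apply (is_lim_seq_incr_1 (fun n => / INR n)).
  apply (is_lim_seq_inv INR p_infty); [apply is_lim_seq_INR | easy].
Qed.

Lemma ex_series_binc b q : 0 <= q < 1 -> ex_series (fun n => Cmod (binc b n) * q ^ n).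
Proof.
intros Hq. apply (ex_series_le (V := R_CompleteNormedModule) _ (fun n => rbin (Cmod b + 1) n * ((1 + q) / 2) ^ n)).
- intros n. unfold norm; simpl; unfold abs; simpl.
  rewrite Rabs_pos_eq by (apply Rmult_le_pos; [apply Cmod_ge_0|apply pow_le; lra]).
  apply Rmult_le_compat; auto using Cmod_ge_0, Cmod_binc_le.
  + apply pow_le; lra.
  + apply pow_incr; lra.
- apply ex_series_rbin; [assert (A := Cmod_ge_0 b); lra | lra].
Qed.

Lemma segment_bounds u v t : 0 <= t <= 1 -> Cmod u - Cmod v <= Cmod (u - t * v)%C <= Cmod u + Cmod v.
Proof.
intros Ht. assert (A := Cmod_ge_0 v). assert (M : Cmod (t * v)%C = t * Cmod v).
{ rewrite Cmod_mult, Cmod_R, Rabs_pos_eq by lra. reflexivity. }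
assert (B := Cmod_triangle (u - t * v)%C (t * v)%C). assert (D := Cmod_triangle u (- (t * v))%C).
replace (u - t * v + t * v)%C with u in B by ring. rewrite Cmod_opp in D.
change (u + - (t * v))%C with (u - t * v)%C in D. nra.
Qed.

Lemma spw_base_1 z : spw 1 z = 1%C.
Proof. now rewrite (spw_RtoC 1), rpw_base_1 by lra. Qed.

Lemma sum_n_binc_1 b w N :
  sum_n (fun n => binc b n * w ^ n * spw 1 (- b - INR n))%C N = sum_n (fun n => binc b n * w ^ n)%C N.
Proof. apply sum_n_ext. intros n. rewrite spw_base_1. cring. Qed.

Lemma slit_segment w t : Cmod w < 1 -> 0 <= t <= 1 -> slit (1 - t * w)%C.
Proof.
intros Hw Ht. apply slit_one_minus. rewrite Cmod_mult, Cmod_R, Rabs_pos_eq by lra. assert (A := Cmod_ge_0 w). nra.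
Qed.

Lemma binomial_half b N : exists K, 0 <= K /\ forall w, Cmod w <= 1/2 ->
  Cmod (spw (1 - w) (- b) - sum_n (fun n => binc b n * w ^ n) N)%C <= K * Cmod w ^ S N.
Proof.
set (K := exp (Cmod (- b - 1)%C * (ln 2 + 4))).
exists (Cmod b * Cmod (binc (b + 1) N) * K). split.
- apply Rmult_le_pos; [apply Rmult_le_pos; apply Cmod_ge_0|left; apply exp_pos].
- intros w Hw. assert (R := binomial_remainder b 1%C w N K). rewrite sum_n_binc_1, Cmod_1, Rdiv_1_r in R.
  simpl. replace (Cmod b * Cmod (binc (b + 1) N) * K * (Cmod w * Cmod w ^ N))
    with (Cmod b * Cmod (binc (b + 1) N) * Cmod w ^ N * Cmod w * K) by ring.
  apply R; [|lra|]; intros t Ht; [apply slit_segment; lra|]. apply Cmod_spw_le; [lra|].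
  assert (S := segment_bounds 1%C w t Ht). rewrite Cmod_1 in S. lra.
Qed.

(** The base point u is arbitrary, as long as the segment stays in the cut
    plane: this avoids splitting (u - v)^(-b) into a product of principal
    powers. *)
Lemma binomial_series_at b u v q : 0 <= q < 1 -> Cmod v <= q * Cmod u ->
  (forall t, 0 <= t <= 1 -> slit (u - t * v)%C) ->
  limat eventually (sum_n (fun n => binc b n * v ^ n * spw u (- b - INR n))%C) (spw (u - v) (- b))%C.
Proof.
intros Hq Hv SL. assert (V0 := Cmod_ge_0 v). assert (B0 := Cmod_ge_0 b).
assert (U0 : 0 < Cmod u).
{ assert (H := slit_Cmod _ (SL 0 ltac:(lra))). now replace (u - 0 * v)%C with u in H by ring. }
set (r := Rmax 1 (Rmax (2 * Cmod u) (/ ((1 - q) * Cmod u)))).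
assert (R1 : 1 <= r) by apply Rmax_l.
assert (R2 : 2 * Cmod u <= r) by (eapply Rle_trans; [apply Rmax_l|apply Rmax_r]).
assert (R3 : / ((1 - q) * Cmod u) <= r) by (eapply Rle_trans; [apply Rmax_r|apply Rmax_r]).
set (K := exp (Cmod (- b - 1)%C * (ln r + 4))). assert (K0 : 0 < K) by apply exp_pos.
assert (HK : forall t, 0 <= t <= 1 -> Cmod (spw (u - t * v) (- b - 1))%C <= K).
{ intros t Ht. apply Cmod_spw_le; [exact R1|]. assert (S := segment_bounds u v t Ht).
  assert (D : 0 < (1 - q) * Cmod u) by nra.
  assert (/ r <= (1 - q) * Cmod u).
  { rewrite <- (Rinv_inv ((1 - q) * Cmod u)). apply Rinv_le_contravar; [now apply Rinv_0_lt_compat|exact R3]. }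
  nra. }
apply (limat_of_bound _ _ (Cmod b * Cmod v * K) (fun n => Cmod (binc (b + 1) n) * q ^ n)).
- apply Rmult_le_pos; nra.
- intros n. apply Rmult_le_pos; [apply Cmod_ge_0|apply pow_le; lra].
- intros n. eapply Rle_trans; [apply (binomial_remainder b u v n K SL); [nra|exact HK]|].
  replace (Cmod b * Cmod v * K * (Cmod (binc (b + 1) n) * q ^ n))
   with (Cmod b * Cmod v * K * Cmod (binc (b + 1) n) * q ^ n) by ring.
  replace (Cmod b * Cmod (binc (b + 1) n) * (Cmod v / Cmod u) ^ n * Cmod v * K)
   with (Cmod b * Cmod v * K * Cmod (binc (b + 1) n) * (Cmod v / Cmod u) ^ n) by ring.
  apply Rmult_le_compat_l; [repeat apply Rmult_le_pos; auto using Cmod_ge_0; lra|].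
  apply pow_incr. split; [apply Rmult_le_pos; [exact V0|left; now apply Rinv_0_lt_compat]|].
  apply Rmult_le_reg_r with (Cmod u); [exact U0|]. replace (Cmod v / Cmod u * Cmod u) with (Cmod v) by (field; lra). exact Hv.
- apply ex_series_lim_0, ex_series_binc, Hq.
Qed.

(** * Domination and comparison of integrals *)

Lemma contC_rpw z t : 0 < t -> contC (fun s => rpw s z) t.
Proof. intros H. eapply derivC_contC, derivC_rpw, H. Qed.

Lemma derivC_rpw1m z t : t < 1 -> derivC (fun s => rpw (1 - s) z) t (- (z * rpw (1 - t) (z - 1)))%C.
Proof.
intros H. eapply derivC_eq.
- apply (derivC_comp (fun s => rpw s z) (fun s : R => 1 - s) t (z * rpw (1 - t) (z - 1))%C (-(1))).
  + apply derivC_rpw. lra.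
  + auto_derive; [trivial|ring].
- rewrite RtoC_opp. ring.
Qed.

Lemma contC_rpw1m z t : t < 1 -> contC (fun s => rpw (1 - s) z) t.
Proof. intros H. eapply derivC_contC, derivC_rpw1m, H. Qed.

Lemma derivC_Cexp_lin y t : derivC (fun s => Cexp (- y * s))%C t (- y * Cexp (- y * t))%C.
Proof.
eapply derivC_eq.
- apply derivC_Cexp. apply (derivC_scal (- y)%C (fun s : R => RtoC s)). apply derivC_RtoC, @is_derive_id.
- cbv beta. change (RtoC one) with (RtoC 1). ring.
Qed.

Lemma contC_Cexp_lin y t : contC (fun s => Cexp (- y * s))%C t.
Proof. eapply derivC_contC, derivC_Cexp_lin. Qed.

Lemma Cmod_Cexp_lin y (t : R) : Cmod (Cexp (- y * t))%C = exp (- fst y * t).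
Proof. rewrite Cmod_Cexp. f_equal. simpl. ring. Qed.

Lemma exp_decay0 kappa M : 0 < kappa -> 0 <= M ->
  exists K, 0 < K /\ forall s, 0 < s -> exp (- kappa * s) <= K * Rpower s (- M).
Proof.
intros Hk HM. destruct (exp_decay_pow kappa 0 M Hk HM) as [K [K0 H]]. exists K; split; [exact K0|].
intros s Hs. specialize (H s Hs). rewrite Rpower_O in H by lra. lra.
Qed.

Definition unit_bound (s r : R) (t : R) : R := Rpower t (s - 1) + Rpower (1 - t) (r - 1).

Lemma is_int_unit_bound s r K : 0 < s -> 0 < r ->
  is_int 0 1 (fun t => RtoC (K * unit_bound s r t)) (RtoC (K * (/ s + / r))).
Proof.
intros Hs Hr.
assert (A := is_int_plus _ _ _ _ _ _ (is_int_Rpower s Hs) (is_int_reflect _ _ (is_int_Rpower r Hr))).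
apply (is_int_scal _ _ (RtoC K)) in A. rewrite RtoC_mult, RtoC_plus.
eapply is_int_ext; [|exact A]. intros t _. cbv beta. unfold unit_bound. now rewrite RtoC_mult, RtoC_plus.
Qed.

Lemma ex_int_unit f s r K : 0 < s -> 0 < r ->
  (forall t, 0 < t < 1 -> contC f t) ->
  (forall t, 0 < t < 1 -> Cmod (f t) <= K * unit_bound s r t) ->
  exists l, is_int 0 1 f l.
Proof.
intros Hs Hr Hc Hb.
destruct (is_int_dominated 0 1 f _ _ ltac:(simpl; lra) ltac:(intros t [? ?]; simpl in *; auto) ltac:(intros t [? ?]; simpl in *; apply Hb; lra) (is_int_unit_bound s r K Hs Hr)) as [l [Hl _]].
now exists l.
Qed.

(** The majorant is part of the conclusion because it also serves as a weight
    in [is_int_series]. *)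
Lemma ex_int_half_line f s kappa B K : 0 < s -> 0 < kappa -> 0 <= K ->
  (forall t, 0 < t -> contC f t) ->
  (forall t, 0 < t -> Cmod (f t) <= K * Rpower t (s - 1) * (Rpower (1 + t) B * exp (- kappa * t))) ->
  exists g m, (forall t, 0 < t -> Cmod (f t) <= g t) /\ is_int 0 p_infty (fun t => RtoC (g t)) m /\
  exists l, is_int 0 p_infty f l.
Proof.
intros Hs Hk HK Hc Hb. destruct (exp_decay kappa (B + (s + 1)) Hk) as [K' [K0' H]].
assert (G : is_int 0 p_infty (fun t => RtoC (K * K' * (Rpower t (s - 1) * Rpower (1 + t) (- (s + 1))))) (RtoC (K * K') * RtoC (/ s))%C).
{ eapply is_int_ext; [|apply is_int_scal, (is_int_half_line s Hs)]. intros t _. cbv beta. now rewrite <- (RtoC_mult (K * K')). }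
assert (D : forall t, 0 < t -> Cmod (f t) <= K * K' * (Rpower t (s - 1) * Rpower (1 + t) (- (s + 1)))).
{ intros t Ht. eapply Rle_trans; [apply (Hb t Ht)|].
  replace (K * K' * (Rpower t (s - 1) * Rpower (1 + t) (- (s + 1))))
   with (K * Rpower t (s - 1) * (K' * Rpower (1 + t) (- (s + 1)))) by ring.
  apply Rmult_le_compat_l; [apply Rmult_le_pos; [exact HK|left; apply Rpower_pos]|].
  replace (Rpower (1 + t) B) with (Rpower (1 + t) (B + (s + 1)) * Rpower (1 + t) (- (s + 1))).
  - specialize (H t ltac:(lra)). assert (P := Rpower_pos (1 + t) (- (s + 1))). nra.
  - rewrite <- Rpower_plus. f_equal; ring. }
eexists; eexists; split; [exact D|]; split; [exact G|].
destruct (is_int_dominated 0 p_infty f _ _ ltac:(simpl; auto) ltac:(intros t [? ?]; auto) ltac:(intros t [? ?]; now apply D) G) as [l [Hl _]].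
now exists l.
Qed.

(** Three regions: f and g are close near 0, f may be singular at 1, and
    beyond 1 only g is present. *)
Lemma int_compare f g l1 l2 A eta rho :
  0 <= A -> 0 < eta -> 0 < rho ->
  is_int 0 1 f l1 -> is_int 0 p_infty g l2 ->
  (forall t, 0 < t <= 1/2 -> Cmod (f t - g t)%C <= A * Rpower t (eta - 1)) ->
  (forall t, 1/2 <= t < 1 -> Cmod (f t - g t)%C <= A * (1 + Rpower (1 - t) (rho - 1))) ->
  (forall t, 1 < t -> Cmod (g t) <= A * Rpower t (- 2)) ->
  Cmod (l1 - l2)%C <= A * (/ eta + / rho + 2).
Proof.
intros HA He Hr Hf Hg H1 H2 H3.
destruct (is_int_split g l2 Hg) as (m1 & m2 & G1 & G2 & ->).
assert (D := is_int_minus _ _ _ _ _ _ Hf G1).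
assert (MJ := is_int_plus _ _ _ _ _ _ (is_int_unit_bound eta rho A He Hr) (is_int_scal _ _ (RtoC A) _ _ (is_int_Rpower 1 Rlt_0_1))).
assert (C1 : Cmod (l1 - m1)%C <= A * (/ eta + / rho) + A).
{ replace (A * (/ eta + / rho) + A) with (Re (RtoC (A * (/ eta + / rho)) + RtoC A * RtoC (/ 1))%C).
  2:{ unfold Re; simpl. field. lra. }
  eapply (is_int_le 0 1 _ _ (fun t => A * (unit_bound eta rho t + 1)) _ ltac:(simpl; lra) D).
  - eapply is_int_ext; [|exact MJ]. intros t [Ht _]. cbv beta.
    rewrite Rminus_diag_eq, Rpower_O by auto. rewrite <- RtoC_mult, <- RtoC_plus. f_equal; ring.
  - intros t [Ht Ht1]. simpl in Ht1. unfold unit_bound.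
    assert (P1 := Rpower_pos t (eta - 1)). assert (P2 := Rpower_pos (1 - t) (rho - 1)).
    destruct (Rle_dec t (1/2)) as [L|L].
    + eapply Rle_trans; [apply H1; lra|]. apply Rmult_le_compat_l; lra.
    + eapply Rle_trans; [apply H2; lra|]. apply Rmult_le_compat_l; lra. }
assert (C2 : Cmod m2 <= A).
{ replace A with (Re (RtoC A * 1)%C) by (unfold Re; simpl; ring).
  eapply (is_int_le 1 p_infty g m2 (fun t => A * Rpower t (- 2)) _ ltac:(simpl; auto) G2).
  - eapply is_int_ext; [|apply is_int_scal, is_int_tail]. intros t _. cbv beta. now rewrite RtoC_mult.
  - intros t [Ht _]. now apply H3. }
replace (l1 - (m1 + m2))%C with ((l1 - m1) + - m2)%C by ring.
eapply Rle_trans; [apply Cmod_triangle|]. rewrite Cmod_opp. lra.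
Qed.

(** * The integrands of Gamma and Beta *)

Lemma Cpower_pos_real t z : 0 < t -> Cpower t z = rpw t z.
Proof.
intros H. unfold Cpower, rpw. f_equal. f_equal. unfold Clog, Carg, RtoC. simpl.
destruct (Rle_dec 0 0); [|lra]. fold (RtoC t). rewrite Cmod_R, Rabs_pos_eq by lra.
f_equal. unfold Re; simpl. replace (t / t) with 1 by (field; lra). apply acos_1.
Qed.

(** Integrand of Gamma(z) y^(-z). *)
Definition gamma_fun (z : C) (y : C) (t : R) : C := (rpw t (z - 1) * Cexp (- y * t))%C.

Lemma contC_gamma_fun z y t : 0 < t -> contC (gamma_fun z y) t.
Proof. intros H. apply contC_mult; [now apply contC_rpw|apply contC_Cexp_lin]. Qed.

Lemma Cmod_gamma_fun z y t : Cmod (gamma_fun z y t) = Rpower t (fst z - 1) * exp (- fst y * t).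
Proof.
unfold gamma_fun. rewrite Cmod_mult, Cmod_rpw, Cmod_Cexp_lin. reflexivity.
Qed.

Lemma ex_int_gamma_fun (z y : C) : 0 < fst z -> 0 < fst y ->
  exists g m, (forall t, 0 < t -> Cmod (gamma_fun z y t) <= g t) /\ is_int 0 p_infty (fun t => RtoC (g t)) m /\
  exists l, is_int 0 p_infty (gamma_fun z y) l.
Proof.
intros Hz Hy. apply (ex_int_half_line (gamma_fun z y) (fst z) (fst y) 0 1); auto; try lra.
- intros; now apply contC_gamma_fun.
- intros t Ht. rewrite Cmod_gamma_fun, Rpower_O by lra. lra.
Qed.

Lemma contC_ext_loc F G t : locally t (fun s => F s = G s) -> contC F t -> contC G t.
Proof.
intros E [A B]; split.
- apply (continuous_ext_loc (fun s => fst (G s)) (fun s => fst (F s)) t); [|exact A].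
  revert E. apply filter_imp. intros s Hs; now rewrite Hs.
- apply (continuous_ext_loc (fun s => snd (G s)) (fun s => snd (F s)) t); [|exact B].
  revert E. apply filter_imp. intros s Hs; now rewrite Hs.
Qed.

Lemma is_int_Gamma (z : C) : 0 < fst z -> is_int 0 p_infty (gamma_fun z 1%C) (Cgamma z).
Proof.
intros Hz. destruct (ex_int_gamma_fun z 1%C Hz ltac:(simpl; lra)) as (_ & _ & _ & _ & l & Hl).
replace (Cgamma z) with l; [exact Hl|]. symmetry.
assert (E : forall t, 0 < t -> gamma_fun z 1 t = (Cpower t (z - 1) * Cexp (- t))%C).
{ intros t Ht. unfold gamma_fun. rewrite Cpower_pos_real by exact Ht. f_equal. f_equal. ring. }
unfold Cgamma. apply is_int_CInt.
- intros t Ht. apply (contC_ext_loc (gamma_fun z 1%C)); [|now apply contC_gamma_fun].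
  generalize (open_gt 0 t Ht). apply filter_imp. exact E.
- eapply is_int_ext; [|exact Hl]. intros t [Ht _]. now apply E.
Qed.

(** z t^(z-1) e^(-t) - t^z e^(-t) is the derivative of t^z e^(-t), which
    vanishes at both ends. *)
Lemma Cgamma_S (z : C) : 0 < fst z -> Cgamma (z + 1)%C = (z * Cgamma z)%C.
Proof.
intros Hz.
assert (I1 := is_int_Gamma z Hz). assert (I2 := is_int_Gamma (z + 1)%C ltac:(simpl; lra)).
assert (D := is_int_minus _ _ _ _ _ _ (is_int_scal _ _ z _ _ I1) I2).
assert (Z : is_int 0 p_infty (fun t => z * gamma_fun z 1 t - gamma_fun (z + 1) 1 t)%C 0%C).
{ assert (B : forall t : R, Cmod (rpw t z * Cexp (- (1) * t))%C = Rpower t (fst z) * exp (- 1 * t)).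
  { intros t. rewrite Cmod_mult, Cmod_rpw, Cmod_Cexp_lin. reflexivity. }
  exists (fun t => rpw t z * Cexp (- (1) * t))%C, 0%C, 0%C. split; [|split; [|split; [|ring]]].
  - intros t [Ht _]. eapply derivC_eq; [apply derivC_mult; [now apply derivC_rpw|apply derivC_Cexp_lin]|].
    unfold gamma_fun. replace (z + 1 - 1)%C with z by ring. ring.
  - apply limat_R_bound with (fun t => Rpower t (fst z)).
    + exists (mkposreal 1 Rlt_0_1). intros t _ Ht. rewrite B.
      assert (exp (- 1 * t) <= 1) by (rewrite <- exp_0; apply exp_le; lra).
      assert (P := Rpower_pos t (fst z)). nra.
    + now apply Rpower_small_0.
  - destruct (exp_decay0 1 (fst z + 1) Rlt_0_1 ltac:(lra)) as [K [K0 HK]].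
    apply (@limat_R_bound R (Rbar_locally p_infty)) with (fun t => K * Rpower t (- (1))).
    + apply (Rbar_locally_filter p_infty).
    + exists 0. intros t Ht. rewrite B. specialize (HK t Ht).
      replace (Rpower t (- (1))) with (Rpower t (fst z) * Rpower t (- (fst z + 1))).
      * assert (P := Rpower_pos t (fst z)).
        replace (K * (Rpower t (fst z) * Rpower t (- (fst z + 1)))) with (Rpower t (fst z) * (K * Rpower t (- (fst z + 1)))) by ring.
        apply Rmult_le_compat_l; [lra|exact HK].
      * rewrite <- Rpower_plus. f_equal; ring.
    + intros eps P. assert (P' : 0 < eps / K) by (apply Rdiv_lt_0_compat; lra).
      generalize (Rpower_small_infty 1 Rlt_0_1 _ P'). apply (filter_imp (F := Rbar_locally p_infty)).
      intros t Ht. apply Rmult_lt_compat_l with (1 := K0) in Ht.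
      replace (K * (eps / K)) with eps in Ht by (field; lra). exact Ht. }
assert (E := is_int_unique 0 p_infty _ _ _ ltac:(simpl; auto) D Z).
replace (Cgamma (z + 1)) with (z * Cgamma z - (z * Cgamma z - Cgamma (z + 1)))%C by ring. rewrite E. ring.
Qed.

Lemma Cgamma_poch (z : C) n : 0 < fst z -> Cgamma (z + INR n)%C = (poch z n * Cgamma z)%C.
Proof.
intros Hz. induction n.
- simpl. rewrite Cplus_0_r. ring.
- rewrite RtoC_S, Cplus_assoc, Cgamma_S, IHn.
  + simpl. ring.
  + simpl. assert (P := pos_INR n). lra.
Qed.

Lemma is_int_gamma_fun_scale (z : C) x : 0 < fst z -> 0 < x ->
  is_int 0 p_infty (gamma_fun z x) (rpw x (- z) * Cgamma z)%C.
Proof.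
intros Hz Hx. assert (I := is_int_scale _ _ x Hx (is_int_Gamma z Hz)).
apply (is_int_scal _ _ (rpw x (- z))) in I. eapply is_int_ext; [|exact I].
intros t [Ht _]. unfold gamma_fun. rewrite rpw_mult by assumption.
replace (- (1) * RtoC (x * t))%C with (- x * t)%C by (rewrite RtoC_mult; ring).
rewrite <- (rpw_1 x Hx) at 1.
replace (rpw x (- z) * (rpw x 1 * (rpw x (z - 1) * rpw t (z - 1) * Cexp (- x * t))))%C
 with ((rpw x (- z) * rpw x 1 * rpw x (z - 1)) * (rpw t (z - 1) * Cexp (- x * t)))%C by ring.
rewrite <- !rpw_plus. replace (- z + 1 + (z - 1))%C with (RtoC 0) by ring. rewrite rpw_0. ring.
Qed.

Definition beta_fun (p q : C) (t : R) : C := (rpw t (p - 1) * rpw (1 - t) (q - 1))%C.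

Lemma contC_beta_fun p q t : 0 < t < 1 -> contC (beta_fun p q) t.
Proof. intros H. apply contC_mult; [apply contC_rpw; lra|apply contC_rpw1m; lra]. Qed.

Lemma Cmod_beta_fun p q t : Cmod (beta_fun p q t) = Rpower t (fst p - 1) * Rpower (1 - t) (fst q - 1).
Proof. unfold beta_fun. now rewrite Cmod_mult, !Cmod_rpw. Qed.

Lemma beta_fun_bound s r : exists K, 0 < K /\ forall t, 0 < t < 1 ->
  Rpower t (s - 1) * Rpower (1 - t) (r - 1) <= K * unit_bound s r t.
Proof.
exists (Rpower 2 (Rabs (r - 1)) + Rpower 2 (Rabs (s - 1))).
assert (A := Rpower_pos 2 (Rabs (r - 1))). assert (B := Rpower_pos 2 (Rabs (s - 1))).
split; [lra|]. intros t Ht. unfold unit_bound.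
assert (P := Rpower_pos t (s - 1)). assert (Q := Rpower_pos (1 - t) (r - 1)).
destruct (Rle_dec t (1/2)) as [L|L].
- assert (M := Rpower_middle (1 - t) (r - 1) ltac:(lra)). nra.
- assert (M := Rpower_middle t (s - 1) ltac:(lra)). nra.
Qed.

Lemma ex_int_beta_fun (p q : C) : 0 < fst p -> 0 < fst q -> exists l, is_int 0 1 (beta_fun p q) l.
Proof.
intros Hp Hq. destruct (beta_fun_bound (fst p) (fst q)) as [K [K0 HK]].
apply (ex_int_unit (beta_fun p q) (fst p) (fst q) K Hp Hq).
- intros; now apply contC_beta_fun.
- intros t Ht. rewrite Cmod_beta_fun. now apply HK.
Qed.

(** * A Laplace-type estimate *)

Lemma Rpower_mult_base x t s : 0 < x -> 0 < t -> Rpower (x * t) s = Rpower x s * Rpower t s.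
Proof. intros; symmetry; now apply Rpower_mult_distr. Qed.

(** Replace the exponential by (xt)^(-M), with a different M in each region.
    Near 0, M is such that t^(eta - 1) remains, which is integrable; for t >=
    1/2 a larger M absorbs the factor x^B and the growth of T. The bound on
    Phi - T is of order N + 1 in t and 1/x jointly, so T may contain powers of
    1/x too. *)
Lemma watson (p : C) N mu beta B rho K1 :
  0 < fst p -> 0 < mu -> 0 <= B -> 0 < rho -> 0 <= K1 ->
  exists K, 0 <= K /\ forall x (Phi T k : R -> C) l1 l2, 1 <= x ->
   (forall t, 0 < t -> Cmod (k t) <= Rpower (1 + x * t) beta * exp (- mu * (x * t))) ->
   (forall t, 0 < t <= 1/2 ->
      Cmod (Phi t - T t)%C <= K1 * (Rpower x (- (INR N + 1)) * Rpower (1 + x * t) (INR N + 2))) ->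
   (forall t, 1/2 <= t < 1 -> Cmod (Phi t) <= K1 * (Rpower x B * (1 + Rpower (1 - t) (rho - 1)))) ->
   (forall t, 1/2 <= t -> Cmod (T t) <= K1 * (1 + t ^ N)) ->
   is_int 0 1 (fun t => rpw t (p - 1) * Phi t * k t)%C l1 ->
   is_int 0 p_infty (fun t => rpw t (p - 1) * T t * k t)%C l2 ->
   Cmod (l1 - l2)%C <= K * Rpower x (- (fst p + INR N + 1/2)).
Proof.
intros Hp Hmu HB Hrho P1. set (sg := fst p) in *. assert (N0 := pos_INR N).
(* eta <= 1/2 gains at least half a power of x over the last term; eta <= sg
   makes the exponent sg - eta used near 0 nonnegative. *)
set (eta := Rmin sg (1/2)). assert (E0 : 0 < eta) by (apply Rmin_pos; lra).
assert (E1 : eta <= sg) by apply Rmin_l. assert (E2 : eta <= 1/2) by apply Rmin_r.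
set (M := sg + INR N + 1 - eta).
destruct (exp_decay_pow mu (beta + (INR N + 2)) (sg - eta) Hmu ltac:(lra)) as [K2 [P2 H2]].
destruct (exp_decay_pow mu beta (M + B) Hmu ltac:(unfold M; lra)) as [K4 [P4 H4]].
destruct (exp_decay_pow mu beta (sg + INR N + 1) Hmu ltac:(lra)) as [K6 [P6 H6]].
set (m1 := Rpower 2 (Rabs (sg - 1))). set (m2 := Rpower 2 (Rabs (- (M + B)))).
assert (M1 : 0 < m1) by apply Rpower_pos. assert (M2 : 0 < m2) by apply Rpower_pos.
set (A1 := K1 * K2). set (A2 := m1 * (3 * K1) * (K4 * m2)). set (A3 := 2 * K1 * K6).
assert (PA1 : 0 <= A1) by (unfold A1; nra).
assert (PA2 : 0 <= A2) by (unfold A2; repeat apply Rmult_le_pos; lra).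
assert (PA3 : 0 <= A3) by (unfold A3; nra).
set (A := A1 + A2 + A3).
assert (PC : 0 <= / eta + / rho + 2).
{ assert (0 < / eta) by now apply Rinv_0_lt_compat. assert (0 < / rho) by now apply Rinv_0_lt_compat. lra. }
exists (A * (/ eta + / rho + 2)). split; [apply Rmult_le_pos; [unfold A; lra|exact PC]|].
intros x Phi T k l1 l2 Hx Hk HPT HPhi HT Hl1 Hl2.
set (X := Rpower x (- M)). assert (X0 : 0 < X) by apply Rpower_pos.
apply Rle_trans with (A * X * (/ eta + / rho + 2)).
2:{ replace (A * X * (/ eta + / rho + 2)) with (A * (/ eta + / rho + 2) * X) by ring.
    apply Rmult_le_compat_l; [apply Rmult_le_pos; [unfold A; lra|exact PC]|]. apply Rpower_le_exp; unfold M; lra. }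
assert (DIF : forall t, Cmod (rpw t (p - 1) * Phi t * k t - rpw t (p - 1) * T t * k t)%C
   = Rpower t (sg - 1) * Cmod (Phi t - T t)%C * Cmod (k t)).
{ intros t. replace (rpw t (p - 1) * Phi t * k t - rpw t (p - 1) * T t * k t)%C
    with (rpw t (p - 1) * (Phi t - T t) * k t)%C by ring. now rewrite !Cmod_mult, Cmod_rpw. }
apply (int_compare _ _ _ _ (A * X) eta rho) with (4 := Hl1) (5 := Hl2); try lra.
- apply Rmult_le_pos; [unfold A; lra|lra].
- intros t Ht. rewrite DIF. specialize (Hk t ltac:(lra)). specialize (HPT t Ht).
  assert (L := H2 (x * t) ltac:(nra)). rewrite Rpower_mult_base in L by lra.
  set (Y := Rpower x (- (INR N + 1))) in *. set (R1 := Rpower t (sg - 1)).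
  assert (Y0 : 0 < Y) by apply Rpower_pos. assert (R10 : 0 < R1) by apply Rpower_pos.
  apply Rle_trans with (R1 * (K1 * (Y * Rpower (1 + x * t) (INR N + 2))) * (Rpower (1 + x * t) beta * exp (- mu * (x * t)))).
  { apply Rmult_le_compat; auto using Cmod_ge_0.
    - apply Rmult_le_pos; [lra|apply Cmod_ge_0].
    - apply Rmult_le_compat_l; lra. }
  apply Rle_trans with (R1 * (K1 * Y) * (K2 * (Rpower x (- (sg - eta)) * Rpower t (- (sg - eta))))).
  { replace (R1 * (K1 * (Y * Rpower (1 + x * t) (INR N + 2))) * (Rpower (1 + x * t) beta * exp (- mu * (x * t))))
     with (R1 * (K1 * Y) * (Rpower (1 + x * t) (beta + (INR N + 2)) * exp (- mu * (x * t)))) by (rewrite Rpower_plus; ring).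
    apply Rmult_le_compat_l; [|exact L]. apply Rmult_le_pos; nra. }
  replace (R1 * (K1 * Y) * (K2 * (Rpower x (- (sg - eta)) * Rpower t (- (sg - eta))))) with (A1 * X * Rpower t (eta - 1)).
  + apply Rmult_le_compat_r; [left; apply Rpower_pos|]. apply Rmult_le_compat_r; [lra|]. unfold A; lra.
  + replace (eta - 1) with ((sg - 1) + - (sg - eta)) by ring. rewrite Rpower_plus. fold R1.
    replace X with (Y * Rpower x (- (sg - eta))); [unfold A1; ring|].
    unfold X, Y. rewrite <- Rpower_plus. f_equal. unfold M. ring.
- intros t Ht. rewrite DIF. specialize (Hk t ltac:(lra)). specialize (HPhi t Ht). specialize (HT t ltac:(lra)).
  assert (T1 := Rpower_middle t (sg - 1) ltac:(lra)). fold m1 in T1.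
  assert (T2 := Rpower_middle t (- (M + B)) ltac:(lra)). fold m2 in T2.
  assert (L := Rle_trans _ _ _ Hk (H4 (x * t) ltac:(nra))). rewrite Rpower_mult_base in L by lra.
  assert (TN : t ^ N <= 1). { apply Rle_trans with (1 ^ N); [apply pow_incr; lra|rewrite pow1; lra]. }
  assert (Q := Rpower_pos (1 - t) (rho - 1)). set (R1 := Rpower (1 - t) (rho - 1)) in *.
  assert (XB : 1 <= Rpower x B). { rewrite <- (Rpower_O x) by lra. apply Rpower_le_exp; lra. }
  assert (EE : Cmod (Phi t - T t)%C <= 3 * K1 * (Rpower x B * (1 + R1))).
  { eapply Rle_trans; [apply Cmod_triangle|]. rewrite Cmod_opp.
    assert (Cmod (T t) <= 2 * K1) by nra. assert (1 <= Rpower x B * (1 + R1)) by nra. nra. }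
  apply Rle_trans with (m1 * (3 * K1 * (Rpower x B * (1 + R1))) * (K4 * (Rpower x (- (M + B)) * m2))).
  + apply Rmult_le_compat; auto using Cmod_ge_0.
    * apply Rmult_le_pos; [left; apply Rpower_pos|apply Cmod_ge_0].
    * apply Rmult_le_compat; auto using Cmod_ge_0. left; apply Rpower_pos.
    * eapply Rle_trans; [exact L|]. apply Rmult_le_compat_l; [lra|]. apply Rmult_le_compat_l; [left; apply Rpower_pos|exact T2].
  + replace (m1 * (3 * K1 * (Rpower x B * (1 + R1))) * (K4 * (Rpower x (- (M + B)) * m2))) with (A2 * X * (1 + R1)).
    * apply Rmult_le_compat_r; [lra|]. apply Rmult_le_compat_r; [lra|]. unfold A; lra.
    * unfold A2, X. replace (- M) with (B + - (M + B)) at 1 by ring. rewrite Rpower_plus. ring.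
- intros t Ht. rewrite !Cmod_mult, Cmod_rpw. change (fst (p - 1)%C) with (sg - 1).
  specialize (Hk t ltac:(lra)). specialize (HT t ltac:(lra)).
  assert (L := Rle_trans _ _ _ Hk (H6 (x * t) ltac:(nra))). rewrite Rpower_mult_base in L by lra.
  assert (TN : 1 <= t ^ N) by (apply pow_R1_Rle; lra).
  assert (TT : Cmod (T t) <= 2 * K1 * t ^ N) by nra.
  set (Y := Rpower x (- (sg + INR N + 1))) in *.
  apply Rle_trans with (Rpower t (sg - 1) * (2 * K1 * t ^ N) * (K6 * (Y * Rpower t (- (sg + INR N + 1))))).
  + apply Rmult_le_compat; auto using Cmod_ge_0.
    * apply Rmult_le_pos; [left; apply Rpower_pos|apply Cmod_ge_0].
    * apply Rmult_le_compat_l; [left; apply Rpower_pos|exact TT].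
  + rewrite <- (Rpower_pow N t) by lra.
    replace (Rpower t (sg - 1) * (2 * K1 * Rpower t (INR N)) * (K6 * (Y * Rpower t (- (sg + INR N + 1)))))
     with (A3 * Y * Rpower t (- 2)).
    * apply Rmult_le_compat_r; [left; apply Rpower_pos|].
      assert (Y <= X) by (apply Rpower_le_exp; unfold M; lra).
      apply Rmult_le_compat; try lra; [left; apply Rpower_pos|unfold A; lra].
    * replace (- 2) with ((sg - 1) + INR N + - (sg + INR N + 1)) by ring. rewrite !Rpower_plus. unfold A3; ring.
Qed.

Lemma pow_rescale x t N : 1 <= x -> 0 < t ->
  (/ x) ^ S N <= Rpower x (- (INR N + 1)) * Rpower (1 + x * t) (INR N + 2) /\
  t ^ S N <= Rpower x (- (INR N + 1)) * Rpower (1 + x * t) (INR N + 2).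
Proof.
intros Hx Ht. assert (N0 := pos_INR N). assert (S1 : 0 < x * t) by nra.
assert (E : (/ x) ^ S N = Rpower x (- (INR N + 1))).
{ rewrite pow_inv, Rpower_Ropp, <- S_INR, Rpower_pow by lra. reflexivity. }
assert (P := Rpower_pos x (- (INR N + 1))).
assert (G : Rpower (1 + x * t) (INR N + 1) <= Rpower (1 + x * t) (INR N + 2)) by (apply Rpower_le_exp; lra).
assert (G1 : 1 <= Rpower (1 + x * t) (INR N + 1)).
{ apply Rle_trans with (Rpower (1 + x * t) 0); [rewrite Rpower_O; lra|apply Rpower_le_exp; lra]. }
split; [rewrite E; nra|].
replace (t ^ S N) with (Rpower x (- (INR N + 1)) * (x * t) ^ S N).
- apply Rmult_le_compat_l; [lra|]. eapply Rle_trans; [|exact G].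
  rewrite <- S_INR, Rpower_pow by lra. apply pow_incr. lra.
- rewrite <- E, <- Rpow_mult_distr. f_equal. field. lra.
Qed.

(** * Gauss's product, Beta integrals and the zeros of Gamma *)

Lemma C_neq_0_Re (z : C) : 0 < fst z -> z <> 0%C.
Proof. intros H Z. rewrite Z in H. simpl in H. lra. Qed.

Lemma poch_neq_0 (z : C) n : 0 < fst z -> poch z n <> 0%C.
Proof.
intros H. induction n; simpl.
- intros Z. apply RtoC_inj in Z. lra.
- apply Cmult_neq_0; [exact IHn|]. apply C_neq_0_Re. simpl. assert (P := pos_INR n). lra.
Qed.

Lemma Rpower_small_1 s : 0 < s -> forall eps, 0 < eps -> at_left 1 (fun t => Rpower (1 - t) s < eps).
Proof.
intros Hs eps P. destruct (Rpower_small_0 s Hs eps P) as [d Hd]. exists d. intros t Ht Htb.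
apply Hd; [|lra].
unfold_ball_goal. unfold_ball Ht.
replace (1 - t + - 0) with (- (t + - (1))) by ring. now rewrite Rabs_Ropp.
Qed.

(** From B(p,q+1) + B(p+1,q) = B(p,q) and p B(p,q+1) = q B(p+1,q); the latter
    integrates the derivative of t^p (1-t)^q. *)
Lemma beta_shift (p q : C) l : 0 < fst p -> 0 < fst q -> is_int 0 1 (beta_fun p q) l ->
  is_int 0 1 (beta_fun p (q + 1)) (q / (p + q) * l)%C.
Proof.
intros Hp Hq H.
destruct (ex_int_beta_fun p (q + 1)%C Hp ltac:(simpl; lra)) as [l1 H1].
destruct (ex_int_beta_fun (p + 1)%C q ltac:(simpl; lra) Hq) as [l2 H2].
assert (E1 : (l1 + l2)%C = l).
{ apply (is_int_unique 0 1 (beta_fun p q)); [simpl; lra| |exact H].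
  eapply is_int_ext; [|exact (is_int_plus _ _ _ _ _ _ H1 H2)]. intros t [Ht Ht1]. simpl in Ht1. cbv beta. unfold beta_fun.
  replace (q + 1 - 1)%C with (1 + (q - 1))%C by ring. replace (p + 1 - 1)%C with (1 + (p - 1))%C by ring.
  rewrite !rpw_plus, !rpw_1 by lra. rewrite RtoC_minus. ring. }
assert (E2 : (p * l1 - q * l2)%C = 0%C).
{ apply (is_int_unique 0 1 (fun t => p * beta_fun p (q + 1) t - q * beta_fun (p + 1) q t)%C); [simpl; lra| |].
  { apply is_int_minus; now apply is_int_scal. }
  exists (fun t => rpw t p * rpw (1 - t) q)%C, 0%C, 0%C.
  assert (B : forall t : R, Cmod (rpw t p * rpw (1 - t) q)%C = Rpower t (fst p) * Rpower (1 - t) (fst q)).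
  { intros t. now rewrite Cmod_mult, !Cmod_rpw. }
  split; [|split; [|split; [|ring]]].
  - intros t [Ht Ht1]. simpl in Ht1. eapply derivC_eq; [apply derivC_mult; [now apply derivC_rpw|now apply derivC_rpw1m]|].
    unfold beta_fun. replace (q + 1 - 1)%C with q by ring. replace (p + 1 - 1)%C with p by ring. ring.
  - apply limat_R_bound with (fun t => Rpower t (fst p)).
    + exists (mkposreal 1 Rlt_0_1). intros t Hb Ht.
      unfold_ball Hb.
      apply Rabs_def2 in Hb. rewrite B. assert (P := Rpower_pos t (fst p)).
      assert (Q := Rpower_le_1_base (1 - t) (fst q) ltac:(lra) ltac:(lra)). nra.
    + now apply Rpower_small_0.
  - apply limat_R_bound with (fun t => Rpower (1 - t) (fst q)).
    + exists (mkposreal 1 Rlt_0_1). intros t Hb Ht.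
      unfold_ball Hb.
      apply Rabs_def2 in Hb. rewrite B. assert (P := Rpower_pos (1 - t) (fst q)).
      assert (Q := Rpower_le_1_base t (fst p) ltac:(lra) ltac:(lra)). nra.
    + now apply Rpower_small_1. }
assert (Z : (p + q)%C <> 0%C) by (apply C_neq_0_Re; simpl; lra).
replace (q / (p + q) * l)%C with l1; [exact H1|].
transitivity ((p * l1 + q * l1) / (p + q))%C; [field; exact Z|].
replace (p * l1)%C with ((p * l1 - q * l2) + q * l2)%C by ring. rewrite E2, <- E1. field. exact Z.
Qed.

Lemma beta_shift_n (p q : C) l n : 0 < fst p -> 0 < fst q -> is_int 0 1 (beta_fun p q) l ->
  is_int 0 1 (beta_fun p (q + INR n)) (poch q n / poch (p + q) n * l)%C.
Proof.
intros Hp Hq H. induction n.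
- simpl. rewrite Cplus_0_r. replace (1 / 1 * l)%C with l by field. exact H.
- rewrite RtoC_S, Cplus_assoc. assert (P := pos_INR n).
  eapply is_int_eq; [apply beta_shift; [exact Hp| |exact IHn]|].
  + simpl. lra.
  + simpl. rewrite Cplus_assoc. field. split.
    * apply C_neq_0_Re. simpl. lra.
    * apply poch_neq_0. simpl. lra.
Qed.

Lemma pow_diff_le a b n : 0 <= a <= b -> (b ^ n - a ^ n) * b <= INR n * (b - a) * b ^ n.
Proof.
intros H. induction n.
- simpl. nra.
- rewrite S_INR. simpl pow.
  replace ((b * b ^ n - a * a ^ n) * b) with (b * ((b ^ n - a ^ n) * b) + (a ^ n * (b - a)) * b) by ring.
  assert (A : a ^ n <= b ^ n) by (apply pow_incr; exact H).
  assert (B : 0 <= a ^ n) by (apply pow_le; lra).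
  assert (b * ((b ^ n - a ^ n) * b) <= b * (INR n * (b - a) * b ^ n)) by (apply Rmult_le_compat_l; lra).
  assert (a ^ n * (b - a) * b <= b ^ n * (b - a) * b) by (apply Rmult_le_compat_r; [lra|apply Rmult_le_compat_r; lra]).
  lra.
Qed.

Lemma exp_pow t n : exp (- t) ^ n = exp (- INR n * t).
Proof.
induction n; [simpl; rewrite <- exp_0; f_equal; ring|].
rewrite S_INR. simpl pow. rewrite IHn, <- exp_plus. f_equal; ring.
Qed.

Lemma one_minus_le_exp t : 1 - t <= exp (- t).
Proof. assert (H := exp_ineq1_le (- t)). lra. Qed.

Lemma pow_exp_diff t n : 0 < t < 1 ->
  Rabs ((1 - t) ^ n - exp (- INR n * t)) <= 3 * INR n * t ^ 2 * exp (- INR n * t).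
Proof.
intros Ht. rewrite <- exp_pow.
assert (A := one_minus_le_exp t).
assert (B : exp (- t) - (1 - t) <= t ^ 2).
{ assert (P := exp_ineq1_le t). assert (Q : exp (- t) * exp t = 1).
  { rewrite <- exp_plus, <- exp_0. f_equal; ring. }
  assert (0 < exp (- t)) by apply exp_pos. nra. }
assert (C := pow_diff_le (1 - t) (exp (- t)) n ltac:(lra)).
assert (E : exp (- t) ^ n >= (1 - t) ^ n) by (apply Rle_ge, pow_incr; lra).
rewrite Rabs_left1 by lra.
(* The comparison of n-th powers loses one factor e^(-t). *)
assert (X : 1 <= 3 * exp (- t)).
{ assert (Q : exp (- t) * exp t = 1). { rewrite <- exp_plus, <- exp_0. f_equal; ring. }
  assert (exp t <= 3) by (apply Rle_trans with (2 := exp_le_3); apply exp_le; lra).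
  assert (0 < exp (- t)) by apply exp_pos. nra. }
assert (N0 := pos_INR n). assert (P0 := pow_lt (exp (- t)) n (exp_pos _)).
apply Rle_trans with (3 * ((exp (- t) ^ n - (1 - t) ^ n) * exp (- t))).
- assert (0 <= exp (- t) ^ n - (1 - t) ^ n) by lra. nra.
- apply Rle_trans with (3 * (INR n * (exp (- t) - (1 - t)) * exp (- t) ^ n)); [lra|].
  replace (3 * INR n * t ^ 2 * exp (- t) ^ n) with (3 * (INR n * t ^ 2 * exp (- t) ^ n)) by ring.
  apply Rmult_le_compat_l; [lra|]. apply Rmult_le_compat_r; [lra|]. apply Rmult_le_compat_l; lra.
Qed.

Lemma rpw_one_minus_lipschitz p : exists K, 0 <= K /\ forall t, 0 < t <= 1/2 -> Cmod (rpw (1 - t) p - 1)%C <= K * t.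
Proof.
destruct (binomial_half (- p)%C 0) as [K [K0 H]]. exists K; split; [exact K0|]. intros t Ht.
specialize (H t). rewrite Cmod_R, Rabs_pos_eq in H by lra. specialize (H ltac:(lra)).
rewrite sum_O in H. unfold binc in H. simpl in H. rewrite Rmult_1_r in H.
rewrite <- RtoC_minus, spw_RtoC in H by lra. replace (- - p)%C with p in H by ring.
replace (1 / 1 * 1)%C with (RtoC 1) in H by field. exact H.
Qed.

(** The integral concentrates at t of order 1/n, where (1-t)^n is close to
    e^(-nt) and (1-t)^p to 1. *)
Lemma beta_large (p q : C) : 0 <= fst p -> 0 < fst q -> exists K, 0 <= K /\ forall n l, (1 <= n)%nat ->
  is_int 0 1 (beta_fun q (p + 1 + INR n)) l ->
  Cmod (l - rpw (INR n) (- q) * Cgamma q)%C <= K * Rpower (INR n) (- (fst q + 1/2)).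
Proof.
intros Hp Hq. destruct (rpw_one_minus_lipschitz p) as [K1 [P1 H1]].
destruct (watson q 0 1 0 0 1 (K1 + 3) Hq ltac:(lra) ltac:(lra) ltac:(lra) ltac:(lra)) as [K [K0 HK]].
exists K; split; [exact K0|]. intros n l Hn Hl.
set (x := INR n) in *. assert (X1 : 1 <= x) by (apply (le_INR 1); exact Hn).
(* With this factor in Phi, the Beta integrand gets the kernel e^(-xt) of the
   Gamma integrand. *)
set (E := fun t => (1 - t) ^ n * exp (x * t)).
assert (EE : forall t, exp (x * t) * exp (- x * t) = 1).
{ intros t. rewrite <- exp_plus, <- exp_0. f_equal; ring. }
assert (EB : forall t, 0 < t < 1 -> 0 <= E t <= 1 /\ Rabs (E t - 1) <= 3 * x * t ^ 2).
{ intros t Ht. assert (A := one_minus_le_exp t). assert (B := exp_pos (x * t)).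
  assert (C : (1 - t) ^ n <= exp (- x * t)) by (unfold x; rewrite <- exp_pow; apply pow_incr; lra).
  assert (D : 0 <= (1 - t) ^ n) by (apply pow_le; lra). specialize (EE t). unfold E. split; [split; nra|].
  assert (Q := pow_exp_diff t n Ht). fold x in Q.
  replace ((1 - t) ^ n * exp (x * t) - 1) with (exp (x * t) * ((1 - t) ^ n - exp (- x * t))) by lra.
  rewrite Rabs_mult, Rabs_pos_eq by lra. apply (Rmult_le_compat_l (exp (x * t))) in Q; [|lra].
  eapply Rle_trans; [exact Q|]. right. transitivity (3 * x * t ^ 2 * (exp (x * t) * exp (- x * t))); [ring|rewrite EE; ring]. }
replace (fst q + 1/2) with (fst q + INR 0 + 1/2) by (simpl; ring).
apply (HK x (fun t => rpw (1 - t) p * RtoC (E t))%C (fun _ => RtoC 1) (fun t => Cexp (- x * t))%C); auto.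
- intros t Ht. rewrite Cmod_Cexp_lin, Rpower_O, Rmult_1_l by nra. simpl fst. apply exp_le. lra.
- intros t Ht. destruct (EB t ltac:(lra)) as [B1 B2].
  replace (rpw (1 - t) p * RtoC (E t) - 1)%C with ((rpw (1 - t) p - 1) * RtoC (E t) + RtoC (E t - 1))%C by (rewrite RtoC_minus; ring).
  eapply Rle_trans; [apply Cmod_triangle|]. rewrite Cmod_mult, !Cmod_R, (Rabs_pos_eq (E t)) by lra.
  specialize (H1 t Ht). assert (Q := Cmod_ge_0 (rpw (1 - t) p - 1)%C).
  replace (Rpower x (- (INR 0 + 1)) * Rpower (1 + x * t) (INR 0 + 2)) with (/ x + 2 * t + x * t ^ 2).
  + assert (I : 0 < / x) by (apply Rinv_0_lt_compat; lra).
    assert (Cmod (rpw (1 - t) p - 1)%C * E t <= K1 * t) by nra.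
    assert (0 <= x * t ^ 2) by (apply Rmult_le_pos; [lra|apply pow2_ge_0]).
    assert (0 <= K1 * t) by nra. assert (0 <= K1 * / x) by nra. assert (0 <= K1 * (x * t ^ 2)) by nra. lra.
  + simpl INR. rewrite Rpower_Ropp. replace (0 + 1) with 1 by ring. rewrite Rpower_1 by lra.
    replace (0 + 2) with (INR 2) by (simpl; ring). rewrite Rpower_pow by nra. field. lra.
- intros t Ht. rewrite Cmod_mult, Cmod_rpw, Cmod_R, Rabs_pos_eq by (apply EB; lra).
  destruct (EB t ltac:(lra)) as [B1 _]. replace (1 - 1) with 0 by ring. rewrite !Rpower_O by lra.
  assert (Q := Rpower_le_1_base (1 - t) (fst p) ltac:(lra) Hp). assert (Q0 := Rpower_pos (1 - t) (fst p)). nra.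
- intros t _. rewrite Cmod_1. simpl. lra.
- eapply is_int_ext; [|exact Hl]. intros t [Ht Ht1]. simpl in Ht1. unfold beta_fun, E.
  replace (p + 1 + x - 1)%C with (p + x)%C by ring. unfold x. rewrite rpw_plus, rpw_nat by lra. fold x.
  replace (Cexp (- x * t)) with (RtoC (exp (- x * t))).
  + rewrite RtoC_mult.
    transitivity (rpw t (q - 1) * (rpw (1 - t) p * RtoC ((1 - t) ^ n)) * RtoC (exp (x * t) * exp (- x * t)))%C;
     [rewrite EE; ring | rewrite RtoC_mult; ring].
  + rewrite <- Cexp_RtoC. f_equal. rewrite RtoC_mult, RtoC_opp. reflexivity.
- eapply is_int_ext; [|apply (is_int_gamma_fun_scale q x Hq); lra]. intros t _. unfold gamma_fun. ring.
Qed.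

Lemma limat_mult {T} {Fl : (T -> Prop) -> Prop} {PF : ProperFilter Fl} F G L M :
  limat Fl F L -> limat Fl G M -> limat Fl (fun t => F t * G t)%C (L * M)%C.
Proof.
intros H K eps P. assert (A := Cmod_ge_0 L). assert (B := Cmod_ge_0 M).
set (d := Rmin 1 (eps / (Cmod L + Cmod M + 2))).
assert (D : 0 < d) by (apply Rmin_pos; [lra|apply Rdiv_lt_0_compat; lra]).
assert (D1 : d <= 1) by apply Rmin_l. assert (D2 : d <= eps / (Cmod L + Cmod M + 2)) by apply Rmin_r.
generalize (filter_and _ _ (H d D) (K d D)). apply filter_imp. intros t [U V].
replace (F t * G t - L * M)%C with ((F t - L) * (G t - M) + L * (G t - M) + M * (F t - L))%C by ring.
assert (Q : d * (Cmod L + Cmod M + 2) <= eps).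
{ replace eps with (eps / (Cmod L + Cmod M + 2) * (Cmod L + Cmod M + 2)) by (field; lra). apply Rmult_le_compat_r; lra. }
eapply Rle_lt_trans; [apply Cmod_triangle|].
eapply Rle_lt_trans; [apply Rplus_le_compat_r, Cmod_triangle|].
rewrite !Cmod_mult. assert (U0 := Cmod_ge_0 (F t - L)%C). assert (V0 := Cmod_ge_0 (G t - M)%C). nra.
Qed.

Lemma eventually_INR M : eventually (fun n => M < INR n).
Proof. assert (H := is_lim_seq_INR). apply is_lim_seq_spec in H. exact (H M). Qed.

Lemma beta_limit (p q : C) (l : nat -> C) : 0 <= fst p -> 0 < fst q ->
  (forall n, is_int 0 1 (beta_fun q (p + 1 + INR n)) (l n)) ->
  limat eventually (fun n => rpw (INR n) q * l n)%C (Cgamma q).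
Proof.
intros Hp Hq Hl. destruct (beta_large p q Hp Hq) as [K [K0 H]].
intros eps P. destruct (Rpower_small_infty (1/2) ltac:(lra) (eps / (K + 1)) ltac:(apply Rdiv_lt_0_compat; lra)) as [M HM].
generalize (eventually_INR (Rmax M 0)). apply filter_imp. intros n Hn.
assert (U := Rmax_l M 0). assert (V := Rmax_r M 0).
assert (N1 : (1 <= n)%nat). { apply INR_lt. simpl. lra. }
specialize (H n (l n) N1 (Hl n)). specialize (HM (INR n) ltac:(lra)).
replace (rpw (INR n) q * l n - Cgamma q)%C with (rpw (INR n) q * (l n - rpw (INR n) (- q) * Cgamma q))%C.
- rewrite Cmod_mult, Cmod_rpw.
  apply Rle_lt_trans with (K * Rpower (INR n) (- (1/2))).
  + replace (K * Rpower (INR n) (- (1/2))) with (Rpower (INR n) (fst q) * (K * Rpower (INR n) (- (fst q + 1/2)))).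
    * apply Rmult_le_compat_l; [left; apply Rpower_pos|exact H].
    * replace (- (1/2)) with (fst q + - (fst q + 1/2)) by ring. rewrite Rpower_plus. ring.
  + assert (Z := Rpower_pos (INR n) (- (1/2))).
    assert (Rpower (INR n) (- (1/2)) * (K + 1) < eps).
    { replace eps with (eps / (K + 1) * (K + 1)) by (field; lra). apply Rmult_lt_compat_r; lra. }
    lra.
- replace (rpw (INR n) q * (l n - rpw (INR n) (- q) * Cgamma q))%C
   with (rpw (INR n) q * l n - (rpw (INR n) q * rpw (INR n) (- q)) * Cgamma q)%C by ring.
  rewrite <- rpw_plus. replace (q + - q)%C with (RtoC 0) by ring. rewrite rpw_0. ring.
Qed.

Lemma poch_1 n : poch 1 n = RtoC (INR (fact n)).
Proof.
induction n; [reflexivity|]. simpl poch. rewrite IHn. replace (fact (S n)) with (S n * fact n)%nat by reflexivity.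
rewrite mult_INR, RtoC_mult, RtoC_S. ring.
Qed.

Lemma is_int_beta_fun_1 (z : C) : 0 < fst z -> is_int 0 1 (beta_fun z 1) (/ z)%C.
Proof.
intros Hz. exists (fun t => / z * rpw t z)%C, 0%C, (/ z)%C.
assert (Z := C_neq_0_Re z Hz).
split; [|split; [|split; [|ring]]].
- intros t [Ht _]. eapply derivC_eq; [apply derivC_scal, derivC_rpw; exact Ht|].
  unfold beta_fun. replace (1 - 1)%C with (RtoC 0) by ring. rewrite rpw_0. field. exact Z.
- replace (RtoC 0) with (/ z * 0)%C by ring. apply limat_scal.
  apply limat_R_bound with (fun t => Rpower t (fst z)).
  + apply filter_forall. intros t. rewrite Cmod_rpw. lra.
  + now apply Rpower_small_0.
- replace (/ z)%C with (/ z * rpw 1 z)%C at 1 by (rewrite rpw_base_1; ring).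
  apply (contC_limat (fun t => / z * rpw t z)%C 1).
  + typeclasses eauto.
  + apply filter_le_within.
  + eapply derivC_contC, derivC_scal, derivC_rpw. lra.
Qed.

(** Gauss's product n^z n! / (z (z+1) ... (z+n)). *)
Definition gauss (z : C) (n : nat) : C := (rpw (INR n) z * RtoC (INR (fact n)) / poch z (S n))%C.

(** The case p = 0 of [beta_limit], as B(z,1+n) = n! / (z)_(n+1). *)
Lemma gauss_limit (z : C) : 0 < fst z -> limat eventually (gauss z) (Cgamma z).
Proof.
intros Hz.
apply (limat_ext (fun n => rpw (INR n) z * (poch 1 n / poch (z + 1) n * / z))%C).
- apply filter_forall. intros n. unfold gauss. rewrite poch_1, poch_S_left. field.
  split; [apply poch_neq_0; simpl; lra|now apply C_neq_0_Re].
- apply (beta_limit 0%C z (fun n => (poch 1 n / poch (z + 1) n * / z)%C)); [simpl; lra|exact Hz|].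
  intros n. rewrite Cplus_0_l. apply beta_shift_n; [exact Hz|simpl; lra|now apply is_int_beta_fun_1].
Qed.

(** The product of gauss p n and n^q B(q,p+1+n) is gauss (p+q) n times B(q,p),
    for every n. *)
Lemma beta_gamma (p q : C) l : 0 < fst p -> 0 < fst q -> is_int 0 1 (beta_fun q p) l ->
  (Cgamma p * Cgamma q)%C = (Cgamma (p + q) * l)%C.
Proof.
intros Hp Hq Hl.
assert (L1 : limat eventually (fun n => gauss p n * (rpw (INR n) q * (poch p (S n) / poch (q + p) (S n) * l)))%C (Cgamma p * Cgamma q)%C).
{ apply limat_mult; [now apply gauss_limit|].
  apply (beta_limit p q (fun n => poch p (S n) / poch (q + p) (S n) * l)%C); [lra|exact Hq|].
  intros n. replace (p + 1 + INR n)%C with (p + RtoC (INR (S n)))%C by (rewrite RtoC_S; ring).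
  now apply beta_shift_n. }
assert (L2 : limat eventually (fun n => gauss (p + q) n * l)%C (Cgamma (p + q) * l)%C).
{ apply limat_mult; [apply gauss_limit; simpl; lra|apply limat_const]. }
refine (limat_unique _ _ _ L1 (limat_ext _ _ _ _ L2)).
apply filter_forall. intros n. unfold gauss. rewrite (Cplus_comm q p), rpw_plus. field.
split; apply poch_neq_0; simpl; lra.
Qed.

Lemma Cmod_shift_le (z : C) k : 0 < k ->
  Cmod (z + k)%C <= k * exp (fst z / k + Cmod z ^ 2 / k ^ 2).
Proof.
intros Hk. set (e := fst z / k + Cmod z ^ 2 / k ^ 2).
assert (E : Cmod (z + k)%C ^ 2 <= (k * exp e) ^ 2).
{ rewrite Cmod_sqr. simpl fst; simpl snd.
  replace ((k * exp e) ^ 2) with (k ^ 2 * exp (2 * e)).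
  2:{ replace (2 * e) with (e + e) by ring. rewrite exp_plus. ring. }
  assert (H := exp_ineq1_le (2 * e)).
  apply Rle_trans with (k ^ 2 * (1 + 2 * e)).
  - unfold e. replace (k ^ 2 * (1 + 2 * (fst z / k + Cmod z ^ 2 / k ^ 2))) with (k ^ 2 + 2 * k * fst z + 2 * Cmod z ^ 2) by (field; lra).
    rewrite Cmod_sqr. nra.
  - apply Rmult_le_compat_l; [nra|exact H]. }
assert (A := Cmod_ge_0 (z + k)%C). assert (B : 0 < k * exp e) by (apply Rmult_lt_0_compat; [exact Hk|apply exp_pos]).
nra.
Qed.

(** Multiply the bounds |z + k| <= k exp (Re z / k + |z|^2 / k^2); the sums of
    1/k and 1/k^2 up to n are at most 1 + ln n and 2 - 1/n. *)
Lemma poch_upper (z : C) n : 0 < fst z ->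
  Cmod (poch z (S (S n))) <= Cmod z * INR (fact (S n)) *
    exp (fst z * (1 + ln (INR (S n))) + Cmod z ^ 2 * (2 - / INR (S n))).
Proof.
intros Hz. assert (Z0 := Cmod_ge_0 z). induction n.
- simpl. rewrite ln_1, Cmult_1_l, Cplus_0_r, Cmod_mult. rewrite Rmult_1_r.
  apply Rmult_le_compat_l; [exact Z0|]. assert (H := Cmod_shift_le z 1 Rlt_0_1).
  eapply Rle_trans; [exact H|]. rewrite Rmult_1_l. apply exp_le. simpl. field_simplify; lra.
- change (poch z (S (S (S n)))) with (poch z (S (S n)) * (z + RtoC (INR (S (S n)))))%C.
  rewrite Cmod_mult. set (k := INR (S (S n))).
  assert (K1 : INR (S n) = k - 1) by (unfold k; rewrite (S_INR (S n)); ring).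
  assert (K2 : 2 <= k) by (unfold k; rewrite !S_INR; assert (P := pos_INR n); lra).
  assert (H := Cmod_shift_le z k ltac:(lra)).
  rewrite K1 in IHn.
  eapply Rle_trans; [apply Rmult_le_compat; [apply Cmod_ge_0|apply Cmod_ge_0|exact IHn|exact H]|].
  replace (fact (S (S n))) with (S (S n) * fact (S n))%nat by reflexivity. rewrite mult_INR. fold k.
  match goal with |- ?a * ?b * exp ?c * (k * exp ?d) <= _ => replace (a * b * exp c * (k * exp d)) with (a * (k * b) * exp (c + d)) end.
  2:{ rewrite exp_plus; ring. }
  apply Rmult_le_compat_l.
  { apply Rmult_le_pos; [exact Z0|]. apply Rmult_le_pos; [lra|apply pos_INR]. }
  apply exp_le.
  assert (L : ln (k - 1) + / k <= ln k).
  { assert (Q : ln ((k - 1) * / k) <= (k - 1) * / k - 1).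
    { assert (U := exp_ineq1_le (ln ((k - 1) * / k))). rewrite exp_ln in U.
      - lra.
      - apply Rmult_lt_0_compat; [lra|apply Rinv_0_lt_compat; lra]. }
    rewrite ln_mult, ln_Rinv in Q by (try apply Rinv_0_lt_compat; lra).
    replace ((k - 1) * / k - 1) with (- / k) in Q by (field; lra). lra. }
  assert (V : / k ^ 2 <= / (k - 1) - / k).
  { replace (/ (k - 1) - / k) with (/ (k * (k - 1))) by (field; lra). apply Rinv_le_contravar; nra. }
  unfold Rdiv. assert (Z2 : 0 <= Cmod z ^ 2) by (apply pow_le; exact Z0).
  assert (fst z * (ln (k - 1) + / k) <= fst z * ln k) by (apply Rmult_le_compat_l; lra).
  assert (Cmod z ^ 2 * / k ^ 2 <= Cmod z ^ 2 * (/ (k - 1) - / k)) by (apply Rmult_le_compat_l; lra).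
  lra.
Qed.

(** By [poch_upper], Gauss's product is bounded away from 0. *)
Lemma Cgamma_neq_0 (z : C) : 0 < fst z -> Cgamma z <> 0%C.
Proof.
intros Hz Z. assert (Zn := C_neq_0_Re z Hz). assert (Z0 : 0 < Cmod z) by now apply Cmod_gt_0.
set (Kz := Cmod z * exp (fst z + Cmod z ^ 2 * 2)).
assert (K0 : 0 < Kz) by (apply Rmult_lt_0_compat; [exact Z0|apply exp_pos]).
assert (L := gauss_limit z Hz). rewrite Z in L.
destruct (filter_ex (F := eventually) _ (filter_and (F := eventually) _ _ (L (/ Kz) ltac:(now apply Rinv_0_lt_compat)) (eventually_INR 0))) as [n [H Hn]].
destruct n as [|n]; [simpl in Hn; lra|].
replace (gauss z (S n) - 0)%C with (gauss z (S n)) in H by ring.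
assert (PN := poch_neq_0 z (S (S n)) Hz). assert (PM : 0 < Cmod (poch z (S (S n)))) by now apply Cmod_gt_0.
unfold gauss in H. rewrite Cmod_div, Cmod_mult, Cmod_rpw, Cmod_R, Rabs_pos_eq in H by (try exact PN; apply pos_INR).
assert (U := poch_upper z n Hz).
assert (F : 0 < INR (fact (S n))) by (apply lt_0_INR, lt_O_fact).
assert (B : Cmod (poch z (S (S n))) <= Kz * (Rpower (INR (S n)) (fst z) * INR (fact (S n)))).
{ eapply Rle_trans; [exact U|]. unfold Kz, Rpower.
  replace (Cmod z * exp (fst z + Cmod z ^ 2 * 2) * (exp (fst z * ln (INR (S n))) * INR (fact (S n))))
   with (Cmod z * INR (fact (S n)) * exp (fst z + Cmod z ^ 2 * 2 + fst z * ln (INR (S n)))) by (rewrite exp_plus; ring).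
  apply Rmult_le_compat_l; [nra|]. apply exp_le.
  assert (0 < / INR (S n)) by (apply Rinv_0_lt_compat; exact Hn).
  assert (0 <= Cmod z ^ 2 * / INR (S n)) by (apply Rmult_le_pos; [apply pow_le|]; lra). lra. }
set (g := Rpower (INR (S n)) (fst z) * INR (fact (S n))) in *.
assert (g / Cmod (poch z (S (S n))) * (Kz * Cmod (poch z (S (S n)))) < / Kz * (Kz * Cmod (poch z (S (S n))))).
{ apply Rmult_lt_compat_r; [nra|exact H]. }
replace (g / Cmod (poch z (S (S n))) * (Kz * Cmod (poch z (S (S n))))) with (Kz * g) in H0 by (field; lra).
replace (/ Kz * (Kz * Cmod (poch z (S (S n))))) with (Cmod (poch z (S (S n)))) in H0 by (field; lra).
lra.
Qed.

(** * The exponential series and the Gamma integral with a complex rate *)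

Definition expc (v : C) (n : nat) : C := (v ^ n / RtoC (INR (fact n)))%C.

Lemma pow_fact_small x : 0 <= x -> is_lim_seq (fun n => x ^ n / INR (fact n)) 0.
Proof.
intros Hx. apply ex_series_lim_0. exists (exp x).
assert (H := is_exp_Reals x). apply is_pseries_R in H.
eapply is_series_ext; [|exact H]. intros n. unfold Rdiv. apply Rmult_comm.
Qed.

Lemma exp_series v : limat eventually (sum_n (expc v)) (Cexp v).
Proof.
assert (V0 := Cmod_ge_0 v).
set (K := Cmod v * exp (Cmod v)). assert (K0 : 0 <= K) by (apply Rmult_le_pos; [exact V0|left; apply exp_pos]).
assert (R : forall N, Cmod (Cexp v - sum_n (expc v) N)%C <= K * (Cmod v ^ N / INR (fact N))).
{ intros N. set (D := fun (n : nat) (t : R) => (v ^ n * Cexp (- (- v) * t))%C).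
  replace (Cexp v) with (D 0%nat 1) by (unfold D; simpl; rewrite Cmult_1_l; f_equal; ring).
  rewrite (sum_n_ext (expc v) (fun n => D n 0 / RtoC (INR (fact n)))%C).
  2:{ intros n. unfold D, expc. rewrite Cmult_0_r, Cexp_0, Cmult_1_r. reflexivity. }
  apply taylor_remainder.
  - intros n t _. unfold D. eapply derivC_eq; [apply derivC_scal, derivC_Cexp_lin|]. simpl. ring.
  - intros t Ht. unfold D. rewrite Cmod_mult, Cmod_pow, Cmod_Cexp_lin.
    assert (P1 : (1 - t) ^ N <= 1).
    { apply Rle_trans with (1 ^ N); [apply pow_incr; lra | rewrite pow1; lra]. }
    assert (P2 : 0 <= (1 - t) ^ N) by (apply pow_le; lra).
    assert (P3 : exp (- fst (- v)%C * t) <= exp (Cmod v)).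
    { apply exp_le. simpl. assert (Q := re_le_Cmod v). unfold Re in Q. assert (Q' := Rle_abs (fst v)). nra. }
    assert (P4 := exp_pos (- fst (- v)%C * t)).
    assert (P5 : 0 <= Cmod v ^ S N / INR (fact N)).
    { apply Rmult_le_pos; [now apply pow_le|]. left. apply Rinv_0_lt_compat, lt_0_INR, lt_O_fact. }
    apply Rle_trans with (Cmod v ^ S N / INR (fact N) * exp (Cmod v)).
    + match goal with |- ?a * ?b * ?c / ?d <= _ => replace (a * b * c / d) with (a / d * (b * c)) by (unfold Rdiv; ring) end.
      apply Rmult_le_compat_l; [exact P5|]. nra.
    + right. unfold K. simpl. unfold Rdiv. ring. }
apply (limat_of_bound _ _ K (fun n => Cmod v ^ n / INR (fact n)) K0); [|exact R|now apply pow_fact_small].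
intros n. apply Rmult_le_pos; [now apply pow_le|]. left. apply Rinv_0_lt_compat, lt_0_INR, lt_O_fact.
Qed.

Lemma pow_fact_le_exp x n : 0 <= x -> x ^ n / INR (fact n) <= exp x.
Proof.
intros Hx. assert (H := is_exp_Reals x). apply is_pseries_R in H.
assert (P : forall k, 0 <= / INR (fact k) * x ^ k).
{ intros k. apply Rmult_le_pos; [left; apply Rinv_0_lt_compat, lt_0_INR, lt_O_fact|now apply pow_le]. }
assert (E : ex_series (fun k => / INR (fact k) * x ^ k)) by (exists (exp x); exact H).
assert (SB := sum_n_le_Series _ n P E). rewrite (is_series_unique _ _ H) in SB.
eapply Rle_trans; [|exact SB]. clear SB E H. unfold Rdiv. rewrite Rmult_comm.
set (u := fun k => / INR (fact k) * x ^ k). change (u n <= sum_n u n).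
change (forall k, 0 <= u k) in P. clearbody u.
assert (Q : forall m, 0 <= sum_n u m).
{ induction m; [rewrite sum_O; apply P|]. rewrite sum_Sn.
  change (plus (sum_n u m) (u (S m))) with (sum_n u m + u (S m)). specialize (P (S m)). lra. }
destruct n; [rewrite sum_O; lra|]. rewrite sum_Sn.
change (plus (sum_n u n) (u (S n))) with (sum_n u n + u (S n)). specialize (Q n). lra.
Qed.

(** The two arguments have the same cosine and the same sign. *)
Lemma Clog_slitlog y : slit y -> Clog y = slitlog y.
Proof.
intros S. assert (P := slit_Cmod y S). unfold Clog, slitlog. f_equal.
set (th := 2 * atan (snd y / (Cmod y + fst y))).
assert (E := Cexp_slitlog y S). apply (f_equal fst) in E. unfold Cexp, slitlog, Re, Im in E; simpl in E.
rewrite exp_ln in E by exact P. fold th in E.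
assert (Cs : Re y / Cmod y = cos th). { unfold Re. rewrite <- E. field. lra. }
assert (B := atan_bound (snd y / (Cmod y + fst y))).
unfold slit in S. unfold Carg. rewrite Cs. destruct (Rle_dec 0 (Im y)) as [L|L]; unfold Im in L.
- assert (0 <= snd y / (Cmod y + fst y)) by (apply Rmult_le_pos; [exact L|left; now apply Rinv_0_lt_compat]).
  apply acos_cos. unfold th. assert (0 <= atan (snd y / (Cmod y + fst y))).
  { rewrite <- atan_0. destruct H as [H|H]; [left; now apply atan_increasing|rewrite <- H; lra]. }
  lra.
- assert (snd y / (Cmod y + fst y) < 0). { apply Rmult_neg_pos; [lra|now apply Rinv_0_lt_compat]. }
  apply atan_increasing in H. rewrite atan_0 in H.
  rewrite <- cos_neg, acos_cos by (unfold th; lra). unfold th; ring.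
Qed.

Lemma Cpower_spw y s : slit y -> Cpower y s = spw y s.
Proof. intros H. unfold Cpower, spw. now rewrite Clog_slitlog. Qed.

(** Expand e^((r-y)t) for a real rate r. The Gamma integrals with rate r turn
    this series into the binomial series of (r - (r-y))^(-z). Any y with Re y
    > 0 satisfies |r - y| < r when r is large enough. *)
Lemma is_int_gamma_fun_complex (z y : C) : 0 < fst z -> 0 < fst y ->
  is_int 0 p_infty (gamma_fun z y) (spw y (- z) * Cgamma z)%C.
Proof.
intros Hz Hy.
(* |r - y| < r means |y|^2 < 2 r Re y. *)
set (r := Cmod y ^ 2 / fst y).
assert (Y2 := Cmod_sqr y).
assert (R0 : 0 < r). { apply Rdiv_lt_0_compat; [rewrite Y2; nra|exact Hy]. }
set (d := Cmod (r - y)%C). assert (D0 : 0 <= d) by apply Cmod_ge_0.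
assert (Dr : d < r).
{ assert (E : d ^ 2 = r ^ 2 - Cmod y ^ 2).
  { unfold d. rewrite Cmod_sqr. rewrite Y2. simpl fst; simpl snd. assert (Q : r * fst y = fst y ^ 2 + snd y ^ 2) by (unfold r; rewrite Y2; field; lra). nra. }
  assert (0 < Cmod y ^ 2) by (rewrite Y2; nra). nra. }
(* The weight keeps e^(-eps t); the remaining e^(-kap t) makes the exponential
   series uniformly summable, as (d t)^n / n! <= (d / kap)^n e^(kap t). *)
set (kap := (r + d) / 2). set (eps := (r - d) / 2).
assert (Kap : d < kap) by (unfold kap; lra). assert (Eps : 0 < eps) by (unfold eps; lra).
assert (RE : r = eps + kap) by (unfold eps, kap; field).
destruct (ex_int_gamma_fun z eps Hz Eps) as (g & m & Hg1 & Hg2 & _).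
set (phi := fun (n : nat) (t : R) => (expc (r - y) n * RtoC (t ^ n) * Cexp (- kap * t))%C).
set (Phi := fun t : R => Cexp (- (y - eps) * t)%C).
assert (SR : slit r) by (apply slit_Re; exact R0).
destruct (is_int_series 0 p_infty (gamma_fun z eps) g m phi Phi (fun n => (d / kap) ^ n)
   (fun n => Cgamma z * (binc z n * (r - y) ^ n * spw r (- z - INR n)))%C) as [L [HL1 HL2]].
- simpl; auto.
- intros t [Ht _]. now apply contC_gamma_fun.
- intros t [Ht _]. now apply Hg1.
- exact Hg2.
- intros t _. apply contC_Cexp_lin.
- intros n t [Ht _]. unfold phi, expc. rewrite !Cmod_mult, Cmod_div, Cmod_pow, Cmod_Cexp_lin, !Cmod_R by apply INR_fact_C.
  fold d. rewrite !Rabs_pos_eq by (try apply pos_INR; apply pow_le; lra).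
  simpl fst.
  assert (F : 0 < INR (fact n)) by (apply lt_0_INR, lt_O_fact).
  assert (U := pow_fact_le_exp (kap * t) n ltac:(apply Rmult_le_pos; lra)).
  replace (d ^ n / INR (fact n) * t ^ n * exp (- kap * t)) with ((d / kap) ^ n * ((kap * t) ^ n / INR (fact n) * exp (- kap * t))).
  + rewrite <- (Rmult_1_r ((d / kap) ^ n)) at 2. apply Rmult_le_compat_l.
    * apply pow_le. apply Rmult_le_pos; [exact D0|left; apply Rinv_0_lt_compat; lra].
    * apply Rle_trans with (exp (kap * t) * exp (- kap * t)).
      -- apply Rmult_le_compat_r; [left; apply exp_pos|exact U].
      -- rewrite <- exp_plus. replace (kap * t + - kap * t) with 0 by ring. rewrite exp_0. lra.
  + unfold Rdiv. rewrite !Rpow_mult_distr, pow_inv. field. split; [|apply pow_nonzero]; lra.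
- apply ex_series_geom. rewrite Rabs_pos_eq.
  + apply Rmult_lt_reg_r with kap; [lra|]. replace (d / kap * kap) with d by (field; lra). lra.
  + apply Rmult_le_pos; [exact D0|left; apply Rinv_0_lt_compat; lra].
- intros t [Ht _].
  apply (limat_ext (fun n => Cexp (- kap * t) * sum_n (expc ((r - y) * t)) n)%C).
  + apply filter_forall. intros n. unfold phi.
    rewrite <- sum_n_C_scal. apply sum_n_ext. intros k. unfold expc. rewrite Cpow_mult_l, RtoC_pow. unfold Cdiv. cring.
  + unfold Phi. replace (Cexp (- (y - eps) * t)) with (Cexp (- kap * t) * Cexp ((r - y) * t))%C.
    * apply limat_scal, exp_series.
    * rewrite <- Cexp_plus. f_equal. rewrite RE, RtoC_plus. ring.
- intros n. assert (ZN : 0 < fst (z + INR n)%C) by (simpl; assert (P := pos_INR n); lra).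
  assert (I := is_int_scal _ _ (expc (r - y) n) _ _ (is_int_gamma_fun_scale (z + INR n)%C r ZN R0)).
  eapply is_int_eq; [eapply is_int_ext; [|exact I]|].
  + intros t [Ht _]. cbv beta. unfold gamma_fun, phi.
    replace (z + INR n - 1)%C with (z - 1 + INR n)%C by ring.
    rewrite rpw_plus, rpw_nat by exact Ht.
    replace (Cexp (- r * t)) with (Cexp (- eps * t) * Cexp (- kap * t))%C.
    * ring.
    * rewrite <- Cexp_plus. f_equal. rewrite RE, RtoC_plus. ring.
  + rewrite Cgamma_poch by exact Hz. replace (- (z + INR n))%C with (- z - INR n)%C by ring.
    rewrite <- (spw_RtoC r (- z - INR n)%C) by exact R0. unfold expc, binc, Cdiv. ring.
- assert (E : L = (Cgamma z * spw y (- z))%C).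
  { apply (limat_unique (Fl := eventually) _ _ _ HL2).
    apply (limat_ext (fun n => Cgamma z * sum_n (fun n => binc z n * (r - y) ^ n * spw r (- z - INR n))%C n)%C).
    - apply filter_forall. intros n. now rewrite <- sum_n_C_scal.
    - apply limat_scal. assert (BS := binomial_series_at z r (r - y)%C (d / r)).
      replace (r - (r - y))%C with y in BS by ring. apply BS; clear BS.
      + split; [apply Rmult_le_pos; [exact D0|left; now apply Rinv_0_lt_compat]|].
        apply Rmult_lt_reg_r with r; [exact R0|]. replace (d / r * r) with d by (field; lra). lra.
      + rewrite Cmod_R, Rabs_pos_eq by lra. fold d. right. field. lra.
      + intros t Ht. apply slit_Re. simpl. nra. }
  rewrite Cmult_comm, <- E. eapply is_int_ext; [|exact HL1]. intros t [Ht _]. unfold gamma_fun, Phi.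
  rewrite <- Cmult_assoc, <- Cexp_plus. do 2 f_equal. ring.
Qed.

(** * The expansion at the origin *)

Lemma pow_le_pow_max t k N : 0 < t -> (k <= N)%nat -> t ^ k <= 1 + t ^ N.
Proof.
intros Ht Hk. destruct (Rle_dec t 1).
- assert (t ^ k <= 1 ^ k) by (apply pow_incr; lra). rewrite pow1 in H.
  assert (0 < t ^ N) by (apply pow_lt; lra). lra.
- assert (t ^ k <= t ^ N) by (apply Rle_pow; [lra|exact Hk]). lra.
Qed.

(** The factor of t^(a-1) (1-t)^(c-a-1) in Euler's integral at (-x, -y). *)
Definition kern (b : C) (x : R) (y : C) (t : R) : C :=
  (rpw (1 + x * t) (- b) * Cexp (- y * t))%C.

Lemma Cmod_kern_le b x y t mu : 0 < x -> 0 < t -> mu * x <= fst y ->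
  Cmod (kern b x y t) <= Rpower (1 + x * t) (- fst b) * exp (- mu * (x * t)).
Proof.
intros Hx Ht Hy. unfold kern. rewrite Cmod_mult, Cmod_rpw, Cmod_Cexp_lin.
apply Rmult_le_compat_l; [left; apply Rpower_pos|]. apply exp_le. nra.
Qed.

(** Only (1-t)^(gam-1) is expanded. The substitution u = x t in the terms of
    its Taylor polynomial leaves integrals U k that depend on x through y / x
    alone. *)
Lemma expansion_origin (a gam b : C) N mu : 0 < fst a -> 0 < fst gam -> 0 < mu ->
  exists K, 0 <= K /\ forall x y l (U : nat -> C), 1 <= x -> mu * x <= fst y ->
   is_int 0 1 (fun t => beta_fun a gam t * kern b x y t)%C l ->
   (forall k, is_int 0 p_infty (fun u => rpw u (a + INR k - 1) * kern b 1 (y / x) u)%C (U k)) ->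
   Cmod (l - sum_n (fun k => binc (1 - gam) k * (rpw x (- (a + INR k)) * U k))%C N)%C
     <= K * Rpower x (- (fst a + INR N + 1/2)).
Proof.
intros Ha Hg Hmu. destruct (binomial_half (1 - gam)%C N) as [K1 [P1 H1]].
set (K5 := sum_n (fun k => Cmod (binc (1 - gam) k)) N).
assert (P5 : 0 <= K5) by (apply sum_n_R_nonneg; intros; apply Cmod_ge_0).
destruct (watson a N mu (- fst b) 0 (fst gam) (K1 + K5 + 1) Ha Hmu ltac:(lra) Hg ltac:(lra)) as [K [K0 HK]].
exists K; split; [exact K0|]. intros x y l U Hx Hy Hl HU.
set (T := fun t : R => sum_n (fun k => binc (1 - gam) k * t ^ k)%C N).
assert (G : is_int 0 p_infty (fun t => rpw t (a - 1) * T t * kern b x y t)%C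
   (sum_n (fun k => binc (1 - gam) k * (rpw x (- (a + INR k)) * U k))%C N)).
{ apply (is_int_ext _ _ (fun t => sum_n (fun k => binc (1 - gam) k * (rpw t (a + INR k - 1) * kern b x y t))%C N)).
  - intros t [Ht _]. unfold T.
    transitivity (sum_n (fun k => (rpw t (a - 1) * kern b x y t) * (binc (1 - gam) k * t ^ k))%C N).
    + apply sum_n_ext. intros k. replace (a + INR k - 1)%C with ((a - 1) + INR k)%C by ring.
      rewrite rpw_plus, rpw_nat, RtoC_pow by exact Ht. cring.
    + rewrite sum_n_C_scal. cring.
  - apply (is_int_sum 0 p_infty (fun k t => binc (1 - gam) k * (rpw t (a + INR k - 1) * kern b x y t))%C
       (fun k => binc (1 - gam) k * (rpw x (- (a + INR k)) * U k))%C).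
    intros k _. apply is_int_scal.
    assert (I := is_int_scale _ _ x ltac:(lra) (HU k)). apply (is_int_scal _ _ (rpw x (- (a + INR k)))) in I.
    eapply is_int_ext; [|exact I]. intros t [Ht _]. cbv beta. unfold kern.
    rewrite rpw_mult by lra. replace (1 + 1 * (x * t)) with (1 + x * t) by ring.
    assert (Xn : RtoC x <> 0%C) by (intros H; apply RtoC_inj in H; lra).
    replace (- (y / x) * RtoC (x * t))%C with (- y * t)%C by (rewrite RtoC_mult; field; exact Xn).
    rewrite <- (rpw_1 x) at 1 by lra.
    set (s := (a + INR k)%C).
    replace (rpw x (- s) * (rpw x 1 * (rpw x (s - 1) * rpw t (s - 1) * (rpw (1 + x * t) (- b) * Cexp (- y * t)))))%C
      with ((rpw x (- s) * rpw x 1 * rpw x (s - 1)) * (rpw t (s - 1) * (rpw (1 + x * t) (- b) * Cexp (- y * t))))%C by ring.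
    rewrite <- !rpw_plus. replace (- s + 1 + (s - 1))%C with (RtoC 0) by ring. rewrite rpw_0. ring. }
apply (HK x (fun t => rpw (1 - t) (gam - 1)) T (kern b x y)) with (7 := G); [exact Hx| | | | |exact Hl].
- intros t Ht. apply Cmod_kern_le; lra.
- intros t Ht. specialize (H1 t). rewrite Cmod_R, Rabs_pos_eq in H1 by lra. specialize (H1 ltac:(lra)).
  rewrite <- RtoC_minus, spw_RtoC in H1 by lra. replace (- (1 - gam))%C with (gam - 1)%C in H1 by ring. fold (T t) in H1.
  destruct (pow_rescale x t N ltac:(lra) ltac:(lra)) as [_ Q].
  assert (0 < t ^ S N) by (apply pow_lt; lra). nra.
- intros t Ht. rewrite Cmod_rpw, Rpower_O by lra. change (fst (gam - 1)%C) with (fst gam - 1).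
  assert (Q := Rpower_pos (1 - t) (fst gam - 1)). nra.
- intros t Ht. unfold T. eapply Rle_trans; [apply Cmod_sum_n|].
  assert (0 < t ^ N) by (apply pow_lt; lra).
  apply Rle_trans with (K5 * (1 + t ^ N)); [|apply Rmult_le_compat_r; lra].
  unfold K5. rewrite <- sum_n_R_scal. apply sum_n_R_le. intros k Hk. rewrite Cmod_mult.
  apply Rmult_le_compat_l; [apply Cmod_ge_0|].
  rewrite <- RtoC_pow, Cmod_R, Rabs_pos_eq by (apply pow_le; lra). apply pow_le_pow_max; [lra|exact Hk].
Qed.

(** * The expansion at the endpoint *)

Lemma sum_n_triangle (f : nat -> nat -> C) N :
  sum_n (fun k => sum_n (fun n => f n (k - n)%nat) k) N = sum_n (fun n => sum_n (f n) (N - n)) N.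
Proof.
induction N.
- now rewrite !sum_O.
- rewrite sum_Sn, IHN. rewrite (sum_Sn (fun n => sum_n (f n) (S N - n))).
  rewrite (sum_Sn (fun n => f n (S N - n)%nat)). rewrite Nat.sub_diag, sum_O.
  rewrite (sum_n_ext_loc (fun n => sum_n (f n) (S N - n)) (fun n => plus (sum_n (f n) (N - n)) (f n (S N - n)%nat))).
  + rewrite sum_n_plus, plus_assoc. reflexivity.
  + intros n Hn. replace (S N - n)%nat with (S (N - n)) by lia. now rewrite sum_Sn.
Qed.

(** The Taylor polynomial of total degree N of (1-s)^(a-1) (1-s+h)^(-b) in s
    and h: first in h, then in s. *)
Definition taylor2 (a b : C) (N : nat) (s h : R) : C :=
  sum_n (fun n => binc b n * (- h) ^ n *
    sum_n (fun m => binc (b - a + 1 + INR n) m * s ^ m) (N - n))%C N.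

Lemma sum_n_uniform_bound (P : R -> R -> Prop) (F : nat -> R -> R -> C) (g : R -> R -> R) N :
  (forall n, (n <= N)%nat -> exists K, 0 <= K /\ forall s h, P s h -> Cmod (F n s h) <= K * g s h) ->
  exists K, 0 <= K /\ forall s h, P s h -> Cmod (sum_n (fun n => F n s h) N) <= K * g s h.
Proof.
induction N; intros H.
- destruct (H 0%nat) as [K [K0 HK]]; [lia|]. exists K; split; [exact K0|]. intros. rewrite sum_O. now apply HK.
- destruct IHN as [K [K0 HK]]; [intros; apply H; lia|]. destruct (H (S N)) as [K' [K0' HK']]; [lia|].
  exists (K + K'); split; [lra|]. intros s h Hp. rewrite sum_Sn.
  eapply Rle_trans; [apply Cmod_triangle|]. specialize (HK s h Hp). specialize (HK' s h Hp). lra.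
Qed.

Lemma pow_mixed_le s h n M : 0 <= s -> 0 <= h -> (n <= M)%nat -> h ^ n * s ^ (M - n) <= h ^ M + s ^ M.
Proof.
intros Hs Hh Hn. replace M with (n + (M - n))%nat at 2 3 by lia. rewrite !pow_add.
set (k := (M - n)%nat).
assert (A : 0 <= h ^ n) by now apply pow_le. assert (B : 0 <= s ^ k) by now apply pow_le.
assert (A' : 0 <= s ^ n) by now apply pow_le. assert (B' : 0 <= h ^ k) by now apply pow_le.
destruct (Rle_dec s h).
- assert (s ^ k <= h ^ k) by (apply pow_incr; lra). nra.
- assert (h ^ n <= s ^ n) by (apply pow_incr; lra). nra.
Qed.

(** The function is (1-s)^(a-1-b) (1-w)^(-b) with w = -h/(1-s). The remainder
    in h is of order h^(N+1), and the remainder in s of the n-th term is of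
    order h^n s^(N+1-n). *)
Lemma taylor2_remainder (a b : C) N : exists K, 0 <= K /\ forall s h, (0 < s <= 1/2 /\ 0 < h <= 1/4) ->
  Cmod (rpw (1 - s) (a - 1) * rpw (1 - s + h) (- b) - taylor2 a b N s h)%C <= K * (h ^ S N + s ^ S N).
Proof.
destruct (binomial_half b N) as [K1 [P1 H1]].
destruct (sum_n_uniform_bound (fun s h => 0 < s <= 1/2 /\ 0 < h <= 1/4)
  (fun n s h => binc b n * (- h) ^ n * (rpw (1 - s) (- (b - a + 1 + INR n))
     - sum_n (fun m => binc (b - a + 1 + INR n) m * s ^ m) (N - n)))%C
  (fun s h => h ^ S N + s ^ S N) N) as [K2 [P2 H2]].
{ intros n Hn. destruct (binomial_half (b - a + 1 + INR n) (N - n)) as [K [K0 HK]].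
  exists (Cmod (binc b n) * K). split; [apply Rmult_le_pos; [apply Cmod_ge_0|exact K0]|].
  intros s h [Hs Hh]. specialize (HK s). rewrite Cmod_R, Rabs_pos_eq in HK by lra. specialize (HK ltac:(lra)).
  rewrite <- RtoC_minus, spw_RtoC in HK by lra.
  rewrite !Cmod_mult, Cmod_pow, Cmod_opp, Cmod_R, Rabs_pos_eq by lra.
  assert (Q := pow_mixed_le s h n (S N) ltac:(lra) ltac:(lra) ltac:(lia)).
  replace (S N - n)%nat with (S (N - n)) in Q by lia.
  apply Rle_trans with (Cmod (binc b n) * h ^ n * (K * s ^ S (N - n))).
  - apply Rmult_le_compat_l; [|exact HK]. apply Rmult_le_pos; [apply Cmod_ge_0|apply pow_le; lra].
  - replace (Cmod (binc b n) * h ^ n * (K * s ^ S (N - n))) with (Cmod (binc b n) * K * (h ^ n * s ^ S (N - n))) by ring.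
    apply Rmult_le_compat_l; [|exact Q]. apply Rmult_le_pos; [apply Cmod_ge_0|exact K0]. }
set (m := Rpower 2 (Rabs (fst (a - 1 - b)%C))). assert (M0 : 0 < m) by apply Rpower_pos.
exists (m * (K1 * 2 ^ S N) + K2). split.
{ assert (0 <= K1 * 2 ^ S N) by (apply Rmult_le_pos; [exact P1|apply pow_le; lra]). nra. }
intros s h [Hs Hh].
set (w := RtoC (- h / (1 - s))).
assert (EW : Cmod w = h / (1 - s)).
{ unfold w. rewrite Cmod_R. unfold Rdiv. rewrite Rabs_mult, Rabs_Ropp, Rabs_pos_eq, Rabs_pos_eq; auto; try lra.
  left; apply Rinv_0_lt_compat; lra. }
assert (W2 : h / (1 - s) <= 2 * h).
{ apply Rmult_le_reg_r with (1 - s); [lra|]. replace (h / (1 - s) * (1 - s)) with h by (field; lra). nra. }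
assert (W0 : 0 <= h / (1 - s)) by (rewrite <- EW; apply Cmod_ge_0).
specialize (H1 w). rewrite EW in H1. specialize (H1 ltac:(lra)).
assert (E1 : rpw (1 - s + h) (- b) = (rpw (1 - s) (- b) * spw (1 - w) (- b))%C).
{ replace (1 - w)%C with (RtoC (1 + h / (1 - s))).
  2:{ unfold w. rewrite <- RtoC_minus. f_equal. field. lra. }
  rewrite spw_RtoC, <- rpw_mult by lra. f_equal. field. lra. }
assert (E2 : forall n, (rpw (1 - s) (a - 1 - b) * w ^ n = (- h) ^ n * rpw (1 - s) (- (b - a + 1 + INR n)))%C).
{ intros n. replace (- (b - a + 1 + INR n))%C with (a - 1 - b - INR n)%C by ring.
  assert (SL : slit (RtoC (1 - s))) by (apply slit_Re; simpl; lra).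
  assert (Sn : RtoC (1 - s) <> 0%C) by (intros H; apply RtoC_inj in H; lra).
  rewrite <- (spw_RtoC (1 - s) (a - 1 - b - INR n)%C), spw_sub_nat, spw_RtoC by (try exact SL; lra).
  replace w with (- h * / RtoC (1 - s))%C.
  - rewrite Cpow_mult_l, Cpow_inv by exact Sn. field. apply Cpow_nz; exact Sn.
  - unfold w, Rdiv. rewrite RtoC_mult, RtoC_opp, RtoC_inv by lra. reflexivity. }
specialize (H2 s h (conj Hs Hh)).
replace (rpw (1 - s) (a - 1) * rpw (1 - s + h) (- b) - taylor2 a b N s h)%C with
 (rpw (1 - s) (a - 1 - b) * (spw (1 - w) (- b) - sum_n (fun n => binc b n * w ^ n) N)
  + sum_n (fun n => binc b n * (- h) ^ n * (rpw (1 - s) (- (b - a + 1 + INR n))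
     - sum_n (fun m => binc (b - a + 1 + INR n) m * s ^ m) (N - n))) N)%C.
- eapply Rle_trans; [apply Cmod_triangle|]. rewrite Rmult_plus_distr_r. apply Rplus_le_compat; [|exact H2].
  rewrite Cmod_mult, Cmod_rpw.
  assert (B := Rpower_middle (1 - s) (fst (a - 1 - b)%C) ltac:(lra)). fold m in B.
  apply Rle_trans with (m * (K1 * (h / (1 - s)) ^ S N)).
  + apply Rmult_le_compat; auto using Cmod_ge_0. left; apply Rpower_pos.
  + rewrite Rmult_assoc. apply Rmult_le_compat_l; [lra|]. rewrite Rmult_assoc. apply Rmult_le_compat_l; [exact P1|].
    apply Rle_trans with ((2 * h) ^ S N); [apply pow_incr; lra|]. rewrite Rpow_mult_distr.
    apply Rmult_le_compat_l; [apply pow_le; lra|]. assert (0 <= s ^ S N) by (apply pow_le; lra). lra.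
- rewrite E1.
  assert (E3 : sum_n (fun n => binc b n * (- h) ^ n * (rpw (1 - s) (- (b - a + 1 + INR n))
     - sum_n (fun m => binc (b - a + 1 + INR n) m * s ^ m) (N - n)))%C N
    = (rpw (1 - s) (a - 1 - b) * sum_n (fun n => binc b n * w ^ n) N - taylor2 a b N s h)%C).
  { unfold taylor2. rewrite <- sum_n_C_scal.
    transitivity (sum_n (fun n => plus (rpw (1 - s) (a - 1 - b) * (binc b n * w ^ n))
       (- (1) * (binc b n * (- h) ^ n * sum_n (fun m => binc (b - a + 1 + INR n) m * s ^ m) (N - n))))%C N).
    - apply sum_n_ext. intros n.
      replace (rpw (1 - s) (a - 1 - b) * (binc b n * w ^ n))%C with (binc b n * (rpw (1 - s) (a - 1 - b) * w ^ n))%C by ring.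
      rewrite E2. change plus with Cplus. cring.
    - rewrite sum_n_plus, sum_n_C_scal, sum_n_C_scal. change plus with Cplus. cring. }
  rewrite E3. replace (a - 1 - b)%C with ((a - 1) + - b)%C by ring. rewrite rpw_plus. cring.
Qed.

Lemma taylor2_bound (a b : C) N : exists K, 0 <= K /\ forall s h, (0 < s /\ 0 < h <= 1) ->
  Cmod (taylor2 a b N s h) <= K * (1 + s ^ N).
Proof.
apply (sum_n_uniform_bound (fun s h => 0 < s /\ 0 < h <= 1)
 (fun n s h => binc b n * (- h) ^ n * sum_n (fun m => binc (b - a + 1 + INR n) m * s ^ m) (N - n))%C
 (fun s h => 1 + s ^ N)).
intros n Hn. set (S5 := sum_n (fun m => Cmod (binc (b - a + 1 + INR n) m)) (N - n)).
assert (P5 : 0 <= S5) by (apply sum_n_R_nonneg; intros; apply Cmod_ge_0).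
exists (Cmod (binc b n) * S5). split; [apply Rmult_le_pos; [apply Cmod_ge_0|exact P5]|].
intros s h [Hs Hh]. rewrite !Cmod_mult, Cmod_pow, Cmod_opp, Cmod_R, Rabs_pos_eq by lra.
assert (B : Cmod (sum_n (fun m => binc (b - a + 1 + INR n) m * s ^ m)%C (N - n)) <= S5 * (1 + s ^ N)).
{ eapply Rle_trans; [apply Cmod_sum_n|]. unfold S5. rewrite <- sum_n_R_scal. apply sum_n_R_le. intros k Hk.
  rewrite Cmod_mult. apply Rmult_le_compat_l; [apply Cmod_ge_0|].
  rewrite <- RtoC_pow, Cmod_R, Rabs_pos_eq by (apply pow_le; lra). apply pow_le_pow_max; [exact Hs|lia]. }
rewrite (Rmult_assoc (Cmod (binc b n)) S5). rewrite Rmult_assoc. apply Rmult_le_compat_l; [apply Cmod_ge_0|].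
assert (H1 : h ^ n <= 1) by (apply Rle_trans with (1 ^ n); [apply pow_incr; lra|rewrite pow1; lra]).
assert (H0 : 0 <= h ^ n) by (apply pow_le; lra).
assert (C0 := Cmod_ge_0 (sum_n (fun m => binc (b - a + 1 + INR n) m * s ^ m)%C (N - n))). nra.
Qed.

(** Sorting the double sum by total degree k yields coef1: the factor h^n y^n
    with h = 1/x is lambda^n. *)
Lemma is_int_taylor2 (a b c y : C) N x : 0 < fst (c - a)%C -> 0 < fst y -> 0 < x ->
  is_int 0 p_infty (fun s => rpw s (c - a - 1) * taylor2 a b N s (/ x) * Cexp (- y * s))%C
   (Cgamma (c - a) * sum_n (fun k => coef1 a b c (y / x) k * spw y (a - c - INR k))%C N)%C.
Proof.
intros Hg Hy Hx. assert (Xn : RtoC x <> 0%C) by (intros H; apply RtoC_inj in H; lra).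
set (h := / x). set (gam := (c - a)%C) in *.
set (cc := fun n m => (binc b n * (- h) ^ n * binc (b - a + 1 + INR n) m)%C).
assert (I := is_int_sum 0 p_infty (fun k t => sum_n (fun n => cc n (k - n)%nat * gamma_fun (gam + RtoC (INR (k - n))) y t)%C k)
  (fun k => sum_n (fun n => cc n (k - n)%nat * (spw y (- (gam + RtoC (INR (k - n)))) * Cgamma (gam + RtoC (INR (k - n)))))%C k) N).
eapply is_int_eq; [eapply is_int_ext; [|apply I]|].
- intros s [Hs _]. cbv beta.
  rewrite (sum_n_triangle (fun n m => cc n m * gamma_fun (gam + INR m) y s)%C).
  unfold taylor2.
  transitivity (sum_n (fun n => (rpw s (gam - 1) * Cexp (- y * s)) * (binc b n * (- h) ^ n *
    sum_n (fun m => binc (b - a + 1 + INR n) m * s ^ m) (N - n)))%C N).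
  + apply sum_n_ext. intros n. rewrite <- sum_n_C_scal, <- sum_n_C_scal. apply sum_n_ext. intros m.
    unfold gamma_fun, cc. replace (gam + INR m - 1)%C with (gam - 1 + INR m)%C by ring.
    rewrite rpw_plus, rpw_nat, RtoC_pow by exact Hs. cring.
  + rewrite sum_n_C_scal. cring.
- intros k _. apply (is_int_sum 0 p_infty (fun n t => cc n (k - n)%nat * gamma_fun (gam + RtoC (INR (k - n))) y t)%C).
  intros n _. apply is_int_scal, is_int_gamma_fun_complex; [|exact Hy]. simpl. assert (P := pos_INR (k - n)). simpl in Hg. lra.
- rewrite <- sum_n_C_scal. apply sum_n_ext. intros k. unfold coef1.
  rewrite <- sum_n_C_scal_r, <- sum_n_C_scal. apply sum_n_ext_loc. intros n Hn.
  unfold cc, poch_quot, binc. rewrite Cgamma_poch by exact Hg. fold gam.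
  assert (SL : slit y) by now apply slit_Re.
  assert (Yn : y <> 0%C) by now apply C_neq_0_Re.
  replace (- (gam + RtoC (INR (k - n))))%C with ((a - c - INR k) + INR n)%C.
  2:{ rewrite minus_INR by exact Hn. rewrite RtoC_minus. unfold gam. ring. }
  assert (SP : spw y ((a - c - INR k) + INR n)%C = (spw y (a - c - INR k) * y ^ n)%C).
  { replace (a - c - INR k)%C with ((a - c - INR k + INR n) - INR n)%C at 2 by ring.
    rewrite spw_sub_nat by exact SL. field. now apply Cpow_nz. }
  rewrite SP. replace ((- (y / x)) ^ n)%C with ((- h) ^ n * y ^ n)%C.
  + match goal with |- @eq _ ?p ?q => change (@eq C p q) end. field. split; apply INR_fact_C.
  + rewrite <- Cpow_mult_l. f_equal. unfold h. rewrite RtoC_inv by lra. field. exact Xn.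
Qed.

(** Near s = 1 the factor (1-s+1/x)^(-b) can be as large as a power of x; this
    is the factor x^B allowed by [watson]. *)
Lemma expansion_end (a b c : C) N mu : 0 < fst a -> 0 < fst (c - a)%C -> 0 < mu ->
  exists K, 0 <= K /\ forall x y l, 4 <= x -> mu * x <= fst y ->
   is_int 0 1 (fun s => rpw s (c - a - 1) * (rpw (1 - s) (a - 1) * rpw (1 - s + / x) (- b)) * Cexp (- y * s))%C l ->
   Cmod (l - Cgamma (c - a) * sum_n (fun k => coef1 a b c (y / x) k * spw y (a - c - INR k))%C N)%C
     <= K * Rpower x (- (fst (c - a)%C + INR N + 1/2)).
Proof.
intros Ha Hg Hmu. set (sg := fst a) in *.
set (B := Rabs (- fst b)). assert (B0 : 0 <= B) by apply Rabs_pos.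
destruct (taylor2_remainder a b N) as [K1 [P1 H1]].
destruct (taylor2_bound a b N) as [K5 [P5 H5]].
destruct (watson (c - a)%C N mu 0 B sg (2 * K1 + K5 + 1) Hg Hmu B0 Ha ltac:(lra)) as [K [K0 HK]].
exists K; split; [exact K0|]. intros x y l Hx Hy Hl.
assert (Hh : 0 < / x <= 1/4).
{ split; [apply Rinv_0_lt_compat; lra|]. replace (1/4) with (/ 4) by field. apply Rinv_le_contravar; lra. }
apply (HK x) with (6 := Hl) (7 := is_int_taylor2 a b c y N x Hg ltac:(nra) ltac:(lra)); [lra| | | |].
- intros t Ht. rewrite Cmod_Cexp_lin, Rpower_O, Rmult_1_l by nra. apply exp_le. nra.
- intros t Ht. eapply Rle_trans; [apply (H1 t (/ x) (conj Ht Hh))|].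
  destruct (pow_rescale x t N ltac:(lra) ltac:(lra)) as [Q1 Q2].
  set (Z := Rpower x (- (INR N + 1)) * Rpower (1 + x * t) (INR N + 2)) in *.
  assert (Z0 : 0 < Z) by (apply Rmult_lt_0_compat; apply Rpower_pos). nra.
- intros t Ht. rewrite Cmod_mult, !Cmod_rpw. change (fst (a - 1)%C) with (sg - 1). change (fst (- b)%C) with (- fst b).
  assert (Q := Rpower_between (1 - t + / x) x (- fst b) ltac:(lra) ltac:(lra)). fold B in Q.
  assert (R1 := Rpower_pos (1 - t) (sg - 1)). assert (R2 := Rpower_pos (1 - t + / x) (- fst b)).
  apply Rle_trans with (1 * (Rpower x B * (1 + Rpower (1 - t) (sg - 1)))); [nra|].
  apply Rmult_le_compat_r; [|lra]. apply Rmult_le_pos; lra.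
- intros t Ht. eapply Rle_trans; [apply H5; lra|]. assert (0 < t ^ N) by (apply pow_lt; lra).
  apply Rmult_le_compat_r; lra.
Qed.

(** * Euler's integral as an analytic continuation *)

Lemma off_cut_neighbourhood z0 : off_cut z0 -> exists d, 0 < d /\ forall z, Cmod (z - z0)%C < d -> off_cut z.
Proof.
intros H. destruct (Req_dec (Im z0) 0) as [I|I].
- assert (R1 : Re z0 < 1). { destruct (Rlt_dec (Re z0) 1); [assumption|]. exfalso; apply H; split; [exact I|lra]. }
  exists (1 - Re z0). split; [lra|]. intros z Hz [_ C]. assert (A := re_le_Cmod (z - z0)%C).
  unfold Re in *. simpl in A. assert (B := Rle_abs (fst z + - fst z0)). lra.
- exists (Rabs (Im z0)). split; [now apply Rabs_pos_lt|]. intros z Hz [C _].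
  assert (A := Rle_trans _ _ _ (Rmax_r _ _) (Rmax_Cmod (z - z0)%C)). unfold Im in *. simpl in A.
  rewrite C, Rplus_0_l, Rabs_Ropp in A. lra.
Qed.

(** A real value t z >= 1 would force z to be real and at least 1/t > 1. *)
Lemma slit_off_cut z (t : R) : off_cut z -> 0 < t < 1 -> slit (1 - t * z)%C.
Proof.
intros H Ht. destruct (Req_dec (Im z) 0) as [I|I].
- assert (R1 : Re z < 1). { destruct (Rlt_dec (Re z) 1); [assumption|]. exfalso; apply H; split; [exact I|lra]. }
  apply slit_Re. unfold Re in *. simpl. nra.
- apply slit_Im. unfold Im in *. simpl. nra.
Qed.

(** Far from t = 0 the imaginary part bounds the distance from below, close to
    t = 0 the value is near 1. *)
Lemma off_cut_distance z0 : off_cut z0 -> exists d, 0 < d /\ forall t, 0 < t < 1 -> d <= Cmod (1 - t * z0)%C.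
Proof.
intros H. assert (RI : forall t : R, fst (1 - t * z0)%C = 1 - t * Re z0 /\ snd (1 - t * z0)%C = - (t * Im z0)).
{ intros t. unfold Re, Im. simpl. split; ring. }
destruct (Req_dec (Im z0) 0) as [I|I].
- assert (R1 : Re z0 < 1). { destruct (Rlt_dec (Re z0) 1); [assumption|]. exfalso; apply H; split; [exact I|lra]. }
  exists (Rmin 1 (1 - Re z0)). split; [apply Rmin_pos; lra|].
  intros t Ht. eapply Rle_trans; [|eapply Rle_trans; [apply Rle_abs|apply (re_le_Cmod (1 - t * z0)%C)]].
  unfold Re at 2. rewrite (proj1 (RI t)). assert (A := Rmin_l 1 (1 - Re z0)). assert (B := Rmin_r 1 (1 - Re z0)).
  destruct (Rle_dec (Re z0) 0); nra.
- assert (V : 0 < Rabs (Im z0)) by now apply Rabs_pos_lt.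
  assert (VC : Rabs (Im z0) <= Cmod z0) by (eapply Rle_trans; [apply Rmax_r|apply Rmax_Cmod]).
  exists (Rmin (1/2) (Rabs (Im z0) / (2 * Cmod z0))). split.
  { apply Rmin_pos; [lra|]. apply Rdiv_lt_0_compat; lra. }
  intros t Ht. destruct (Rle_dec (t * Cmod z0) (1/2)) as [L|L].
  + eapply Rle_trans; [apply Rmin_l|]. assert (S := segment_bounds 1%C (t * z0)%C 1 ltac:(lra)).
    rewrite Cmod_1, Cmod_mult, Cmod_R, Rabs_pos_eq in S by lra. replace (1 - 1%R * (t * z0))%C with (1 - t * z0)%C in S by ring. lra.
  + eapply Rle_trans; [apply Rmin_r|]. eapply Rle_trans; [|eapply Rle_trans; [apply Rmax_r|apply Rmax_Cmod]].
    rewrite (proj2 (RI t)), Rabs_Ropp, Rabs_mult, (Rabs_pos_eq t) by lra.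
    apply Rmult_le_reg_r with (2 * Cmod z0); [lra|].
    replace (Rabs (Im z0) / (2 * Cmod z0) * (2 * Cmod z0)) with (Rabs (Im z0)) by (field; lra). nra.
Qed.

(** Integrand of Euler's integral for B(p,gam) 2F1[p,b;p+gam;z]. *)
Definition euler_fun (p gam b z : C) (t : R) : C := (beta_fun p gam t * spw (1 - t * z) (- b))%C.

Lemma contC_spw_affine z s (t : R) : slit (1 - t * z)%C -> contC (fun u => spw (1 - u * z) s)%C t.
Proof. intros H. eapply derivC_contC. apply (derivC_spw (fun u : R => 1 - u * z)%C); [exact H|apply derivC_affine]. Qed.

Lemma spw_affine_bound b z0 d : 0 < d -> (forall t, 0 < t < 1 -> d <= Cmod (1 - t * z0)%C) ->
  exists E, 0 <= E /\ forall t, 0 < t < 1 -> Cmod (spw (1 - t * z0) (- b))%C <= E.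
Proof.
intros Hd H. set (r := Rmax (1 + Cmod z0) (/ d)). assert (Z0 := Cmod_ge_0 z0).
assert (R1 : 1 + Cmod z0 <= r) by apply Rmax_l. assert (R2 : / d <= r) by apply Rmax_r.
exists (exp (Cmod (- b)%C * (ln r + 4))). split; [left; apply exp_pos|].
intros t Ht. apply Cmod_spw_le; [lra|]. split.
- eapply Rle_trans; [|apply (H t Ht)]. rewrite <- (Rinv_inv d). apply Rinv_le_contravar; [now apply Rinv_0_lt_compat|exact R2].
- eapply Rle_trans; [|exact R1]. assert (S := segment_bounds 1%C z0 t ltac:(lra)). rewrite Cmod_1 in S. lra.
Qed.

Lemma euler_fun_majorant (p gam b z0 : C) d : 0 < d -> (forall t, 0 < t < 1 -> d <= Cmod (1 - t * z0)%C) ->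
  exists K, 0 <= K /\ forall t, 0 < t < 1 -> Cmod (euler_fun p gam b z0 t) <= K * unit_bound (fst p) (fst gam) t.
Proof.
intros Hd H. destruct (beta_fun_bound (fst p) (fst gam)) as [K [K0 HK]].
destruct (spw_affine_bound b z0 d Hd H) as [E [E0 HE]]. exists (K * E). split; [nra|].
intros t Ht. unfold euler_fun. rewrite Cmod_mult, Cmod_beta_fun.
replace (K * E * unit_bound (fst p) (fst gam) t) with (K * unit_bound (fst p) (fst gam) t * E) by ring.
apply Rmult_le_compat; auto using Cmod_ge_0. apply Rmult_le_pos; left; apply Rpower_pos.
Qed.

Lemma contC_euler_fun p gam b z (t : R) : 0 < t < 1 -> slit (1 - t * z)%C -> contC (euler_fun p gam b z) t.
Proof. intros Ht H. apply contC_mult; [now apply contC_beta_fun|now apply contC_spw_affine]. Qed.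

(** The binomial series at u = 1 - t z0 with v = t (z - z0), integrated term
    by term. *)
Lemma euler_fun_local (p gam b z0 : C) d : 0 < fst p -> 0 < fst gam -> 0 < d ->
  (forall t, 0 < t < 1 -> slit (1 - t * z0)%C /\ d <= Cmod (1 - t * z0)%C) ->
  exists u : nat -> C,
   (forall n, is_int 0 1 (fun t => beta_fun p gam t * (binc b n * (t ^ n * spw (1 - t * z0) (- b - INR n))))%C (u n)) /\
   forall z q, 0 <= q < 1 ->
    (forall t, 0 < t < 1 -> Cmod (t * (z - z0))%C <= q * Cmod (1 - t * z0)%C /\
       forall s, 0 <= s <= 1 -> slit (1 - t * (z0 + s * (z - z0)))%C) ->
    exists L, is_int 0 1 (euler_fun p gam b z) L /\ limat eventually (sum_n (fun n => u n * (z - z0) ^ n)%C) L.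
Proof.
intros Hp Hg Hd H. destruct (beta_fun_bound (fst p) (fst gam)) as [K [K0 HK]].
destruct (spw_affine_bound b z0 d Hd ltac:(intros t Ht; apply H, Ht)) as [E [E0 HE]].
assert (BK : forall t, 0 < t < 1 -> Cmod (beta_fun p gam t) <= K * unit_bound (fst p) (fst gam) t).
{ intros t Ht. rewrite Cmod_beta_fun. now apply HK. }
assert (TB : forall n (t : R) w q, 0 < t < 1 -> 0 <= q -> Cmod (t * w)%C <= q * Cmod (1 - t * z0)%C ->
  Cmod (binc b n * (t * w) ^ n * spw (1 - t * z0) (- b - INR n))%C <= Cmod (binc b n) * q ^ n * E).
{ intros n t w q Ht Hq Hw. destruct (H t Ht) as [S B].
  assert (N : ((1 - t * z0) ^ n)%C <> 0%C) by (apply Cpow_nz; intros Z; rewrite Z, Cmod_0 in B; lra).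
  rewrite spw_sub_nat by exact S. rewrite !Cmod_mult, Cmod_div, !Cmod_pow by exact N.
  set (m := Cmod (1 - t * z0)%C) in *. set (x := Cmod (t * w)%C) in *. assert (x0 : 0 <= x) by apply Cmod_ge_0.
  replace (Cmod (binc b n) * x ^ n * (Cmod (spw (1 - t * z0) (- b))%C / m ^ n))
   with (Cmod (binc b n) * (x / m) ^ n * Cmod (spw (1 - t * z0) (- b))%C) by (unfold Rdiv; rewrite Rpow_mult_distr, pow_inv; ring).
  assert (XM : 0 <= x / m) by (apply Rmult_le_pos; [exact x0|left; apply Rinv_0_lt_compat; lra]).
  apply Rmult_le_compat; auto using Cmod_ge_0.
  - apply Rmult_le_pos; [apply Cmod_ge_0|now apply pow_le].
  - apply Rmult_le_compat_l; [apply Cmod_ge_0|]. apply pow_incr. split; [exact XM|].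
    apply Rmult_le_reg_r with m; [lra|]. replace (x / m * m) with x by (field; lra). exact Hw. }
assert (CT : forall n w (t : R), 0 < t < 1 -> contC (fun t => binc b n * (t * w) ^ n * spw (1 - t * z0) (- b - INR n))%C t).
{ intros n w t Ht. apply contC_mult; [|apply contC_spw_affine, H, Ht]. apply contC_mult; [apply contC_const|].
  apply contC_pow, contC_mult; [|apply contC_const]. eapply derivC_contC, derivC_RtoC, @is_derive_id. }
assert (EX : forall n, exists l, is_int 0 1 (fun t => beta_fun p gam t * (binc b n * (t ^ n * spw (1 - t * z0) (- b - INR n))))%C l).
{ intros n. destruct (ex_int_unit (fun t => beta_fun p gam t * (binc b n * (t * 1) ^ n * spw (1 - t * z0) (- b - INR n)))%C
    (fst p) (fst gam) (K * (Cmod (binc b n) * (/ d) ^ n * E)) Hp Hg) as [l Hl].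
  - intros t Ht. apply contC_mult; [now apply contC_beta_fun|now apply CT].
  - intros t Ht. rewrite Cmod_mult.
    replace (K * (Cmod (binc b n) * (/ d) ^ n * E) * unit_bound (fst p) (fst gam) t)
     with (K * unit_bound (fst p) (fst gam) t * (Cmod (binc b n) * (/ d) ^ n * E)) by ring.
    assert (D0 : 0 < / d) by now apply Rinv_0_lt_compat.
    apply Rmult_le_compat; auto using Cmod_ge_0. apply TB; [exact Ht|lra|].
    rewrite Cmult_1_r, Cmod_R, Rabs_pos_eq by lra. destruct (H t Ht) as [_ B].
    apply Rle_trans with (/ d * d); [rewrite Rinv_l; lra|apply Rmult_le_compat_l; lra].
  - exists l. eapply is_int_ext; [|exact Hl]. intros t _. cbv beta. rewrite Cmult_1_r. ring. }
exists (fun n => proj1_sig (constructive_indefinite_description _ (EX n))).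
set (u := fun n => proj1_sig (constructive_indefinite_description _ (EX n))).
assert (HU : forall n, is_int 0 1 (fun t => beta_fun p gam t * (binc b n * (t ^ n * spw (1 - t * z0) (- b - INR n))))%C (u n)).
{ intros n. unfold u. now destruct (constructive_indefinite_description _ (EX n)). }
split; [exact HU|]. intros z q Hq Hz.
apply (is_int_series 0 1 (beta_fun p gam) (fun t => K * unit_bound (fst p) (fst gam) t) (RtoC (K * (/ fst p + / fst gam)))
  (fun n t => binc b n * (t * (z - z0)) ^ n * spw (1 - t * z0) (- b - INR n))%C
  (fun t => spw (1 - t * z) (- b))%C (fun n => Cmod (binc b n) * q ^ n * E) (fun n => u n * (z - z0) ^ n)%C).
- simpl; lra.
- intros t Ht. now apply contC_beta_fun.
- intros t Ht. now apply BK.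
- now apply is_int_unit_bound.
- intros t Ht. apply contC_spw_affine. replace z with (z0 + 1%R * (z - z0))%C by ring. apply Hz; [exact Ht|lra].
- intros n t Ht. apply TB; [exact Ht|lra|now apply Hz].
- apply (ex_series_scal_r E). now apply ex_series_binc.
- intros t Ht. destruct (Hz t Ht) as [B S]. replace (1 - t * z)%C with (1 - t * z0 - t * (z - z0))%C by ring.
  apply (binomial_series_at b _ _ q Hq B). intros s Hs.
  replace (1 - t * z0 - s * (t * (z - z0)))%C with (1 - t * (z0 + s * (z - z0)))%C by ring. now apply S.
- intros n. eapply is_int_eq; [eapply is_int_ext; [|apply (is_int_scal _ _ ((z - z0) ^ n)%C _ _ (HU n))]|ring].
  intros t _. cbv beta. rewrite (Cpow_mult_l t). ring.
Qed.

Lemma beta_fun_sym p q l : is_int 0 1 (beta_fun p q) l -> is_int 0 1 (beta_fun q p) l.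
Proof.
intros H. apply is_int_reflect in H. eapply is_int_ext; [|exact H]. intros t _. unfold beta_fun.
replace (1 - (1 - t)) with t by ring. ring.
Qed.

Lemma beta_shift_left (p q : C) l n : 0 < fst p -> 0 < fst q -> is_int 0 1 (beta_fun p q) l ->
  is_int 0 1 (beta_fun (p + INR n) q) (poch p n / poch (p + q) n * l)%C.
Proof.
intros Hp Hq H. apply beta_fun_sym. rewrite (Cplus_comm p q). apply beta_shift_n; auto. now apply beta_fun_sym.
Qed.

Lemma pow_n_Cpow (z : C) n : @pow_n C_Ring z n = (z ^ n)%C.
Proof. induction n; simpl; [reflexivity|]. rewrite IHn. reflexivity. Qed.

Lemma is_pseries_limat (u : nat -> C) (z l : C) :
  @is_pseries C_AbsRing C_NormedModule u z l <-> limat eventually (sum_n (fun n => u n * z ^ n)%C) l.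
Proof.
assert (E : forall n, scal (pow_n (K := C_AbsRing) z n) (u n) = (u n * z ^ n)%C).
{ intros n. change (@pow_n C_AbsRing z n) with (@pow_n C_Ring z n). rewrite pow_n_Cpow. apply Cmult_comm. }
split; intros H.
- apply limat_is_series. unfold is_pseries in H. eapply is_series_ext; [|exact H]. exact E.
- apply is_series_limat in H. unfold is_pseries. eapply is_series_ext; [|exact H]. intros n. symmetry. apply E.
Qed.

Definition euler_integral (p gam b z : C) : C := epsilon (inhabits (RtoC 0)) (is_int 0 1 (euler_fun p gam b z)).

Lemma euler_integral_eq p gam b z L : is_int 0 1 (euler_fun p gam b z) L -> euler_integral p gam b z = L.
Proof.
intros H. apply (is_int_unique 0 1 (euler_fun p gam b z)); [simpl; lra| |exact H].
apply (epsilon_spec (inhabits (RtoC 0)) (is_int 0 1 (euler_fun p gam b z))). now exists L.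
Qed.

(** At z0 = 0 the local series converges in the whole unit disk, and the shift
    relation for Beta integrals identifies its coefficients. *)
Lemma euler_is_hyp2F1 (p gam b B : C) : 0 < fst p -> 0 < fst gam -> is_int 0 1 (beta_fun p gam) B -> B <> 0%C ->
  is_hyp2F1 p b (p + gam) (fun z => euler_integral p gam b z / B)%C.
Proof.
intros Hp Hg HB NB. split.
- intros z Hz. apply is_pseries_limat.
  assert (E1 : forall t : R, (1 - t * 0)%C = RtoC 1) by (intros; ring).
  destruct (euler_fun_local p gam b 0%C 1 Hp Hg Rlt_0_1) as [u [HU HL]].
  { intros t Ht. rewrite E1, Cmod_1. split; [apply slit_Re; simpl; lra|lra]. }
  assert (UE : forall n, u n = (binc b n * (poch p n / poch (p + gam) n * B))%C).
  { intros n. apply (is_int_unique 0 1 _ _ _ ltac:(simpl; lra) (HU n)).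
    eapply is_int_ext; [|apply (is_int_scal _ _ (binc b n) _ _ (beta_shift_left p gam B n Hp Hg HB))].
    intros t [Ht _]. cbv beta. unfold beta_fun. rewrite E1, spw_base_1. replace (p + INR n - 1)%C with (p - 1 + INR n)%C by ring.
    rewrite rpw_plus, rpw_nat, RtoC_pow by exact Ht. ring. }
  destruct (HL z (Cmod z)) as [L [HL1 HL2]].
  { split; [apply Cmod_ge_0|exact Hz]. }
  { intros t Ht. assert (A := Cmod_ge_0 z). rewrite E1, Cmod_1. replace (z - 0)%C with z by ring.
    rewrite Cmod_mult, Cmod_R, Rabs_pos_eq by lra. split; [nra|]. intros s Hs.
    replace (1 - t * (0 + s * z))%C with (1 - s * (t * z))%C by ring. apply slit_segment; [|exact Hs].
    rewrite Cmod_mult, Cmod_R, Rabs_pos_eq by lra. nra. }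
  rewrite (euler_integral_eq _ _ _ _ _ HL1).
  apply (limat_ext (fun n => / B * sum_n (fun n => u n * (z - 0) ^ n)%C n)%C).
  + apply filter_forall. intros n. rewrite <- sum_n_C_scal. apply sum_n_ext. intros k. rewrite UE.
    replace (z - 0)%C with z by ring. unfold binc. match goal with |- @eq _ ?p ?q => change (@eq C p q) end. field.
    repeat split; first [apply INR_fact_C | exact NB | apply poch_neq_0; simpl; lra].
  + replace (L / B)%C with (/ B * L)%C by (unfold Cdiv; ring). now apply limat_scal.
- intros z0 Hz0. destruct (off_cut_distance z0 Hz0) as [d [D0 HD]].
  destruct (off_cut_neighbourhood z0 Hz0) as [d' [D1 HD']].
  destruct (euler_fun_local p gam b z0 d Hp Hg D0) as [u [HU HL]].
  { intros t Ht. split; [now apply slit_off_cut|now apply HD]. }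
  exists (fun n => / B * u n)%C, (Rmin (d / 2) d'). split; [apply Rmin_pos; lra|].
  intros z Hz. apply is_pseries_limat.
  assert (Z1 := Rmin_l (d / 2) d'). assert (Z2 := Rmin_r (d / 2) d'). assert (A := Cmod_ge_0 (z - z0)%C).
  destruct (HL z (1/2)) as [L [HL1 HL2]]; [lra| |].
  { intros t Ht. specialize (HD t Ht). split.
    - rewrite Cmod_mult, Cmod_R, Rabs_pos_eq by lra. nra.
    - intros s Hs. apply slit_off_cut; [|exact Ht]. apply HD'. replace (z0 + s * (z - z0) - z0)%C with (s * (z - z0))%C by ring.
      rewrite Cmod_mult, Cmod_R, Rabs_pos_eq by lra. nra. }
  rewrite (euler_integral_eq _ _ _ _ _ HL1).
  apply (limat_ext (fun n => / B * sum_n (fun n => u n * (z - z0) ^ n)%C n)%C).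
  + apply filter_forall. intros n. rewrite <- sum_n_C_scal. apply sum_n_ext. intros k. cring.
  + replace (L / B)%C with (/ B * L)%C by (unfold Cdiv; ring). now apply limat_scal.
Qed.

(** * Uniqueness of the continuation on the negative axis *)

Lemma series_terms_bounded (u : nat -> C) L : limat eventually (sum_n u) L -> exists K, forall n, Cmod (u n) <= K.
Proof.
intros H. destruct (H 1 Rlt_0_1) as [N HN].
assert (P : forall M, 0 <= sum_n (fun n => Cmod (u n)) M) by (intros; apply sum_n_R_nonneg; intros; apply Cmod_ge_0).
assert (Q : forall M n, (n <= M)%nat -> Cmod (u n) <= sum_n (fun n => Cmod (u n)) M).
{ intros M n Hn. induction Hn as [|m Hm IH].
  - destruct n; [rewrite sum_O; lra|]. rewrite sum_Sn. specialize (P n).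
    change (Cmod (u (S n)) <= sum_n (fun n => Cmod (u n)) n + Cmod (u (S n))). lra.
  - rewrite sum_Sn. change (Cmod (u n) <= sum_n (fun n => Cmod (u n)) m + Cmod (u (S m))). assert (A := Cmod_ge_0 (u (S m))). lra. }
exists (2 + sum_n (fun n => Cmod (u n)) N). intros n.
destruct (Nat.le_gt_cases n N) as [L1|L1]; [specialize (Q N n L1); lra|].
destruct n as [|n]; [lia|].
assert (A1 := HN (S n) ltac:(lia)). assert (A2 := HN n ltac:(lia)). rewrite sum_Sn in A1.
replace (u (S n)) with ((sum_n u n + u (S n) - L) + - (sum_n u n - L))%C by cring.
eapply Rle_trans; [apply Cmod_triangle|]. rewrite Cmod_opp. specialize (P N).
change (plus (sum_n u n) (u (S n))) with (sum_n u n + u (S n))%C in A1. lra.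
Qed.

(** If |w n| s1^n <= K for all n, then at s = q s1 the terms of positive
    degree contribute at most K q / (1-q), which is arbitrarily small. *)
Lemma pseries_zero_head (w : nat -> C) r : 0 < r ->
  (forall s, 0 < s < r -> limat eventually (sum_n (fun n => w n * s ^ n)%C) 0%C) -> w 0%nat = 0%C.
Proof.
intros Hr H. apply Cmod_eq_0. apply Rle_antisym; [|apply Cmod_ge_0].
  set (s1 := r / 2). assert (S1 : 0 < s1) by (unfold s1; lra).
  destruct (series_terms_bounded _ _ (H s1 ltac:(unfold s1; lra))) as [K HK].
  assert (K0 : 0 <= K) by (eapply Rle_trans; [apply Cmod_ge_0|apply (HK 0%nat)]).
  apply le_epsilon. intros eps He. rewrite Rplus_0_l.
  (* The value for which K q / (1 - q) = eps K / (K + 1). *)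
  set (q := eps / (K + eps + 1)). assert (Q1 : 0 < q < 1).
  { unfold q. split; [apply Rdiv_lt_0_compat; lra|]. apply Rmult_lt_reg_r with (K + eps + 1); [lra|].
    replace (eps / (K + eps + 1) * (K + eps + 1)) with eps by (field; lra). lra. }
  assert (G : is_series (fun n => K * q ^ n) (K * / (1 - q))).
  { exact (is_series_scal K _ _ (is_series_geom q ltac:(rewrite Rabs_pos_eq; lra))). }
  assert (T := series_tail_le (fun n => w n * RtoC (q * s1) ^ n)%C (fun n => K * q ^ n) 0%C 0).
  rewrite !sum_O, (is_series_unique _ _ G) in T.
  replace (0 - w 0%nat * RtoC (q * s1) ^ 0)%C with (- w 0%nat)%C in T by (simpl; ring). rewrite Cmod_opp in T.
  eapply Rle_trans; [apply T|].
  + intros k. specialize (HK k). rewrite Cmod_mult, Cmod_pow, Cmod_R, Rabs_pos_eq in HK |- * by nra.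
    rewrite Rpow_mult_distr.
    replace (Cmod (w k) * (q ^ k * s1 ^ k)) with (Cmod (w k) * s1 ^ k * q ^ k) by ring.
    apply Rmult_le_compat_r; [apply pow_le; lra|exact HK].
  + eexists; exact G.
  + apply H. unfold s1. nra.
  + replace (K * q ^ 0) with (K * 1) by (simpl; ring).
    assert (E : 1 - q = (K + 1) / (K + eps + 1)) by (unfold q; field; lra).
    rewrite E, Rinv_div. replace (K * ((K + eps + 1) / (K + 1)) - K * 1) with (eps * (K / (K + 1))) by (field; lra).
    assert (K / (K + 1) <= 1) by (apply Rle_div_1; lra). nra.
Qed.

Lemma pseries_zero (w : nat -> C) r : 0 < r ->
  (forall s, 0 < s < r -> limat eventually (sum_n (fun n => w n * s ^ n)%C) 0%C) -> forall n, w n = 0%C.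
Proof.
intros Hr H n. revert w H. induction n; intros w H; [now apply (pseries_zero_head w r)|].
assert (W0 := pseries_zero_head w r Hr H).
apply (IHn (fun n => w (S n))). intros s Hs.
assert (Sn : RtoC s <> 0%C) by (intros E; apply RtoC_inj in E; lra).
assert (ST : forall N, sum_n (fun n => w n * s ^ n)%C (S N) = (s * sum_n (fun n => w (S n) * s ^ n)%C N)%C).
{ induction N.
  - rewrite sum_Sn, !sum_O, W0. change plus with Cplus. simpl. ring.
  - rewrite sum_Sn, IHN, sum_Sn. change plus with Cplus. simpl. cring. }
assert (L := limat_scal (/ s)%C _ _ (H s Hs)). replace (/ s * 0)%C with (RtoC 0) in L by ring.
intros eps P. destruct (L eps P) as [N0 HN]. exists N0. intros m Hm. specialize (HN (S m) ltac:(lia)).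
rewrite ST in HN. rewrite Cmult_assoc, Cinv_l, Cmult_1_l in HN by exact Sn. exact HN.
Qed.

Lemma off_cut_neg t : 0 <= t -> off_cut (- t)%C.
Proof. intros H [_ B]. unfold Re in B; simpl in B. lra. Qed.

(** Identity theorem along the negative axis. The two functions agree on (-1,
    0]. At the supremum of the T such that they agree on (-T, 0], the two
    local power series agree on one side, hence coincide. *)
Lemma hyp2F1_unique (a b c : C) F G x : is_hyp2F1 a b c F -> is_hyp2F1 a b c G -> 0 <= x ->
  F (- x)%C = G (- x)%C.
Proof.
intros [F1 F2] [G1 G2] Hx. set (h := fun t => F (- t)%C = G (- t)%C). change (h x).
assert (NEAR : forall t, 0 <= t < 1 -> h t).
{ intros t Ht. assert (M : Cmod (- t)%C < 1) by (rewrite Cmod_opp, Cmod_R, Rabs_pos_eq; lra).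
  assert (A := F1 _ M). assert (B := G1 _ M). apply is_pseries_limat in A. apply is_pseries_limat in B.
  exact (limat_unique _ _ _ A B). }
assert (STEP : forall T, 0 < T -> (forall t, 0 <= t < T -> h t) -> exists r, 0 < r /\ forall t, 0 <= t < T + r -> h t).
{ intros T HT H. destruct (F2 _ (off_cut_neg T ltac:(lra))) as [u [r1 [R1 U]]].
  destruct (G2 _ (off_cut_neg T ltac:(lra))) as [v [r2 [R2 V]]].
  set (r := Rmin (Rmin r1 r2) T).
  assert (R0 : 0 < r) by (apply Rmin_pos; [apply Rmin_pos; assumption|exact HT]).
  assert (RA : r <= r1) by (eapply Rle_trans; [apply Rmin_l|apply Rmin_l]).
  assert (RB : r <= r2) by (eapply Rle_trans; [apply Rmin_l|apply Rmin_r]).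
  assert (RT : r <= T) by apply Rmin_r.
  assert (D : forall t, Rabs (T - t) < r -> limat eventually (sum_n (fun n => (u n - v n) * RtoC (T - t) ^ n)%C) (F (- t) - G (- t))%C).
  { intros t Ht. assert (E : (- t - - RtoC T)%C = RtoC (T - t)) by (rewrite RtoC_minus; ring).
    assert (A := U (- t)%C). assert (B := V (- t)%C). rewrite E, Cmod_R in A, B.
    specialize (A ltac:(lra)). specialize (B ltac:(lra)). apply is_pseries_limat in A. apply is_pseries_limat in B.
    assert (S := limat_plus _ _ _ _ A (limat_scal (- (1))%C _ _ B)).
    replace (F (- t) - G (- t))%C with (F (- t) + - (1) * G (- t))%C by ring.
    eapply limat_ext; [|exact S]. apply filter_forall. intros n. cbv beta. rewrite <- sum_n_C_scal.
    change (Cplus (sum_n (fun n => u n * RtoC (T - t) ^ n)%C n) (sum_n (fun n => - (1) * (v n * RtoC (T - t) ^ n))%C n))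
     with (plus (sum_n (fun n => u n * RtoC (T - t) ^ n)%C n) (sum_n (fun n => - (1) * (v n * RtoC (T - t) ^ n))%C n)).
    rewrite <- sum_n_plus. apply sum_n_ext. intros k. change plus with Cplus. cring. }
  assert (W : forall n, (u n - v n)%C = 0%C).
  { apply (pseries_zero (fun n => u n - v n)%C r R0). intros s Hs.
    assert (Ds := D (T - s) ltac:(replace (T - (T - s)) with s by ring; rewrite Rabs_pos_eq; lra)).
    replace (T - (T - s)) with s in Ds by ring.
    replace (F (- RtoC (T - s)) - G (- RtoC (T - s)))%C with (RtoC 0) in Ds; [exact Ds|].
    assert (HS := H (T - s) ltac:(lra)). unfold h in HS. rewrite HS. ring. }
  exists r; split; [exact R0|]. intros t Ht. destruct (Rlt_dec t T) as [L|L]; [apply H; lra|].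
  assert (Dt := D t ltac:(apply Rabs_def1; lra)).
  assert (Z : limat eventually (sum_n (fun n => (u n - v n) * RtoC (T - t) ^ n)%C) 0%C).
  { apply (limat_ext (fun _ => RtoC 0)); [|apply limat_const]. apply filter_forall. intros n.
    induction n; [rewrite sum_O, W; ring|]. rewrite sum_Sn, <- IHn, W. change plus with Cplus. ring. }
  assert (E := limat_unique _ _ _ Dt Z). unfold h.
  replace (F (- t)%C) with (F (- t) - G (- t) + G (- t))%C by ring. rewrite E. ring. }
destruct (Rlt_dec x 1) as [L|L]; [apply NEAR; lra|].
set (E := fun T => 0 <= T <= x /\ forall t, 0 <= t < T -> h t).
destruct (completeness E) as [m [UB LUB]].
{ exists x. intros T [HT _]. lra. }
{ exists 0. split; [lra|]. intros; lra. }
assert (M1 : 1 <= m). { apply UB. split; [lra|]. intros; apply NEAR; lra. }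
assert (MX : m <= x). { apply LUB. intros T [HT _]. lra. }
assert (HM : forall t, 0 <= t < m -> h t).
{ intros t Ht. destruct (Classical_Prop.classic (exists T, E T /\ t < T)) as [[T [[_ HT] HtT]]|N]; [apply HT; lra|].
  exfalso. assert (m <= t); [|lra]. apply LUB. intros T HT. destruct (Rle_dec T t); [assumption|].
  exfalso; apply N. exists T; split; [exact HT|lra]. }
destruct (STEP m ltac:(lra) HM) as [r [R0 HR]].
assert (Q : Rmin x (m + r) <= m).
{ apply UB. split.
  - split; [apply Rmin_glb; lra|apply Rmin_l].
  - intros t Ht. apply HR. assert (A := Rmin_r x (m + r)). lra. }
assert (m = x).
{ unfold Rmin in Q. destruct (Rle_dec x (m + r)); lra. }
apply HR. lra.
Qed.

Lemma hyp2F1_euler (p gam b B : C) x : 0 < fst p -> 0 < fst gam -> is_int 0 1 (beta_fun p gam) B -> B <> 0%C -> 0 <= x ->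
  hyp2F1 p b (p + gam) (- x) = (euler_integral p gam b (- x) / B)%C.
Proof.
intros Hp Hg HB NB Hx. assert (H := euler_is_hyp2F1 p gam b B Hp Hg HB NB).
apply (hyp2F1_unique p b (p + gam)%C (hyp2F1 p b (p + gam)) (fun z => euler_integral p gam b z / B)%C x); [|exact H|exact Hx].
unfold hyp2F1. apply epsilon_spec. eexists; exact H.
Qed.

(** * Euler's integral for the Humbert function *)

Lemma beta_value (p q B : C) : 0 < fst p -> 0 < fst q -> is_int 0 1 (beta_fun p q) B ->
  B <> 0%C /\ (Cgamma p * Cgamma q)%C = (Cgamma (p + q) * B)%C.
Proof.
intros Hp Hq HB. assert (E := beta_gamma q p B Hq Hp HB). rewrite (Cplus_comm q p) in E.
split; [|rewrite <- E; ring]. intros Z. rewrite Z, Cmult_0_r in E.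
exact (Cmult_neq_0 _ _ (Cgamma_neq_0 q Hq) (Cgamma_neq_0 p Hp) E).
Qed.

Lemma CSeries_limat u l : limat eventually (sum_n u) l -> CSeries u = l.
Proof. intros H. apply CSeries_unique. now apply is_series_limat. Qed.

(** The n-th value of 2F1 is an integral divided by B(a+n,c-a), and (a)_n /
    (c)_n turns this denominator into the fixed B(a,c-a). What remains is the
    exponential series under the integral sign. *)
Lemma Phi1_euler (a b c y B : C) x : 0 < fst a -> 0 < fst (c - a)%C -> is_int 0 1 (beta_fun a (c - a)) B -> 0 <= x ->
  exists L, is_int 0 1 (fun t => beta_fun a (c - a) t * rpw (1 + x * t) (- b) * Cexp (y * t))%C L /\
    Phi1 a b c (- x) y = (L / B)%C.
Proof.
intros Ha Hg HB Hx. set (gam := (c - a)%C) in *. destruct (beta_value a gam B Ha Hg HB) as [NB _].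
assert (EC : forall n, (c + INR n)%C = (a + INR n + gam)%C) by (intros; unfold gam; ring).
assert (EC0 : c = (a + gam)%C) by (unfold gam; ring).
assert (SP : forall t, 0 < t < 1 -> spw (1 - t * - x)%C (- b)%C = rpw (1 + x * t) (- b)).
{ intros t Ht. replace (1 - t * - x)%C with (RtoC (1 + x * t)) by (rewrite RtoC_plus, RtoC_mult; ring).
  apply spw_RtoC. nra. }
assert (SL : forall t, 0 < t < 1 -> slit (1 - t * - x)%C).
{ intros t Ht. replace (1 - t * - x)%C with (RtoC (1 + x * t)) by (rewrite RtoC_plus, RtoC_mult; ring).
  apply slit_Re. simpl. nra. }
assert (DB : forall t, 0 < t < 1 -> 1 <= Cmod (1 - t * - x)%C).
{ intros t Ht. replace (1 - t * - x)%C with (RtoC (1 + x * t)) by (rewrite RtoC_plus, RtoC_mult; ring).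
  rewrite Cmod_R, Rabs_pos_eq by nra. nra. }
assert (AN : forall n, 0 < fst (a + INR n)%C) by (intros n; simpl; assert (P := pos_INR n); lra).
assert (HI : forall n, exists l, is_int 0 1 (euler_fun (a + INR n) gam b (- x)) l).
{ intros n. destruct (euler_fun_majorant (a + INR n)%C gam b (- x)%C 1 Rlt_0_1 DB) as [K [K0 HK]].
  apply (ex_int_unit _ _ _ K (AN n) Hg); [|exact HK]. intros t Ht. apply contC_euler_fun; auto. }
destruct (euler_fun_majorant a gam b (- x)%C 1 Rlt_0_1 DB) as [K [K0 HK]].
set (l := fun n => (expc y n * euler_integral (a + INR n) gam b (- x))%C).
assert (HL : forall n, is_int 0 1 (fun t => euler_fun a gam b (- x) t * expc (y * t) n)%C (l n)).
{ intros n. destruct (HI n) as [m Hm]. unfold l. rewrite (euler_integral_eq _ _ _ _ _ Hm).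
  eapply is_int_ext; [|apply is_int_scal; exact Hm]. intros t [Ht _]. unfold euler_fun, beta_fun, expc.
  replace (a + INR n - 1)%C with (a - 1 + INR n)%C by ring. rewrite rpw_plus, rpw_nat by exact Ht.
  rewrite Cpow_mult_l, RtoC_pow. unfold Cdiv. ring. }
destruct (is_int_series 0 1 (euler_fun a gam b (- x)) (fun t => K * unit_bound (fst a) (fst gam) t) (RtoC (K * (/ fst a + / fst gam)))
   (fun n t => expc (y * t) n) (fun t => Cexp (y * t))%C (fun n => Cmod y ^ n / INR (fact n)) l) as [L [HL1 HL2]].
- simpl; lra.
- intros t [Ht Ht1]; simpl in Ht1. apply contC_euler_fun; auto.
- intros t [Ht Ht1]; simpl in Ht1. now apply HK.
- now apply is_int_unit_bound.
- intros t _. assert (C0 := contC_Cexp_lin (- y)%C t). destruct C0 as [C1 C2].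
  apply (contC_ext_loc (fun s => Cexp (- - y * s))%C); [|split; assumption].
  apply filter_forall. intros s. f_equal. ring.
- intros n t [Ht Ht1]; simpl in Ht1. unfold expc. rewrite Cmod_div, Cmod_pow, Cmod_mult by apply INR_fact_C.
  rewrite !Cmod_R, (Rabs_pos_eq t), (Rabs_pos_eq (INR _)) by (try apply pos_INR; lra).
  apply Rmult_le_compat_r; [left; apply Rinv_0_lt_compat, lt_0_INR, lt_O_fact|].
  assert (Y0 := Cmod_ge_0 y). apply pow_incr. nra.
- exists (exp (Cmod y)). assert (H := is_exp_Reals (Cmod y)). apply is_pseries_R in H.
  eapply is_series_ext; [|exact H]. intros n. unfold Rdiv. apply Rmult_comm.
- intros t _. apply exp_series.
- exact HL.
- exists L. split.
  + eapply is_int_ext; [|exact HL1]. intros t [Ht Ht1]; simpl in Ht1. unfold euler_fun. now rewrite SP by lra.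
  + unfold Phi1. apply CSeries_limat.
    apply (limat_ext (fun n => / B * sum_n l n)%C).
    * apply filter_forall. intros n. rewrite <- sum_n_C_scal. apply sum_n_ext. intros k.
      rewrite EC, (hyp2F1_euler _ _ _ _ x (AN k) Hg (beta_shift_left a gam B k Ha Hg HB)); [|apply Cmult_neq_0; [|exact NB]|exact Hx].
      -- unfold l, expc. rewrite EC0. match goal with |- @eq _ ?p ?q => change (@eq C p q) end.
         field. repeat split; first [apply INR_fact_C | exact NB | apply poch_neq_0; simpl; simpl in Hg; lra].
      -- intros Z. assert (Z1 : (poch a k / poch (a + gam) k * poch (a + gam) k)%C = 0%C) by (rewrite Z; ring).
         assert (N2 : poch (a + gam)%C k <> 0%C) by (apply poch_neq_0; simpl; simpl in Hg; lra).
         replace (poch a k / poch (a + gam) k * poch (a + gam) k)%C with (poch a k) in Z1 by (field; exact N2).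
         revert Z1. apply poch_neq_0. exact Ha.
    * replace (L / B)%C with (/ B * L)%C by (unfold Cdiv; ring). now apply limat_scal.
Qed.

Lemma is_int_Kummer (al be z : C) : 0 < fst al -> 0 < fst z ->
  is_int 0 p_infty (fun u => rpw u (al - 1) * (rpw (1 + 1 * u) (be - al - 1) * Cexp (- z * u)))%C
    (Cgamma al * KummerU al be z)%C.
Proof.
intros Ha Hz.
set (f := fun u => (rpw u (al - 1) * (rpw (1 + 1 * u) (be - al - 1) * Cexp (- z * u)))%C).
assert (CF : forall t, 0 < t -> contC f t).
{ intros t Ht. apply contC_mult; [now apply contC_rpw|]. apply contC_mult; [|apply contC_Cexp_lin].
  eapply derivC_contC. apply (derivC_comp (fun s => rpw s (be - al - 1)) (fun t => 1 + 1 * t)).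
  - apply derivC_rpw. lra.
  - auto_derive; [trivial|reflexivity]. }
destruct (ex_int_half_line f (fst al) (fst z) (fst (be - al - 1)%C) 1 Ha Hz ltac:(lra) CF) as (_ & _ & _ & _ & l & Hl).
{ intros t Ht. unfold f. rewrite !Cmod_mult, !Cmod_rpw, Cmod_Cexp_lin. rewrite !Rmult_1_l. right. reflexivity. }
replace (Cgamma al * KummerU al be z)%C with l; [exact Hl|].
assert (E : forall t, 0 < t -> f t = (Cpower t (al - 1) * Cpower (1 + t) (be - al - 1) * Cexp (- z * t))%C).
{ intros t Ht. unfold f. rewrite <- (RtoC_plus 1 t), !Cpower_pos_real by lra. rewrite Rmult_1_l. ring. }
unfold KummerU. rewrite (is_int_CInt _ l).
- field. now apply Cgamma_neq_0.
- intros t Ht. apply (contC_ext_loc f); [|now apply CF]. generalize (open_gt 0 t Ht). apply filter_imp. exact E.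
- eapply is_int_ext; [|exact Hl]. intros t [Ht _]. now apply E.
Qed.

(** * The two expansions *)

(** The bound on the argument is a lower bound on Re lambda / |lambda|, hence
    on Re y / x. *)
Lemma lambda_region_facts delta l1 l2 x y : 0 < delta < PI / 2 -> 0 < l1 -> 0 < x -> lambda_region delta l1 l2 x y ->
  l1 * sin delta * x <= fst y /\ Cmod y <= l2 * x /\ 0 < fst (y / x)%C.
Proof.
intros Hd Hl Hx [HA [H1 H2]]. set (lam := (y / x)%C) in *.
assert (Xn : RtoC x <> 0%C) by (intros E; apply RtoC_inj in E; lra).
assert (EY : y = (x * lam)%C) by (unfold lam; field; exact Xn).
assert (S0 : 0 < sin delta) by (apply sin_gt_0; lra).
assert (CB : -1 <= Re lam / Cmod lam <= 1).
{ assert (A := re_le_Cmod lam). apply Rabs_le_between in A. split.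
  - apply Rmult_le_reg_r with (Cmod lam); [lra|]. replace (Re lam / Cmod lam * Cmod lam) with (Re lam) by (field; lra). lra.
  - apply Rmult_le_reg_r with (Cmod lam); [lra|]. replace (Re lam / Cmod lam * Cmod lam) with (Re lam) by (field; lra). lra. }
assert (CA : cos (Rabs (Carg lam)) = Re lam / Cmod lam).
{ unfold Carg. destruct (Rle_dec 0 (Im lam)).
  - rewrite Rabs_pos_eq by apply acos_bound. now apply cos_acos.
  - rewrite Rabs_Ropp, Rabs_pos_eq by apply acos_bound. now apply cos_acos. }
assert (CC : sin delta <= Re lam / Cmod lam).
{ rewrite <- CA, <- cos_shift. apply cos_decr_1; try lra; try apply Rabs_pos; lra. }
assert (RL : l1 * sin delta <= Re lam).
{ apply Rle_trans with (Cmod lam * sin delta); [apply Rmult_le_compat_r; lra|].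
  replace (Re lam) with (Cmod lam * (Re lam / Cmod lam)) by (field; lra). apply Rmult_le_compat_l; lra. }
unfold Re in RL. clearbody lam. repeat split.
- rewrite EY. simpl. nra.
- rewrite EY, Cmod_mult, Cmod_R, Rabs_pos_eq by lra. nra.
- nra.
Qed.

Lemma large_x K eta : 0 <= K -> 0 < eta -> Rbar_locally p_infty (fun x => 4 <= x /\ K * Rpower x (- (1/2)) <= eta).
Proof.
intros HK He. destruct (Rpower_small_infty (1/2) ltac:(lra) (eta / (K + 1)) ltac:(apply Rdiv_lt_0_compat; lra)) as [M HM].
exists (Rmax M 4). intros x Hx. assert (A := Rmax_l M 4). assert (B := Rmax_r M 4). split; [lra|].
specialize (HM x ltac:(lra)). assert (P := Rpower_pos x (- (1/2))).
assert (Rpower x (- (1/2)) * (K + 1) < eta).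
{ replace eta with (eta / (K + 1) * (K + 1)) by (field; lra). apply Rmult_lt_compat_r; lra. }
lra.
Qed.

(** The remainder O(x^(-Re a - N - 1/2)) is half a power smaller than the last
    term of the sum. *)
Lemma expansion_minus (a b c : C) (delta lambda1 lambda2 : R) :
  0 < fst a -> 0 < fst (c - a)%C -> 0 < delta < PI / 2 -> 0 < lambda1 ->
  poincare_expansion (lambda_region delta lambda1 lambda2)
    (fun x y => Phi1 a b c (- x) (- y))
    (fun x y => Cgamma c / Cgamma (c - a))%C
    (fun k x y => coef2 a b c (y / x) k)
    (fun k x y => Cpower x (- a - INR k)).
Proof.
intros Ha Hg Hd Hl N eps He. set (gam := (c - a)%C) in *.
destruct (ex_int_beta_fun a gam Ha Hg) as [B HB]. destruct (beta_value a gam B Ha Hg HB) as [NB EB].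
assert (Hc : (a + gam)%C = c) by (unfold gam; ring). rewrite Hc in EB.
assert (GA := Cgamma_neq_0 a Ha). assert (GG := Cgamma_neq_0 gam Hg).
set (mu := lambda1 * sin delta). assert (Mu : 0 < mu) by (apply Rmult_lt_0_compat; [exact Hl|apply sin_gt_0; lra]).
destruct (expansion_origin a gam b N mu Ha Hg Mu) as [K [K0 HK]].
assert (GA0 : 0 < Cmod (Cgamma a)) by now apply Cmod_gt_0.
assert (EV := large_x K (eps * Cmod (Cgamma a)) K0 ltac:(nra)).
revert EV. apply (filter_imp (F := Rbar_locally p_infty)). intros x [X4 HX] y HD.
destruct (lambda_region_facts delta lambda1 lambda2 x y Hd Hl ltac:(lra) HD) as [Y1 [Y2 Y3]].
destruct (Phi1_euler a b c (- y)%C B x Ha Hg HB ltac:(lra)) as [L [HL EL]]. rewrite EL.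
set (U := fun k => (Cgamma (a + INR k) * KummerU (a + INR k) (a - b + INR k + 1) (y / x))%C).
assert (H := HK x y L U ltac:(lra) Y1).
assert (D : Cmod (L - sum_n (fun k => binc (1 - gam) k * (rpw x (- (a + INR k)) * U k))%C N)%C
     <= K * Rpower x (- (fst a + INR N + 1/2))).
{ apply H.
  - eapply is_int_ext; [|exact HL]. intros t _. cbv beta. unfold kern. fold gam. ring.
  - intros k. assert (I := is_int_Kummer (a + INR k)%C (a - b + INR k + 1)%C (y / x)%C).
    eapply is_int_ext; [|apply I].
    + intros u _. unfold kern. do 3 f_equal. ring.
    + simpl. assert (P := pos_INR k). lra.
    + exact Y3. }
assert (GC : (Cgamma c / Cgamma gam)%C = (Cgamma a / B)%C).
{ transitivity (Cgamma c * B / (Cgamma gam * B))%C; [field; now split|]. rewrite <- EB. field. now split. }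
rewrite GC.
assert (SE : (Cgamma a * sum_n (fun k => (coef2 a b c (y / x) k * Cpower x (- a - INR k))%C) N)%C
   = sum_n (fun k => binc (1 - gam) k * (rpw x (- (a + INR k)) * U k))%C N).
{ rewrite <- sum_n_C_scal. apply sum_n_ext. intros k. unfold coef2, U, binc. rewrite Cgamma_poch by exact Ha.
  rewrite Cpower_pos_real by lra. replace (1 - gam)%C with (a - c + 1)%C by (unfold gam; ring).
  replace (- (a + INR k))%C with (- a - INR k)%C by ring. unfold Cdiv. cring. }
replace (L / B - Cgamma a / B * sum_n (fun k => (coef2 a b c (y / x) k * Cpower x (- a - INR k))%C) N)%C
  with ((L - Cgamma a * sum_n (fun k => (coef2 a b c (y / x) k * Cpower x (- a - INR k))%C) N) / B)%C by (unfold Cdiv; cring).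
rewrite SE, Cpower_pos_real by lra. rewrite !Cmod_mult, !Cmod_div, Cmod_rpw by exact NB.
assert (B0 : 0 < Cmod B) by now apply Cmod_gt_0.
replace (fst (- a - RtoC (INR N))%C) with (- (fst a + INR N)) by (simpl; ring).
apply Rmult_le_reg_r with (Cmod B); [exact B0|].
match goal with |- ?u / ?v * ?v <= _ => replace (u / v * v) with u by (field; lra) end.
eapply Rle_trans; [exact D|].
replace (eps * (Cmod (Cgamma a) / Cmod B * Rpower x (- (fst a + INR N))) * Cmod B)
  with (eps * Cmod (Cgamma a) * Rpower x (- (fst a + INR N))) by (field; lra).
replace (- (fst a + INR N + 1/2)) with (- (1/2) + - (fst a + INR N)) by ring. rewrite Rpower_plus, <- Rmult_assoc.
apply Rmult_le_compat_r; [left; apply Rpower_pos|exact HX].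
Qed.

(** The argument of y is bounded, so only its modulus matters up to a
    constant. *)
Lemma Cmod_spw_ge (y s : C) x l2 : 1 <= x -> 0 < l2 -> slit y -> Cmod y <= l2 * x -> fst s <= 0 ->
  exp (fst s * ln l2 - 4 * Rabs (snd s)) * Rpower x (fst s) <= Cmod (spw y s).
Proof.
intros Hx Hl S HY Hs. assert (Y0 := slit_Cmod y S). rewrite Cmod_spw. unfold Rpower. rewrite <- exp_plus. apply exp_le.
assert (L : ln (Cmod y) <= ln l2 + ln x). { rewrite <- ln_mult by lra. apply ln_le_0; lra. }
assert (T := atan_bound (snd y / (Cmod y + fst y))). assert (P4 := PI_4).
set (th := 2 * atan (snd y / (Cmod y + fst y))).
assert (TH : Rabs th <= 4) by (unfold th; apply Rabs_le; lra).
assert (X : snd s * th <= 4 * Rabs (snd s)).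
{ eapply Rle_trans; [apply Rle_abs|]. rewrite Rabs_mult. assert (Q := Rabs_pos (snd s)). nra. }
nra.
Qed.

(** The factor e^y x^(-b) and the constant B(a,c-a) are common to both sides,
    so the comparison reduces to [expansion_end] and a lower bound of
    |y^(a-c-N)|. *)
Lemma expansion_plus (a b c : C) (delta lambda1 lambda2 : R) :
  0 < fst a -> 0 < fst (c - a)%C -> 0 < delta < PI / 2 -> 0 < lambda1 ->
  poincare_expansion (lambda_region delta lambda1 lambda2)
    (fun x y => Phi1 a b c (- x) y)
    (fun x y => Cgamma c / Cgamma a * Cpower x (- b) * Cexp y)%C
    (fun k x y => coef1 a b c (y / x) k)
    (fun k x y => Cpower y (a - c - INR k)).
Proof.
intros Ha Hg Hd Hl N eps He. set (gam := (c - a)%C) in *.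
destruct (ex_int_beta_fun a gam Ha Hg) as [B HB]. destruct (beta_value a gam B Ha Hg HB) as [NB EB].
assert (Hc : (a + gam)%C = c) by (unfold gam; ring). rewrite Hc in EB.
assert (GA := Cgamma_neq_0 a Ha). assert (GG := Cgamma_neq_0 gam Hg).
set (mu := lambda1 * sin delta). assert (Mu : 0 < mu) by (apply Rmult_lt_0_compat; [exact Hl|apply sin_gt_0; lra]).
destruct (expansion_end a b c N mu Ha Hg Mu) as [K [K0 HK]]. fold gam in HK.
assert (GG0 : 0 < Cmod (Cgamma gam)) by now apply Cmod_gt_0.
set (s := (a - c - RtoC (INR N))%C).
assert (Es : fst s = - (fst gam + INR N)) by (unfold s, gam; simpl; ring).
assert (N0 := pos_INR N).
set (c0 := exp (fst s * ln lambda2 - 4 * Rabs (snd s))). assert (C0 : 0 < c0) by apply exp_pos.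
assert (EV := large_x K (eps * Cmod (Cgamma gam) * c0) K0 ltac:(apply Rmult_lt_0_compat; [nra|exact C0])).
revert EV. apply (filter_imp (F := Rbar_locally p_infty)). intros x [X4 HX] y HD.
destruct (lambda_region_facts delta lambda1 lambda2 x y Hd Hl ltac:(lra) HD) as [Y1 [Y2 Y3]].
assert (Y0 : 0 < fst y). { eapply Rlt_le_trans; [|exact Y1]. fold mu. nra. }
assert (SY : slit y) by now apply slit_Re.
assert (L20 : 0 < lambda2). { destruct HD as [_ [A1 A2]]. lra. }
destruct (Phi1_euler a b c y B x Ha Hg HB ltac:(lra)) as [L [HL EL]]. rewrite EL.
assert (R := is_int_reflect _ _ HL).
assert (XB : Cpower x (- b) = rpw x (- b)) by (apply Cpower_pos_real; lra).
assert (NE := Cexp_neq_0 y). assert (NR : rpw x (- b) <> 0%C) by apply Cexp_neq_0.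
set (g0 := (rpw x (- b) * Cexp y)%C). assert (G0 : g0 <> 0%C) by (apply Cmult_neq_0; assumption).
assert (D := HK x y (L / g0)%C X4 Y1).
assert (D' : Cmod (L / g0 - Cgamma gam * sum_n (fun k => coef1 a b c (y / x) k * spw y (a - c - INR k))%C N)%C
     <= K * Rpower x (- (fst gam + INR N + 1/2))).
{ apply D. clear D. apply (is_int_scal _ _ (/ g0)%C) in R.
  eapply is_int_eq; [eapply is_int_ext; [|exact R]|unfold Cdiv; ring].
  intros t [Ht Ht1]. simpl in Ht1. cbv beta. unfold beta_fun. fold gam.
  assert (IX : 0 < / x) by (apply Rinv_0_lt_compat; lra).
  replace (1 + x * (1 - t)) with (x * (1 - t + / x)) by (field; lra).
  rewrite rpw_mult by lra. replace (1 - (1 - t)) with t by ring.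
  replace (Cexp (y * RtoC (1 - t))) with (Cexp y * Cexp (- y * t))%C.
  2:{ rewrite <- Cexp_plus, RtoC_minus. f_equal. ring. }
  unfold g0. field. split; assumption. }
assert (GC : (Cgamma c / Cgamma a)%C = (Cgamma gam / B)%C).
{ transitivity (Cgamma c * B / (Cgamma a * B))%C; [field; now split|]. rewrite <- EB. field. now split. }
rewrite GC, XB.
rewrite (sum_n_ext (fun k => (coef1 a b c (y / x) k * Cpower y (a - c - INR k))%C)
  (fun k => (coef1 a b c (y / x) k * spw y (a - c - INR k))%C)) by (intros k; now rewrite Cpower_spw).
rewrite Cpower_spw by exact SY. fold s.
set (S := sum_n (fun k => (coef1 a b c (y / x) k * spw y (a - c - INR k))%C) N) in *.
replace (L / B - Cgamma gam / B * rpw x (- b) * Cexp y * S)%C with (g0 / B * (L / g0 - Cgamma gam * S))%C.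
2:{ unfold g0. field. repeat split; assumption. }
replace (Cgamma gam / B * rpw x (- b) * Cexp y * spw y s)%C with (g0 / B * (Cgamma gam * spw y s))%C by (unfold g0, Cdiv; ring).
rewrite (Cmod_mult (g0 / B)), (Cmod_mult (g0 / B)), (Cmod_mult (Cgamma gam)).
assert (SG := Cmod_spw_ge y s x lambda2 ltac:(lra) L20 SY Y2 ltac:(rewrite Es; lra)). fold c0 in SG. rewrite Es in SG.
replace (eps * (Cmod (g0 / B) * (Cmod (Cgamma gam) * Cmod (spw y s)))) with (Cmod (g0 / B) * (eps * Cmod (Cgamma gam) * Cmod (spw y s))) by ring.
apply Rmult_le_compat_l; [apply Cmod_ge_0|].
eapply Rle_trans; [exact D'|].
apply Rle_trans with (eps * Cmod (Cgamma gam) * (c0 * Rpower x (- (fst gam + INR N)))).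
- replace (- (fst gam + INR N + 1/2)) with (- (1/2) + - (fst gam + INR N)) by ring. rewrite Rpower_plus, <- !Rmult_assoc.
  apply Rmult_le_compat_r; [left; apply Rpower_pos|exact HX].
- apply Rmult_le_compat_l; [nra|exact SG].
Qed.

Local Open Scope C_scope.

Theorem theorem3p8 (a b c : C) (delta lambda1 lambda2 : R) :
  (0 < Re a < Re c)%R ->
  (0 < delta < PI / 2)%R ->
  (0 < lambda1)%R ->
  poincare_expansion (lambda_region delta lambda1 lambda2)
    (fun x y => Phi1 a b c (- RtoC x) y)
    (fun x y => Cgamma c / Cgamma a * Cpower (RtoC x) (- b) * Cexp y)
    (fun k x y => coef1 a b c (y / RtoC x) k)
    (fun k x y => Cpower y (a - c - RtoC (INR k)))
  /\
  poincare_expansion (lambda_region delta lambda1 lambda2)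
    (fun x y => Phi1 a b c (- RtoC x) (- y))
    (fun x y => Cgamma c / Cgamma (c - a))
    (fun k x y => coef2 a b c (y / RtoC x) k)
    (fun k x y => Cpower (RtoC x) (- a - RtoC (INR k))).
Proof.
intros [Ha Hac] Hd Hl. unfold Re in *.
assert (Hg : (0 < fst (c - a)%C)%R) by (simpl; lra).
split; [now apply expansion_plus|now apply expansion_minus].
Qed.
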